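(* Let $r\ge\beta_1(1)+1$ and let $\Delta=(\Delta x,\Delta t)$ satisfy the mesh conditions listed in the context. Suppose that $c\in[c_0,c_1]$ is associated with a KAM torus, with $\nu,\tau$-Diophantine rotation vector. Let $\bar u^{(c)}$ be the corresponding $\mathbb Z^2$-periodic $C^1$ entropy solution and let $\bar v^{(c)}$ be a $\mathbb Z^2$-periodic viscosity solution such that $\bar v^{(c)}_x=\bar u^{(c)}$. Then the space-time periodic difference solutions $\bar v^{(c)}_\Delta$ (with a suitable choice of its free additive constant) and $\bar u^{(c)}_\Delta$ satisfy $$\sup_{(x,t)\in\mathbb T^2}|\bar v^{(c)}_\Delta(x,t)-\bar v^{(c)}(x,t)|\le\beta_7\,\Delta x^{\frac1{2(1+\tau)}},\qquad\sup_{(x,t)\in\mathbb T^2}|\bar u^{(c)}_\Delta(x,t)-\bar u^{(c)}(x,t)|\le\beta_8\,\Delta x^{\frac1{4(1+\tau)}},$$ where $\beta_7$ and $\beta_8$ are independent of $\Delta$.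
   Context: $\mathbb T=\mathbb R/\mathbb Z$. $H=H(x,t,p):\mathbb T^2\times\mathbb R\to\mathbb R$ satisfies: (A1) $H$ is $C^2$; (A2) $H_{pp}>0$; (A3) $\lim_{|p|\to\infty}H(x,t,p)/|p|=+\infty$; (A4) the Legendre transform $L(x,t,\xi)=\sup_p\{\xi p-H(x,t,p)\}$ satisfies $|L_x|\le\alpha(|L|+1)$ for some $\alpha>0$. Put $L^{(c)}(x,t,\xi)=L(x,t,\xi)-c\xi$. Numbers $r>0$, $c_0\le c_1$ are fixed. $L^\infty_{r,0}(\mathbb T)$: all $u^0\in L^\infty(\mathbb T)$ with $\|u^0\|_{L^\infty}\le r$, $\int_{\mathbb T}u^0dx=0$. $Lip_r(\mathbb T)$: Lipschitz functions with Lipschitz constant at most $r$. Exact equations: $u_t+H(x,t,c+u)_x=0$ (entropy solutions) and $v_t+H(x,t,c+v_x)=h(c)$ (viscosity solutions), with $u=v_x$; $\phi^t(u^0;c)=u(\cdot,t)$ is the entropy solution with initial data $u^0$. $\bar h(c)$ is the unique value of $h(c)$ for which the second equation has a $\mathbb Z^2$-periodic viscosity solution; $\bar v^{(c)}$ is such a solution for $h(c)=\bar h(c)$. KAM torus: $c$ is associated with a KAM torus if there is a $\mathbb Z^2$-periodic entropy solution $\bar u^{(c)}$ of class $C^1$ such that the dynamics of the reduced characteristic curves $C^*(s)=(\gamma^*(s)\bmod1,\ s\bmod1)$, where $\gamma^{*\prime}(s)=H_p(\gamma^*(s),s,c+\bar u^{(c)}(\gamma^*(s),s))$ for $s\in\mathbb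 R$, is $C^1$-conjugate to a linear flow on $\mathbb T^2$ with Diophantine rotation vector: there exist a $C^1$-diffeomorphism $F:\mathbb T^2\to\mathbb T^2$ and $\omega=(\omega_1,\omega_2)\in\mathbb R^2$ such that every $C^*$ satisfies $C^*(s)=F(\omega s+\theta)$ for all $s$, with $\theta$ depending on $C^*(0)$, and $\omega$ (which is $(\omega_1,1)$, the rotation vector) satisfies the $\nu,\tau$-Diophantine condition $|\omega_1z_1+\omega_2z_2|\ge\nu\|z\|_1^{-\tau}$ for all $z\in\mathbb Z^2\setminus\{0\}$, where $\|z\|_1=|z_1|+|z_2|$. (For such $c$, $\bar u^{(c)}$ is the unique $\mathbb Z^2$-periodic entropy solution.) Mesh: $N\le K$ natural numbers, $\Delta x=(2N)^{-1}$, $\Delta t=(2K)^{-1}$, $\lambda=\Delta t/\Delta x$, $x_m=m\Delta x$, $t_k=k\Delta t$. Scheme: $u^k_m$ ($m+k$ even) satisfies $$\frac{u^{k+1}_{m+1}-\frac{u^k_m+u^k_{m+2}}2}{\Delta t}+\frac{H(x_{m+2},t_k,c+u^k_{m+2})-H(x_m,t_k,c+u^k_m)}{2\Delta x}=0,\quad u^k_{m\pm2N}=u^k_m,$$ $u^0_m=\frac1{2\Delta x}\int_{x_m-\Delta x}^{x_m+\Delta x}u^0dy$ ($m$ even); $u_\Delta(x,t)=u^k_m$ on $[x_{m-1},x_{m+1})\times[t_k,t_{k+1})$, $\phi^t_\Delta(u^0;c)=u_\Delta(\cdot,t)$. Also $v^k_m$ ($m+k$ odd) satisfies $$\frac{v^{k+1}_m-\frac{v^k_{m-1}+v^k_{m+1}}2}{\Delta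 t}+H\Big(x_m,t_k,c+\frac{v^k_{m+1}-v^k_{m-1}}{2\Delta x}\Big)=h(c),\quad v^k_{m+1\pm2N}=v^k_{m+1},$$ $v^0_{m+1}=v^0(x_{m+1})$ ($m$ even); $v_\Delta(x,t)=v^k_{m-1}+\frac{v^k_{m+1}-v^k_{m-1}}{2\Delta x}(x-x_{m-1})$ on $[x_{m-1},x_{m+1})\times[t_k,t_{k+1})$ ($m+k$ even), $\psi^t_\Delta(v^0;c)=v_\Delta(\cdot,t)$. Constants: $\beta_1(1)>0$ is a constant, independent of $r$, $c\in[c_0,c_1]$ and initial data, with $\|\phi^1(u^0;c)\|_{L^\infty}\le\beta_1(1)$ for all $c\in[c_0,c_1]$ and bounded zero-mean $u^0$. $0<\lambda_0<\lambda_1$ and $\delta>0$ are fixed constants such that for every mesh with $\lambda_0\le\lambda<\lambda_1$, $\Delta x\le\delta$, every $c\in[c_0,c_1]$ and $u^0\in L^\infty_{r,0}(\mathbb T)$: (i) $|H_p(x_m,t_k,c+u^k_m)|\le\lambda_1^{-1}<\lambda^{-1}$ for all $k\ge0$ and $m$ with $m+k$ even; (ii) $\|\phi^1_\Delta(u^0;c)\|_{L^\infty}\le\beta_1(1)+1$. (Such constants exist.) Notation: $u^*=\sup_{x,t\in\mathbb T,\,c\in[c_0,c_1],\,|\xi|\le\lambda_1^{-1}}|L^{(c)}_\xi(x,t,\xi)|$; $H^*_{xx}$, $H^*_{xp}$ are the suprema of $|H_{xx}(x,t,c+u)|$, $|H_{xp}(x,t,c+u)|$, and $H^*_{pp}>0$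 the infimum of $|H_{pp}(x,t,c+u)|$, over $x,t\in\mathbb T$, $c\in[c_0,c_1]$, $|u|\le u^*$; $\eta=\max\{2H^*_{xp}+H^*_{pp},\ \tfrac12H^*_{pp}+H^*_{xx}\}$; $E^*=\frac{2H^*_{xp}}{H^*_{pp}}+\sqrt{4\big(\frac{H^*_{xp}}{H^*_{pp}}\big)^2+\frac{2H^*_{xx}}{H^*_{pp}}}$. Mesh conditions on $\Delta$: $\lambda_0\le\lambda<\lambda_1$, $\Delta x\le\delta$, $\Delta t<\min\{(2\eta)^{-1},(E^*H^*_{pp}+2H^*_{xp})^{-1}\}$, and $$\sup_{x,t\in\mathbb T,\,c\in[c_0,c_1],\,|u|\le u^*}\lambda\big(|H_p(x,t,c+u)|+H^*_{xp}\cdot2\Delta x\big)<1,\qquad\lambda\le\frac{1-2H^*_{xp}\Delta t}{rH^*_{pp}+(1+H^*_{pp})\Delta x}.$$ Periodic difference solutions: for such $\Delta$ and $c$, $\phi^1_\Delta(\cdot;c)$ has a unique fixed point $\bar u^0_\Delta\in L^\infty_{r,0}(\mathbb T)$, and $\bar u^{(c)}_\Delta(\cdot,t)=\phi^t_\Delta(\bar u^0_\Delta;c)$; there is a unique constant $\bar h_\Delta(c)$ such that for $h(c)=\bar h_\Delta(c)$ the map $\psi^1_\Delta(\cdot;c)$ has a fixed point $\bar v^0_\Delta\in Lip_r(\mathbb T)$, unique up to additive constants, and $\bar v^{(c)}_\Delta(\cdot,t)=\psi^t_\Delta(\bar v^0_\Delta;c)$, with $(\bar v^{(c)}_\Delta)_x=\bar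 u^{(c)}_\Delta$. Both are $1$-periodic in $t$. *)

(* Defs.v *)
(* Mathematical Components with MathComp-Analysis; the reals are an arbitrary
   R : realType.

   Functions on T = R/Z or T^2 are represented by their 1-periodic lifts.
   Arguments are ordered (x, t) and (x, t, p). *)
From mathcomp Require Export all_boot all_order all_algebra.
From mathcomp Require Export all_classical all_reals all_analysis.

Set Implicit Arguments.
Unset Strict Implicit.
Unset Printing Implicit Defensive.

Export Order.TTheory GRing.Theory Num.Theory.
Export numFieldNormedType.Exports.

Local Open Scope classical_set_scope.
Local Open Scope ring_scope.

Section Definitions.
Context {R : realType}.

Local Notation leb := (@lebesgue_measure R).

(* Partial derivatives and classes C^1, C^2 *)

Definition fx (f : R -> R -> R) (x t : R) : R := derive1 (fun y => f y t) x.
Definition ft (f : R -> R -> R) (x t : R) : R := derive1 (fun s => f x s) t.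

Definition C1_2 (f : R -> R -> R) : Prop :=
  [/\ forall x t, derivable (fun y => f y t) x 1 /\
                  derivable (fun s => f x s) t 1,
      continuous (fun z : R * R => fx f z.1 z.2) &
      continuous (fun z : R * R => ft f z.1 z.2)].

Definition Dx (G : R -> R -> R -> R) (x t p : R) : R :=
  derive1 (fun y => G y t p) x.
Definition Dt (G : R -> R -> R -> R) (x t p : R) : R :=
  derive1 (fun s => G x s p) t.
Definition Dp (G : R -> R -> R -> R) (x t p : R) : R :=
  derive1 (fun q => G x t q) p.

Definition C1_3 (G : R -> R -> R -> R) : Prop :=
  [/\ forall x t p, [/\ derivable (fun y => G y t p) x 1,
                        derivable (fun s => G x s p) t 1 &
                        derivable (fun q => G x t q) p 1],
      continuous (fun z : R * R * R => Dx G z.1.1 z.1.2 z.2),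
      continuous (fun z : R * R * R => Dt G z.1.1 z.1.2 z.2) &
      continuous (fun z : R * R * R => Dp G z.1.1 z.1.2 z.2)].

Definition C2_3 (G : R -> R -> R -> R) : Prop :=
  [/\ C1_3 G, C1_3 (Dx G), C1_3 (Dt G) & C1_3 (Dp G)].

Definition Z2_periodic (f : R -> R -> R) : Prop :=
  (forall t, periodic (fun x => f x t) 1) /\ (forall x, periodic (f x) 1).

(* Hamiltonian and Lagrangian *)

Definition legendre (H : R -> R -> R -> R) (x t xi : R) : R :=
  sup [set xi * p - H x t p | p in [set: R]].

Record hamiltonian (H : R -> R -> R -> R) : Prop := Hamiltonian {
  ham_periodic : forall p, Z2_periodic (fun x t => H x t p) ;
  ham_C2 : C2_3 H ;
  ham_convex : forall x t p, 0 < Dp (Dp H) x t p ;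
  ham_superlinear : forall x t,
    (H x t p / `|p| @[p --> +oo] --> +oo) /\
    (H x t p / `|p| @[p --> -oo] --> +oo) ;
  ham_lagrangian : exists2 alpha : R, 0 < alpha &
    forall x t xi,
      `|Dx (legendre H) x t xi| <= alpha * (`|legendre H x t xi| + 1) }.

Definition Lc (H : R -> R -> R -> R) (c x t xi : R) : R :=
  legendre H x t xi - c * xi.

(* Function spaces on the circle *)

Definition Linf_norm (f : R -> R) : \bar R := ('N[leb]_+oo [EFin \o f])%E.

Definition Linf0 (f : R -> R) : Prop :=
  [/\ measurable_fun [set: R] f, periodic f 1, (Linf_norm f < +oo)%E &
      (\int[leb]_(x in `[0, 1]) f x) = 0].

Definition Linf_r0 (r : R) (f : R -> R) : Prop :=
  Linf0 f /\ (Linf_norm f <= r%:E)%E.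

Definition Lip_r (r : R) (f : R -> R) : Prop := periodic f 1 /\ r.-lipschitz f.

(* Entropy solutions of u_t + H(x, t, c + u)_x = 0, u(., 0) = u0 *)

Definition test_function (phi : R -> R -> R) : Prop :=
  let S := closure [set z : R * R | phi z.1 z.2 != 0] in
  [/\ C1_2 phi, forall x t, 0 <= phi x t, compact S &
      S `<=` [set z | 0 < z.2]].

Definition kruzhkov_inequality (H : R -> R -> R -> R) (c : R)
    (u : R -> R -> R) : Prop :=
  forall (k : R) (phi : R -> R -> R), test_function phi ->
  0 <= \int[(leb \x leb)%E]_(z in [set z : R * R | 0 < z.2])
     (let x := z.1 in let t := z.2 in
      `|u x t - k| * ft phi x t
      + Num.sg (u x t - k) * (H x t (c + u x t) - H x t (c + k)) * fx phi x t
      - Num.sg (u x t - k) * Dx H x t (c + k) * phi x t).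

Record entropy_solution (H : R -> R -> R -> R) (c : R) (u0 : R -> R)
    (u : R -> R -> R) : Prop := EntropySolution {
  ent_measurable : measurable_fun [set z : R * R | 0 <= z.2]
    (fun z : R * R => u z.1 z.2) ;
  ent_slice : forall t, 0 <= t -> measurable_fun [set: R] (fun x => u x t) ;
  ent_periodic : forall t, 0 <= t -> periodic (fun x => u x t) 1 ;
  ent_bounded : forall T : R, exists M : R, forall t, 0 <= t <= T ->
    (Linf_norm (fun x => u x t) <= M%:E)%E ;
  ent_L1_continuous : forall t, 0 <= t ->
    (\int[leb]_(x in `[0, 1]) `|u x s - u x t|)
      @[s --> within [set s : R | 0 <= s] (nbhs t)] --> (0 : R) ;
  ent_initial : {ae leb, forall x, u x 0 = u0 x} ;
  ent_kruzhkov : kruzhkov_inequality H c u }.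

Definition periodic_entropy_solution (H : R -> R -> R -> R) (c : R)
    (u : R -> R -> R) : Prop :=
  Z2_periodic u /\ entropy_solution H c (fun x => u x 0) u.

(* Viscosity solutions of v_t + H(x, t, c + v_x) = h *)

Definition viscosity_solution (H : R -> R -> R -> R) (c h : R)
    (v : R -> R -> R) : Prop :=
  [/\ continuous (fun z : R * R => v z.1 z.2),
      forall (phi : R -> R -> R) (x t : R), C1_2 phi ->
        (\forall z \near (x, t),
           v z.1 z.2 - phi z.1 z.2 <= v x t - phi x t) ->
        ft phi x t + H x t (c + fx phi x t) <= h &
      forall (phi : R -> R -> R) (x t : R), C1_2 phi ->
        (\forall z \near (x, t),
           v x t - phi x t <= v z.1 z.2 - phi z.1 z.2) ->
        h <= ft phi x t + H x t (c + fx phi x t)].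

Definition periodic_viscosity_solution (H : R -> R -> R -> R) (c h : R)
    (v : R -> R -> R) : Prop :=
  Z2_periodic v /\ viscosity_solution H c h v.

(* KAM tori *)

Definition torus_eq (a b : R * R) : Prop :=
  (a.1 - b.1 \is a Num.int) /\ (a.2 - b.2 \is a Num.int).

(* F : R^2 -> R^2 is a lift of a C^1 map of T^2 *)
Definition torus_C1_map (F : R * R -> R * R) : Prop :=
  [/\ forall a b, torus_eq a b -> torus_eq (F a) (F b),
      C1_2 (fun x y => (F (x, y)).1) &
      C1_2 (fun x y => (F (x, y)).2)].

Definition torus_C1_diffeo (F : R * R -> R * R) : Prop :=
  torus_C1_map F /\
  exists G, [/\ torus_C1_map G, forall a, torus_eq (G (F a)) a &
                forall a, torus_eq (F (G a)) a].

Definition diophantine (nu tau : R) (omega : R * R) : Prop :=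
  [/\ 0 < nu, 0 < tau &
      forall z1 z2 : int, (z1, z2) != (0, 0) ->
        nu * ((`|z1| + `|z2|)%:~R `^ (- tau))
          <= `|omega.1 * z1%:~R + omega.2 * z2%:~R|].

(* gamma is a lift of the x-component of the reduced characteristic curve *)
Definition characteristic (H : R -> R -> R -> R) (c : R) (u : R -> R -> R)
    (gamma : R -> R) : Prop :=
  forall s : R, is_derive s 1 gamma (Dp H (gamma s) s (c + u (gamma s) s)).

Definition KAM_torus (H : R -> R -> R -> R) (c nu tau : R)
    (u : R -> R -> R) : Prop :=
  [/\ periodic_entropy_solution H c u, C1_2 u &
      exists (F : R * R -> R * R) (omega : R * R),
        [/\ torus_C1_diffeo F, omega.2 = 1, diophantine nu tau omega &
            forall gamma, characteristic H c u gamma ->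
              exists theta : R * R, forall s : R,
                torus_eq (gamma s, s)
                  (F (omega.1 * s + theta.1, omega.2 * s + theta.2))]].

(* Mesh and difference schemes *)

Definition dx (N : nat) : R := (2 * N%:R)^-1.
Definition dt (K : nat) : R := (2 * K%:R)^-1.
Definition lam (N K : nat) : R := dt K / dx N.
Definition xm (N : nat) (m : int) : R := m%:~R * dx N.
Definition tk (K k : nat) : R := k%:R * dt K.

Definition even_node (k : nat) (m : int) : bool := (2 %| m + k%:Z)%Z.

(* Grid functions are indexed by all (k, m), but only the nodes with m + k even
   (for u), respectively odd (for v), are constrained or used. *)

Definition u_scheme (H : R -> R -> R -> R) (c : R) (N K : nat) (u0 : R -> R)
    (u : nat -> int -> R) : Prop :=
  [/\ forall k m, even_node k m ->
        (u k.+1 (m + 1) - (u k m + u k (m + 2)) / 2) / dt K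
        + (H (xm N (m + 2)) (tk K k) (c + u k (m + 2))
           - H (xm N m) (tk K k) (c + u k m)) / (2 * dx N) = 0,
      forall k m, even_node k m -> u k (m + (2 * N)%:Z) = u k m &
      forall m, even_node 0 m ->
        u 0%N m = (2 * dx N)^-1 *
          \int[leb]_(y in `[xm N m - dx N, xm N m + dx N]) u0 y].

Definition u_step (N K : nat) (u : nat -> int -> R) (U : R -> R -> R) : Prop :=
  forall (k : nat) (m : int) (x t : R), even_node k m ->
    xm N (m - 1) <= x < xm N (m + 1) -> tk K k <= t < tk K k.+1 ->
    U x t = u k m.

(* U x t = (phi_Delta^t(u0; c))(x) for t >= 0 *)
Definition is_phi_Delta (H : R -> R -> R -> R) (c : R) (N K : nat)
    (u0 : R -> R) (U : R -> R -> R) : Prop :=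
  exists u, u_scheme H c N K u0 u /\ u_step N K u U.

Definition v_scheme (H : R -> R -> R -> R) (c h : R) (N K : nat)
    (v0 : R -> R) (v : nat -> int -> R) : Prop :=
  [/\ forall k m, even_node k m ->
        (v k.+1 m - (v k (m - 1) + v k (m + 1)) / 2) / dt K
        + H (xm N m) (tk K k) (c + (v k (m + 1) - v k (m - 1)) / (2 * dx N))
        = h,
      forall k m, even_node k m ->
        v k (m + 1 + (2 * N)%:Z) = v k (m + 1) &
      forall m, even_node 0 m -> v 0%N (m + 1) = v0 (xm N (m + 1))].

Definition v_interp (N K : nat) (v : nat -> int -> R) (V : R -> R -> R) :
    Prop :=
  forall (k : nat) (m : int) (x t : R), even_node k m ->
    xm N (m - 1) <= x < xm N (m + 1) -> tk K k <= t < tk K k.+1 ->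
    V x t = v k (m - 1)
            + (v k (m + 1) - v k (m - 1)) / (2 * dx N) * (x - xm N (m - 1)).

(* V x t = (psi_Delta^t(v0; c))(x) for t >= 0 *)
Definition is_psi_Delta (H : R -> R -> R -> R) (c h : R) (N K : nat)
    (v0 : R -> R) (V : R -> R -> R) : Prop :=
  exists v, v_scheme H c h N K v0 v /\ v_interp N K v V.

Definition periodic_u_Delta (H : R -> R -> R -> R) (c r : R) (N K : nat)
    (U : R -> R -> R) : Prop :=
  exists u0, [/\ Linf_r0 r u0, is_phi_Delta H c N K u0 U &
                 {ae leb, forall x, U x 1 = u0 x}].

Definition periodic_v_Delta (H : R -> R -> R -> R) (c r h : R) (N K : nat)
    (V : R -> R -> R) : Prop :=
  exists v0, [/\ Lip_r r v0, is_psi_Delta H c h N K v0 V &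
                 forall x, V x 1 = v0 x].

(* Constants *)

Definition beta1_bound (H : R -> R -> R -> R) (c0 c1 beta1 : R) : Prop :=
  forall (c : R) (u0 : R -> R) (u : R -> R -> R), c0 <= c <= c1 -> Linf0 u0 ->
    entropy_solution H c u0 u -> (Linf_norm (fun x => u x 1%R) <= beta1%:E)%E.

Definition stability_bounds (H : R -> R -> R -> R)
    (r c0 c1 beta1 lambda0 lambda1 delta : R) : Prop :=
  forall (N K : nat), (0 < N <= K)%N ->
    lambda0 <= lam N K < lambda1 -> dx N <= delta ->
    forall (c : R) (u0 : R -> R), c0 <= c <= c1 -> Linf_r0 r u0 ->
    (forall u, u_scheme H c N K u0 u ->
      forall k m, even_node k m ->
        `|Dp H (xm N m) (tk K k) (c + u k m)| <= lambda1^-1 < (lam N K)^-1) /\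
    (forall U, is_phi_Delta H c N K u0 U ->
      (Linf_norm (fun x => U x 1%R) <= (beta1 + 1)%:E)%E).

Definition u_star (H : R -> R -> R -> R) (c0 c1 lambda1 : R) : R :=
  sup [set y | exists x t c xi, [/\ c0 <= c <= c1, `|xi| <= lambda1^-1 &
                                    y = `|Dp (Lc H c) x t xi|]].

Definition strip_values (c0 c1 us : R) (G : R -> R -> R -> R) : set R :=
  [set y | exists x t c u, [/\ c0 <= c <= c1, `|u| <= us &
                               y = G x t (c + u)]].

Definition Hxx_star (H : R -> R -> R -> R) (c0 c1 lambda1 : R) : R :=
  sup (strip_values c0 c1 (u_star H c0 c1 lambda1)
         (fun x t p => `|Dx (Dx H) x t p|)).

Definition Hxp_star (H : R -> R -> R -> R) (c0 c1 lambda1 : R) : R :=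
  sup (strip_values c0 c1 (u_star H c0 c1 lambda1)
         (fun x t p => `|Dp (Dx H) x t p|)).

Definition Hpp_star (H : R -> R -> R -> R) (c0 c1 lambda1 : R) : R :=
  inf (strip_values c0 c1 (u_star H c0 c1 lambda1)
         (fun x t p => `|Dp (Dp H) x t p|)).

Definition eta_const (H : R -> R -> R -> R) (c0 c1 lambda1 : R) : R :=
  let hxx := Hxx_star H c0 c1 lambda1 in
  let hxp := Hxp_star H c0 c1 lambda1 in
  let hpp := Hpp_star H c0 c1 lambda1 in
  Num.max (2 * hxp + hpp) (2^-1 * hpp + hxx).

Definition E_star (H : R -> R -> R -> R) (c0 c1 lambda1 : R) : R :=
  let hxx := Hxx_star H c0 c1 lambda1 in
  let hxp := Hxp_star H c0 c1 lambda1 in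
  let hpp := Hpp_star H c0 c1 lambda1 in
  2 * hxp / hpp + Num.sqrt (4 * (hxp / hpp) ^+ 2 + 2 * hxx / hpp).

(* The inverse in mesh_dt is taken in \bar R, where 0^-1 = +oo: the quantity
   E^* H^*_pp + 2 H^*_xp vanishes when H does not depend on x. *)
Record mesh_conditions (H : R -> R -> R -> R)
    (r c0 c1 lambda0 lambda1 delta : R) (N K : nat) : Prop := MeshConditions {
  mesh_nat : (0 < N <= K)%N ;
  mesh_lambda : lambda0 <= lam N K < lambda1 ;
  mesh_dx : dx N <= delta ;
  mesh_dt : ((dt K)%:E < Order.min
    (((2 * eta_const H c0 c1 lambda1)%:E)^-1)
    (((E_star H c0 c1 lambda1 * Hpp_star H c0 c1 lambda1
       + 2 * Hxp_star H c0 c1 lambda1)%:E)^-1))%E ;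
  mesh_CFL : sup (strip_values c0 c1 (u_star H c0 c1 lambda1)
    (fun x t p => lam N K *
       (`|Dp H x t p| + Hxp_star H c0 c1 lambda1 * (2 * dx N)))) < 1 ;
  mesh_slope : lam N K <=
    (1 - 2 * Hxp_star H c0 c1 lambda1 * dt K)
    / (r * Hpp_star H c0 c1 lambda1
       + (1 + Hpp_star H c0 c1 lambda1) * dx N) }.

End Definitions.

(* Main.v *)
Require Import Defs.
From mathcomp Require Import measurable_realfun ess_sup_inf ring lra zify.

(** The nodal error $e=v_\Delta-\bar v$ is compared with the exact solution along its own
    characteristics.  Convexity of $H$ at the exact slope makes $e$ a subsolution of a
    linear averaging scheme whose drift is $b=H_p(x,t,c+\bar u)$, convexity at the discrete
    slope makes $-e$ a subsolution of one with the discrete drift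
    (error_upper_step, error_lower_step); both are monotone as soon as the drifts are at
    most $\lambda^{-1}$.  Comparing extrema over one period, the maximum principle gives
    $|\bar h_\Delta-\bar h|\le C\Delta x$ (effective_constant_error).

    Run backwards, the averaging scheme with drift $b$ is a random walk that follows a
    characteristic $\gamma$ up to $O(\sqrt{\Delta x})$ in mean square over unit time.  Since
    $e$ is Lipschitz in $x$ and periodic in $t$, this gives
    $e(\gamma(j+1))\le e(\gamma(j))+C\sqrt{\Delta x}$ (second_moment_step, block_estimate,
    orbit_estimate).  On a KAM torus the points $\gamma(j)$, $j\le CQ^\tau$, are $C/Q$-dense
    in the circle: the conjugacy carries over the covering rate of a Diophantine rotation,
    which follows from the approximation of $\omega_1$ by one reduced fraction
    (diophantine_orbit_dense, kam_orbit_dense).  Hence the oscillation of $e$ is at most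
    $C(Q^\tau\sqrt{\Delta x}+1/Q)$, and $Q=\Delta x^{-1/(2(1+\tau))}$ balances the two terms
    (initial_oscillation, error_oscillation).

    The slopes $u_\Delta$ are one-sided Lipschitz, $u^k_{m+2}-u^k_m\le C\Delta x$, by uniform
    convexity of $H$ (jump_bound).  A slope error $\epsilon$ at a point therefore persists
    over a length of order $\epsilon$ and produces a value error of order $\epsilon^2$; so
    the slope error is at most $C$ times the square root of the value error
    (slope_error, grid_convergence).

    Three points remain.  The viscosity solution $\bar v$ has to satisfy its equation in an
    integrated sense with $O(d^2)$ errors, which is extracted from the test function
    inequalities (test_functions_bound_increment, regular_solution_exists).  The exact drift
    has to satisfy the bound $\lambda_1^{-1}$ that the stability hypothesis only states for
    difference solutions: the scheme started at $\bar v(\cdot,0)$ on refined meshes converges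
    as long as the exact drift is below $\lambda^{-1}$, whence the exact drift
    inherits the stricter bound $\lambda_1^{-1}$ and the time interval extends
    (slopes_reach, speed_bound); the initial bound $|\bar u|\le r$ is the universal bound
    after time one, by periodicity (periodic_slice_bound).  And the two fixed point problems
    are reduced to periodic grid solutions of the scheme for $v$
    (periodic_v_grid, periodic_u_grid, periodic_primitive). *)

Set Implicit Arguments.
Unset Strict Implicit.
Unset Printing Implicit Defensive.
Local Open Scope classical_set_scope.
Local Open Scope ring_scope.

(** * Elementary calculus and periodic functions *)

Section Calculus.
Context {R : realType}.
Implicit Types (f df : R -> R) (a b x y z w h C : R).

Lemma mvt f df a b : a <= b ->
    (forall x, a <= x <= b -> is_derive x 1 f (df x)) ->
  exists2 x, a <= x <= b & f b - f a = df x * (b - a).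
Proof.
move=> ab fdf.
have [||x] := @MVT_segment R f df a b ab.
- by move=> x; rewrite in_itv /= => /andP[/ltW ax /ltW xb]; apply: fdf; rewrite ax.
- apply: derivable_within_continuous => x; rewrite in_itv /= => /fdf fx.
  exact: (@ex_derive _ _ _ _ _ _ _ fx).
- by rewrite in_itv /=; exists x.
Qed.

(** Without its tangent at $x$ and the quadratic $h/2\,(y-x)^2$, the function has a
    nondecreasing derivative that vanishes at $x$, where it is therefore minimal.  The
    number $h$ may have either sign, so that convexity, Taylor and semiconvexity estimates
    are all instances. *)
Lemma tangent_below f df h a b x y :
    (forall z, a <= z <= b -> is_derive z 1 f (df z)) ->
    (forall z w, a <= z -> z <= w -> w <= b -> h * (w - z) <= df w - df z) ->
    a <= x <= b -> a <= y <= b ->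
  f x + df x * (y - x) + h / 2 * (y - x) ^+ 2 <= f y.
Proof.
move=> fdf dfh /andP[ax xb] /andP[ay yb].
pose g z := f z - df x * (z - x) - h / 2 * (z - x) ^+ 2.
pose dg z := df z - df x - h * (z - x).
have gdg z : a <= z <= b -> is_derive z 1 g (dg z).
  move=> /fdf fz; rewrite /g /dg; apply: is_derive_eq.
  rewrite /GRing.scale /=; lra.
suff : g x <= g y by rewrite /g subrr mulr0 expr2 mulr0 mulr0; lra.
have [xy|yx] := leP x y.
  have [|z /andP[xz zy] gE] := @mvt g dg x y xy.
  - by move=> z /andP[xz zy]; apply: gdg; rewrite (le_trans ax xz) (le_trans zy yb).
  rewrite -subr_ge0 gE mulr_ge0 ?subr_ge0 //.
  by rewrite /dg; have := dfh x z ax xz (le_trans zy yb); lra.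
have [|z /andP[yz zx] gE] := @mvt g dg y x (ltW yx).
- by move=> z /andP[yz zx]; apply: gdg; rewrite (le_trans ay yz) (le_trans zx xb).
rewrite -subr_le0 gE mulr_le0_ge0 ?subr_ge0 ?(ltW yx) //.
by rewrite /dg; have := dfh z x (le_trans ay yz) zx xb; lra.
Qed.

Lemma derivative_bound_lipschitz f df C a b x y :
    (forall z, a <= z <= b -> is_derive z 1 f (df z)) ->
    (forall z, a <= z <= b -> `|df z| <= C) ->
    a <= x <= b -> a <= y <= b -> `|f x - f y| <= C * `|x - y|.
Proof.
wlog yx : x y / y <= x.
  move=> wl fdf dfC xab yab; have [yx|/ltW xy] := leP y x; first exact: wl.
  by rewrite distrC (distrC x); apply: wl.
move=> fdf dfC /andP[ax xb] /andP[ay yb].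
have sub z : y <= z <= x -> a <= z <= b.
  by move=> /andP[yz zx]; rewrite (le_trans ay yz) (le_trans zx xb).
have [|z zxy ->] := @mvt f df y x yx; first by move=> z /sub/fdf.
by rewrite normrM ler_wpM2r// dfC// sub.
Qed.

Lemma bounded_derivative_lipschitz f df C x y :
    (forall z, is_derive z 1 f (df z)) -> (forall z, `|df z| <= C) ->
  `|f x - f y| <= C * `|x - y|.
Proof.
move=> fdf dfC.
apply: (@derivative_bound_lipschitz f df C (Num.min x y) (Num.max x y)) => //.
- by rewrite ge_min le_max !lexx.
- by rewrite ge_min le_max !lexx !orbT.
Qed.

(** The second order Taylor bound: the quadratic $\pm C/2\,|y-x|^2$ makes $\pm f$
    convex, so that both graphs lie above their tangents. *)
Lemma lipschitz_derivative_taylor f df C x y :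
    (forall z, is_derive z 1 f (df z)) ->
    (forall z w, `|df z - df w| <= C * `|z - w|) ->
  `|f y - f x - df x * (y - x)| <= C / 2 * (y - x) ^+ 2.
Proof.
move=> fdf dfC.
pose a := Num.min x y; pose b := Num.max x y.
have xab : a <= x <= b by rewrite ge_min le_max lexx.
have yab : a <= y <= b by rewrite ge_min le_max lexx !orbT.
have P z w : a <= z -> z <= w -> w <= b -> - C * (w - z) <= df w - df z.
  by move=> _ zw _; have := dfC w z; rewrite (ger0_norm (_ : 0 <= w - z)) ?subr_ge0// ler_norml => /andP[]; lra.
have Q z w : a <= z -> z <= w -> w <= b -> - C * (w - z) <= - df w - - df z.
  by move=> _ zw _; have := dfC w z; rewrite (ger0_norm (_ : 0 <= w - z)) ?subr_ge0// ler_norml => /andP[]; lra.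
have := tangent_below (fun z _ => fdf z) P xab yab.
have fdfN z : is_derive z 1 (fun x => - f x) (- df z) by apply: is_deriveN.
have := tangent_below (fun z _ => fdfN z) Q xab yab.
by rewrite ler_norml => ? ?; apply/andP; split; lra.
Qed.

Lemma second_difference_below f df C a b x d :
    (forall z, a <= z <= b -> is_derive z 1 f (df z)) ->
    (forall z w, a <= z -> z <= w -> w <= b -> - C * (w - z) <= df w - df z) ->
    0 <= d -> a <= x - d -> x + d <= b ->
  - C * d ^+ 2 <= f (x + d) + f (x - d) - 2 * f x.
Proof.
move=> fdf dfC d0 axd xdb.
have xab : a <= x <= b by apply/andP; split; lra.
have [pab mab] : a <= x + d <= b /\ a <= x - d <= b by split; apply/andP; split; lra.
have := tangent_below fdf dfC xab pab; have := tangent_below fdf dfC xab mab.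
have -> : x + d - x = d by rewrite addrAC subrr add0r.
have -> : x - d - x = - d by rewrite addrAC subrr add0r.
rewrite sqrrN; set D := df x; set e := d ^+ 2.
by move=> h1 h2; rewrite -subr_ge0; lra.
Qed.

End Calculus.

Section Periodic.
Context {R : realType}.

Lemma periodicz (f : R -> R) : periodic f 1 -> forall (z : int) x, f (x + z%:~R) = f x.
Proof.
move=> pf [n|n] x.
- exact: (periodicn pf n x).
- rewrite -[in RHS](subrK n.+1%:R x); symmetry; rewrite NegzE rmorphN /=.
  exact: (periodicn pf n.+1 (x - n.+1%:R)).
Qed.

Lemma periodic_frac (f : R -> R) : periodic f 1 -> forall x,
  exists2 y, 0 <= y <= 1 & f x = f y.
Proof.
move=> pf x; have /andP[fl fu] := floor_itv x.
exists (x - (Num.floor x)%:~R).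
  by move: fu; rewrite rmorphD/= => fu; apply/andP; split; lra.
by rewrite -[in LHS](subrK (Num.floor x)%:~R x) periodicz.
Qed.

Lemma derive1_periodic (f : R -> R) : periodic f 1 -> periodic (derive1 f) 1.
Proof.
move=> pf x; rewrite /derive1.
suff -> : (fun h => h^-1 *: (f (h + (x + 1)) - f (x + 1))) = (fun h => h^-1 *: (f (h + x) - f x)) by [].
by apply/funext => h; rewrite addrA !pf.
Qed.

Lemma Z2_periodic_bounded (f : R -> R -> R) : Z2_periodic f ->
  continuous (fun z : R * R => f z.1 z.2) -> exists C, forall x t, `|f x t| <= C.
Proof.
move=> [px pt] cf.
have cK : compact (`[0, 1]%classic `*` `[0, 1]%classic : set (R * R)).
  by apply: compact_setX; exact: segment_compact.
have cg : continuous (fun z : R * R => `|f z.1 z.2|).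
  by move=> z; apply: continuous_comp; [exact: cf|exact: norm_continuous].
have [||[a b] _ /= M] := @compact_EVT_max _ _ (fun z : R * R => `|f z.1 z.2|) _ _ cK.
- by exists (0, 0); split; rewrite /= in_itv/= lexx ler01.
- exact: continuous_subspaceT.
exists `|f a b| => x t.
have [y y01 ->] := periodic_frac (px t) x; have [s s01 ->] := periodic_frac (pt y) t.
by apply: (M (y, s)); rewrite inE; split => /=; rewrite in_itv.
Qed.

Lemma Z2_periodic_strip_max (G : R -> R -> R -> R) (P : R) : 0 <= P ->
    (forall p, Z2_periodic (fun x t => G x t p)) ->
    continuous (fun z : R * R * R => G z.1.1 z.1.2 z.2) ->
  exists x0 t0 p0, [/\ `|p0| <= P &
    forall x t p, `|p| <= P -> G x t p <= G x0 t0 p0].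
Proof.
move=> P0 pG cG.
have cK : compact ((`[0, 1]%classic `*` `[0, 1]%classic) `*` `[- P, P]%classic : set (R * R * R)).
  by apply: compact_setX; [apply: compact_setX|]; exact: segment_compact.
have [||[[x0 t0] p0]] := @compact_EVT_max _ _ (fun z : R * R * R => G z.1.1 z.1.2 z.2) _ _ cK.
- by exists (0, 0, 0); split; [split|]; rewrite /= in_itv/= ?lexx ?ler01// oppr_le0 P0.
- exact: continuous_subspaceT.
rewrite inE => -[_ /=]; rewrite in_itv /= -ler_norml => p0P M.
exists x0, t0, p0; split => // x t p pP.
have [y y01 ->] := periodic_frac ((pG p).1 t) x.
have [s s01 ->] := periodic_frac ((pG p).2 y) t.
by apply: (M (y, s, p)); rewrite inE; split; [split|] => /=; rewrite in_itv //= -ler_norml.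
Qed.

Lemma Z2_periodic_strip_bounded (G : R -> R -> R -> R) (P : R) :
    (forall p, Z2_periodic (fun x t => G x t p)) ->
    continuous (fun z : R * R * R => G z.1.1 z.1.2 z.2) ->
  exists2 C, 0 <= C & forall x t p, `|p| <= P -> `|G x t p| <= C.
Proof.
move=> pG cG; have [P0|P0] := leP 0 P; last first.
  by exists 0 => // x t p pP; have := le_trans (normr_ge0 p) pP; rewrite leNgt P0.
have pN p : Z2_periodic (fun x t => `|G x t p|).
  by split=> ? ? /=; rewrite ?(pG p).1 ?(pG p).2.
have cN : continuous (fun z : R * R * R => `|G z.1.1 z.1.2 z.2|).
  by move=> z; apply: continuous_comp; [exact: cG|exact: norm_continuous].
have [x0 [t0 [p0 [_ M]]]] := Z2_periodic_strip_max P0 pN cN.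
by exists `|G x0 t0 p0|.
Qed.

End Periodic.

(** * Uniform bounds on the Hamiltonian over strips *)

Section HamiltonianBounds.
Context {R : realType}.

Lemma derivable_is_derive1 (f : R -> R) (x : R) :
  derivable f x 1 -> is_derive x 1 f (derive1 f x).
Proof. by move=> /derivableP fx; rewrite derive1E. Qed.

Lemma C1_3_derive (G : R -> R -> R -> R) : C1_3 G -> forall x t p : R,
  [/\ is_derive x 1 (fun y => G y t p) (Dx G x t p),
      is_derive t 1 (fun s => G x s p) (Dt G x t p) &
      is_derive p 1 (fun q => G x t q) (Dp G x t p)].
Proof.
by case=> dG _ _ _ x t p; case: (dG x t p) => *; split; exact: derivable_is_derive1.
Qed.

Section Strip.
Variable G : R -> R -> R -> R.
Hypothesis G_periodic : forall p, Z2_periodic (fun x t => G x t p).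

Lemma Dx_periodic p : Z2_periodic (fun x t => Dx G x t p).
Proof.
split=> a b /=; rewrite /Dx.
  by apply: derive1_periodic; exact: (G_periodic p).1.
by congr (derive1 _ _); apply/funext => y; rewrite (G_periodic p).2.
Qed.

Lemma Dt_periodic p : Z2_periodic (fun x t => Dt G x t p).
Proof.
split=> a b /=; rewrite /Dt; last first.
  by apply: derive1_periodic; exact: (G_periodic p).2.
by congr (derive1 _ _); apply/funext => y; rewrite (G_periodic p).1.
Qed.

Lemma Dp_periodic p : Z2_periodic (fun x t => Dp G x t p).
Proof.
split=> a b /=; rewrite /Dp; congr (derive1 _ _); apply/funext => q.
  by rewrite (G_periodic q).1.
by rewrite (G_periodic q).2.
Qed.

Hypothesis G_C1 : C1_3 G.

Lemma C1_3_strip_lipschitz P : exists2 C, 0 <= C & forall x t p y s q,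
  `|p| <= P -> `|q| <= P ->
  `|G x t p - G y s q| <= C * (`|x - y| + `|t - s| + `|p - q|).
Proof.
have [_ cx ct cp] := G_C1; have dG := C1_3_derive G_C1.
have [A A0 hA] := Z2_periodic_strip_bounded P Dx_periodic cx.
have [B B0 hB] := Z2_periodic_strip_bounded P Dt_periodic ct.
have [D D0 hD] := Z2_periodic_strip_bounded P Dp_periodic cp.
exists (A + B + D); first by rewrite !addr_ge0.
move=> x t p y s q pP qP.
have h1 : `|G x t p - G y t p| <= A * `|x - y|.
  apply: (bounded_derivative_lipschitz (f := fun z => G z t p) (df := fun z => Dx G z t p)) => z; last exact: hA.
  by case: (dG z t p) => h _ _; exact: h.
have h2 : `|G y t p - G y s p| <= B * `|t - s|.
  apply: (bounded_derivative_lipschitz (f := fun z => G y z p) (df := fun z => Dt G y z p)) => z; last exact: hB.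
  by case: (dG y z p) => _ h _; exact: h.
have h3 : `|G y s p - G y s q| <= D * `|p - q|.
  apply: (@derivative_bound_lipschitz _ (fun z => G y s z) _ D (- P) P p q); rewrite -?ler_norml//.
    by move=> z _; case: (dG y s z) => _ _ h; exact: h.
  by move=> z; rewrite -ler_norml; exact: hD.
have -> : G x t p - G y s q = (G x t p - G y t p) + (G y t p - G y s p) + (G y s p - G y s q) by lra.
apply: (le_trans (ler_normD _ _)); apply: (le_trans (lerD (ler_normD _ _) (lexx _))).
have := normr_ge0 (x - y); have := normr_ge0 (t - s); have := normr_ge0 (p - q).
nra.
Qed.

Lemma C1_3_continuous : continuous (fun z : R * R * R => G z.1.1 z.1.2 z.2).
Proof.
move=> [[x t] p].
have [C C0 hC] := C1_3_strip_lipschitz (`|p| + 1).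
apply/cvgrPdist_le => /= e e0.
pose d := Num.min 1 (e / (3 * (C + 1))).
have d0 : 0 < d by rewrite lt_min ltr01 divr_gt0// mulr_gt0// ltr_wpDl.
exists (ball x d `*` ball t d, ball p d) => /=.
  split; last exact: nbhsx_ballx.
  by exists (ball x d, ball t d) => //=; split; exact: nbhsx_ballx.
move=> [[y s] q] [[/= xy ts] pq]; move: xy ts pq; rewrite /ball /= => xy ts pq.
apply: (le_trans (hC x t p y s q _ _)).
- by rewrite lerDl.
- rewrite -[q](subKr p) (le_trans (ler_normB _ _))// lerD2l.
  by apply: (le_trans (ltW pq)); rewrite ge_min lexx.
have de : d <= e / (3 * (C + 1)) by rewrite ge_min lexx orbT.
apply: (le_trans (y := C * (d + d + d))).
  by rewrite ler_wpM2l// !lerD// ltW.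
move: de; rewrite ler_pdivlMr; last by rewrite mulr_gt0// ltr_wpDl.
nra.
Qed.

End Strip.

Variables (H : R -> R -> R -> R) (hH : hamiltonian H).
Let perH := ham_periodic hH.
Let C2H := ham_C2 hH.

Lemma H_C1 : C1_3 H. Proof. by case: C2H. Qed.
Lemma DpH_C1 : C1_3 (Dp H). Proof. by case: C2H. Qed.

Lemma is_derive_H (x t p : R) : is_derive p 1 (H x t) (Dp H x t p).
Proof. by case: (C1_3_derive H_C1 x t p) => _ _ h; exact: h. Qed.

Lemma is_derive_DpH (x t p : R) : is_derive p 1 (Dp H x t) (Dp (Dp H) x t p).
Proof. by case: (C1_3_derive DpH_C1 x t p) => _ _ h; exact: h. Qed.

Lemma DpH_monotone x t p q : p <= q -> Dp H x t p <= Dp H x t q.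
Proof.
move=> pq; have [|z _ E] := mvt pq (f := Dp H x t) (df := Dp (Dp H) x t).
  by move=> z _; exact: is_derive_DpH.
by rewrite -subr_ge0 E mulr_ge0 ?subr_ge0// ltW// (ham_convex hH).
Qed.

Lemma H_above_tangent x t p q : H x t p + Dp H x t p * (q - p) <= H x t q.
Proof.
have := @tangent_below R (H x t) (Dp H x t) 0 (Num.min p q) (Num.max p q) p q.
rewrite !mul0r addr0; apply.
- by move=> z _; exact: is_derive_H.
- by move=> z w _ zw _; rewrite mul0r subr_ge0; exact: DpH_monotone.
- by rewrite ge_min le_max lexx.
- by rewrite ge_min le_max lexx !orbT.
Qed.

(** On a strip $|p|\le P$ the positive function $H_{pp}$ attains its minimum, by
    periodicity in $(x,t)$. *)
Lemma H_uniformly_convex P : exists2 h, 0 < h & forall x t p q,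
  `|p| <= P -> `|q| <= P ->
  H x t p + Dp H x t p * (q - p) + h / 2 * (q - p) ^+ 2 <= H x t q.
Proof.
have [P0|P0] := leP 0 P; last first.
  by exists 1 => // x t p q pP; have := le_trans (normr_ge0 p) pP; rewrite leNgt P0.
have [_ _ _ cpp] := DpH_C1.
have cN : continuous (fun z : R * R * R => - Dp (Dp H) z.1.1 z.1.2 z.2).
  by move=> z; apply: (continuous_comp (cpp z)); exact: opp_continuous.
have pN p : Z2_periodic (fun x t => - Dp (Dp H) x t p).
  by split=> a b /=; rewrite ?(Dp_periodic (Dp_periodic perH) p).1 ?(Dp_periodic (Dp_periodic perH) p).2.
have [x0 [t0 [p0 [_ M]]]] := Z2_periodic_strip_max P0 pN cN.
exists (Dp (Dp H) x0 t0 p0); first exact: ham_convex.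
move=> x t p q pP qP.
apply: (@tangent_below R (H x t) (Dp H x t) _ (- P) P); rewrite -?ler_norml//.
  by move=> z _; exact: is_derive_H.
move=> z w Pz zw wP.
have [|y /andP[zy yw] ->] := mvt zw (f := Dp H x t) (df := Dp (Dp H) x t).
  by move=> y _; exact: is_derive_DpH.
apply: ler_wpM2r; first by rewrite subr_ge0.
rewrite -lerN2; apply: M; rewrite ler_norml.
by rewrite (le_trans Pz zy) (le_trans yw wP).
Qed.

(** Semiconvexity of $H$ in $x$, from the boundedness of $H_{xx}$ on a strip. *)
Lemma H_second_difference P : exists2 C, 0 <= C & forall x t p d, `|p| <= P -> 0 <= d ->
  - C * d ^+ 2 <= H (x + d) t p + H (x - d) t p - 2 * H x t p.
Proof.
have [_ DxC1 _ _] := C2H; have [_ cxx _ _] := DxC1.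
have [C C0 hC] := Z2_periodic_strip_bounded P (Dx_periodic (Dx_periodic perH)) cxx.
exists C => // x t p d pP d0.
apply: (@second_difference_below R (fun y => H y t p) (fun y => Dx H y t p) C (x - d) (x + d)) => //.
  by move=> z _; case: (C1_3_derive H_C1 z t p) => h _ _; exact: h.
move=> z w _ zw _.
have [|y _ ->] := mvt zw (f := fun y => Dx H y t p) (df := fun y => Dx (Dx H) y t p).
  by move=> y _; case: (C1_3_derive DxC1 y t p) => h _ _; exact: h.
apply: ler_wpM2r; first by rewrite subr_ge0.
by have := hC y t p pP; rewrite ler_norml => /andP[h _]; exact: h.
Qed.

Lemma DpH_large (B : R) x t : (\forall p \near +oo, B < Dp H x t p) /\
  (\forall p \near +oo, Dp H x t (- p) < - B).
Proof.
have [Hp Hm] := ham_superlinear hH x t.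
have big : \forall p \near +oo, B + `|H x t 0| < H x t p / `|p|.
  by move/cvgryPgt : Hp; exact.
have bigm : \forall p \near +oo, B + `|H x t 0| < H x t (- p) / `|p|.
  move/cvgryPgt : Hm => /(_ (B + `|H x t 0|)).
  move=> [M [_ hM]]; exists (- M); split; first exact: num_real.
  by move=> p pM /=; rewrite -[X in _ / X]normrN; apply: hM; rewrite ltrNl.
split; near=> p; have p1 : 1 <= p by near: p; exact: nbhs_pinfty_ge.
- have p0 : 0 < p := lt_le_trans ltr01 p1.
  have : B + `|H x t 0| < H x t p / `|p| by near: p.
  rewrite (ger0_norm (ltW p0)) ltr_pdivlMr//.
  have := H_above_tangent x t p 0; have := ler_norm (H x t 0); have := normr_ge0 (H x t 0).
  nra.
- have p0 : 0 < p := lt_le_trans ltr01 p1.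
  have : B + `|H x t 0| < H x t (- p) / `|p| by near: p.
  rewrite (ger0_norm (ltW p0)) ltr_pdivlMr//.
  have := H_above_tangent x t (- p) 0; have := ler_norm (H x t 0); have := normr_ge0 (H x t 0).
  nra.
Unshelve. all: by end_near.
Qed.

(** Superlinearity is only assumed pointwise in $(x,t)$; monotonicity of $H_p$ in $p$
    and compactness of the torus make the divergence of $H_p$ uniform. *)
Lemma DpH_coercive (B : R) : exists2 U, 0 <= U & forall x t p,
  `|Dp H x t p| <= B -> `|p| <= U.
Proof.
have cK : compact (`[0, 1]%classic `*` `[0, 1]%classic : set (R * R)).
  by apply: compact_setX; exact: segment_compact.
have cDp : continuous (fun z : R * R * R => Dp H z.1.1 z.1.2 z.2) by case: H_C1.
have cq q : continuous (fun z : R * R => Dp H z.1 z.2 q).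
  move=> z; apply: (@continuous_comp _ _ _ (fun z : R * R => (z, q)) (fun z : R * R * R => Dp H z.1.1 z.1.2 z.2)); last exact: cDp.
  exact: (cvg_pair (@cvg_id _ (nbhs z)) (@cvg_cst _ q _ _ _)).
have cov := (compact_near_coveringP _).1 cK.
have h : \forall p \near +oo, `[0, 1]%classic `*` `[0, 1]%classic `<=`
    (fun z : R * R => B < Dp H z.1 z.2 p /\ Dp H z.1 z.2 (- p) < - B).
  apply: (cov R +oo_R (fun p z => B < Dp H z.1 z.2 p /\ Dp H z.1 z.2 (- p) < - B)) => -[x t] _ /=.
  have [h1 h2] := DpH_large B x t.
  near +oo_R => q.
  have hq1 : B < Dp H x t q by near: q.
  have hq2 : Dp H x t (- q) < - B by near: q.
  exists ([set z | B < Dp H z.1 z.2 q /\ Dp H z.1 z.2 (- q) < - B], [set p | q <= p]) => /=.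
    split; last by exists q; split=> // p /ltW.
    have n1 : \forall z \near (x, t), B < Dp H z.1 z.2 q by exact: (cvgr_gt _ (cq q (x, t))).
    have n2 : \forall z \near (x, t), Dp H z.1 z.2 (- q) < - B by exact: (cvgr_lt _ (cq (- q) (x, t))).
    exact: filterI n1 n2.
  move=> [[y s] p] /= [[b1 b2] qp]; split.
    by apply: (lt_le_trans b1); exact: DpH_monotone.
  by apply: le_lt_trans b2; apply: DpH_monotone; rewrite lerN2.
near +oo_R => U.
have U0 : 0 <= U by near: U; exact: nbhs_pinfty_ge.
have hU : `[0, 1]%classic `*` `[0, 1]%classic `<=`
    (fun z : R * R => B < Dp H z.1 z.2 U /\ Dp H z.1 z.2 (- U) < - B) by near: U.
exists U => // x t p.
have pD := Dp_periodic perH p.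
have [y y01 ->] := periodic_frac (pD.1 t) x.
have [s s01 ->] := periodic_frac (pD.2 y) t.
have [|h1 h2] := hU (y, s); first by split; rewrite /= in_itv.
rewrite !ler_norml => /andP[b1 b2]; apply/andP; split; rewrite leNgt; apply/negP => hp.
  by have := DpH_monotone y s (ltW hp); move: h2 b1 => /=; lra.
by have := DpH_monotone y s (ltW hp); move: h1 b2 => /=; lra.
Unshelve. all: by end_near.
Qed.

End HamiltonianBounds.

(** * Increments controlled by test functions *)

Section SmoothFunctions.
Context {R : realType}.

Lemma continuous_normr (T : topologicalType) (f : T -> R) :
  continuous f -> continuous (fun z => `|f z|).
Proof. by move=> cf z; apply: (@continuous_comp _ _ _ f (@Num.norm R R) z); [exact: cf|exact: norm_continuous]. Qed.

Lemma box_lipschitz (f : R -> R -> R) C a b a' b' : C1_2 f ->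
    (forall x t, a <= x <= b -> a' <= t <= b' -> `|fx f x t| <= C /\ `|ft f x t| <= C) ->
  forall x t y s, a <= x <= b -> a' <= t <= b' -> a <= y <= b -> a' <= s <= b' ->
  `|f x t - f y s| <= C * (`|x - y| + `|t - s|).
Proof.
move=> [df _ _] bd x t y s xab tab yab sab.
have h1 : `|f x t - f y t| <= C * `|x - y|.
  apply: (@derivative_bound_lipschitz _ (fun z => f z t) (fun z => fx f z t) C a b) => // z zab.
    by apply: derivable_is_derive1; exact: (df z t).1.
  by case: (bd z t zab tab).
have h2 : `|f y t - f y s| <= C * `|t - s|.
  apply: (@derivative_bound_lipschitz _ (fun z => f y z) (fun z => ft f y z) C a' b') => // z zab.
    by apply: derivable_is_derive1; exact: (df y z).2.
  by case: (bd y z yab zab).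
have -> : f x t - f y s = (f x t - f y t) + (f y t - f y s) by lra.
by apply: (le_trans (ler_normD _ _)); rewrite mulrDr lerD.
Qed.

Lemma C1_2_periodic_lipschitz (f : R -> R -> R) : Z2_periodic f -> C1_2 f ->
  exists2 C, 0 <= C & forall x t y s, `|f x t - f y s| <= C * (`|x - y| + `|t - s|).
Proof.
move=> pf cf; have [df cx ct] := cf.
have px : Z2_periodic (fx f).
  split=> a b /=; rewrite /fx; first by apply: derive1_periodic; exact: pf.1.
  by congr (derive1 _ _); apply/funext => y; rewrite pf.2.
have pt : Z2_periodic (ft f).
  split=> a b /=; rewrite /ft; last by apply: derive1_periodic; exact: pf.2.
  by congr (derive1 _ _); apply/funext => y; rewrite pf.1.
have [A hA] := Z2_periodic_bounded px cx; have [B hB] := Z2_periodic_bounded pt ct.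
have A0 : 0 <= A := le_trans (normr_ge0 _) (hA 0 0).
have B0 : 0 <= B := le_trans (normr_ge0 _) (hB 0 0).
exists (A + B); first exact: addr_ge0.
have mm (a b : R) : Num.min a b <= a <= Num.max a b /\ Num.min a b <= b <= Num.max a b.
  by rewrite !ge_min !le_max !lexx !orbT.
move=> x t y s; apply: (@box_lipschitz f (A + B) (Num.min x y) (Num.max x y) (Num.min t s) (Num.max t s)) => //.
- by move=> ? ? _ _; split; [rewrite (le_trans (hA _ _))// lerDl|rewrite (le_trans (hB _ _))// lerDr].
- exact: (mm x y).1.
- exact: (mm t s).1.
- exact: (mm x y).2.
- exact: (mm t s).2.
Qed.

Lemma C1_2_locally_lipschitz (f : R -> R -> R) a b : a <= b -> C1_2 f ->
  exists2 C, 0 <= C & forall x t y s, a <= x <= b -> a <= t <= b -> a <= y <= b -> a <= s <= b ->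
    `|f x t - f y s| <= C * (`|x - y| + `|t - s|).
Proof.
move=> ab cf; have [df cx ct] := cf.
have cK : compact (`[a, b]%classic `*` `[a, b]%classic : set (R * R)).
  by apply: compact_setX; exact: segment_compact.
have bd (g : R -> R -> R) : continuous (fun z : R * R => g z.1 z.2) ->
    exists2 C, 0 <= C & forall x t, a <= x <= b -> a <= t <= b -> `|g x t| <= C.
  move=> cg.
  have cN : continuous (fun z : R * R => `|g z.1 z.2|).
    exact: (continuous_normr cg).
  have K0 : (`[a, b]%classic `*` `[a, b]%classic : set (R * R)) !=set0.
    by exists (a, a); split; rewrite /= in_itv /= lexx.
  have [[x0 t0] _ M] := compact_EVT_max K0 cK (continuous_subspaceT cN).
  exists `|g x0 t0| => // x t xab tab.
  by apply: (M (x, t)); rewrite inE; split; rewrite /= in_itv.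
have [A A0 hA] := bd _ cx; have [B B0 hB] := bd _ ct.
exists (A + B); first exact: addr_ge0.
move=> x t y s; apply: (@box_lipschitz f (A + B)) => // z w zab wab.
by split; [rewrite (le_trans (hA _ _ zab wab))// lerDl|rewrite (le_trans (hB _ _ zab wab))// lerDr].
Qed.

Lemma young_inequality (U a th : R) : 0 < th -> U * a <= U ^+ 2 / th * a ^+ 2 + th / 4.
Proof.
move=> th0; rewrite -subr_ge0.
have -> : U ^+ 2 / th * a ^+ 2 + th / 4 - U * a = th * (U * a / th - 2^-1) ^+ 2.
  by field; rewrite gt_eqF.
by rewrite mulr_ge0 ?sqr_ge0 ?ltW.
Qed.

(** Touching from above by $K t + \sigma e^{n(t-t_2)} + A(x-x_0)^2$: the quadratic
    confines the maximum of the difference to a thin strip around $x_0$, and the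
    exponential keeps it away from the upper end of the time interval while
    contributing a positive slope only.  At the maximum the space derivative of the
    test function is forced to be that of $v$. *)
Lemma test_functions_bound_increment (v u F : R -> R -> R) (L U x0 t1 t2 : R) :
    continuous (fun z : R * R => v z.1 z.2) ->
    (forall x t : R, is_derive x 1 (fun y => v y t) (u x t)) ->
    (forall x t, `|u x t| <= U) -> 0 <= L ->
    (forall x t y s, `|F x t - F y s| <= L * (`|x - y| + `|t - s|)) ->
    (forall (phi : R -> R -> R) (x t : R), C1_2 phi ->
      (\forall z \near (x, t), v z.1 z.2 - phi z.1 z.2 <= v x t - phi x t) ->
      fx phi x t = u x t -> ft phi x t <= F x t) ->
    t1 <= t2 ->
  v x0 t2 - v x0 t1 <= (t2 - t1) * (F x0 t1 + L * (t2 - t1)).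
Proof.
move=> cv vu uU L0 FL visc; rewrite le_eqVlt => /predU1P[->|t12].
  by rewrite !subrr mul0r.
rewrite leNgt; apply/negP => Q.
pose D := t2 - t1; have D0 : 0 < D by rewrite subr_gt0.
pose Th := v x0 t2 - v x0 t1 - D * (F x0 t1 + L * D).
have Th0 : 0 < Th by rewrite subr_gt0.
pose eps := Th / (4 * D); have eps0 : 0 < eps by rewrite divr_gt0// mulr_gt0.
have epsD : eps * D = Th / 4 by rewrite /eps; field; rewrite gt_eqF.
pose K := F x0 t1 + L * D + 2 * eps.
pose th := v x0 t2 - v x0 t1 - K * D.
have th0 : 0 < th.
  by rewrite /th (_ : _ - _ = Th - 2 * (eps * D)); [rewrite epsD; lra|rewrite /Th /K; lra].
pose rho := eps / (2 * (L + 1)).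
have rho0 : 0 < rho by rewrite divr_gt0// mulr_gt0// ltr_wpDl.
have rhoL : 2 * L * rho < eps.
  have : rho * (2 * (L + 1)) = eps by rewrite /rho mulfVK// gt_eqF// mulr_gt0// ltr_wpDl.
  lra.
pose t3 := t2 + rho; pose sg := th / 4; have sg0 : 0 < sg by rewrite divr_gt0.
have cK : compact (`[x0 - rho, x0 + rho]%classic `*` `[t1, t3]%classic : set (R * R)).
  by apply: compact_setX; exact: segment_compact.
have Kc : (`[x0 - rho, x0 + rho]%classic `*` `[t1, t3]%classic) (x0, t2).
  by split; rewrite /= in_itv /=; apply/andP; split; rewrite /t3; lra.
have K0 : (`[x0 - rho, x0 + rho]%classic `*` `[t1, t3]%classic : set (R * R)) !=set0 by exists (x0, t2).
have c1 : continuous (fun z : R * R => v z.1 z.2 - K * z.2).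
  move=> z; apply: cvgB; [exact: cv|apply: cvgM; [exact: cvg_cst|exact: cvg_snd]].
have cN : continuous (fun z : R * R => `|v z.1 z.2 - K * z.2|).
  exact: (continuous_normr c1).
have [[xw tw] _ /= hW] := compact_EVT_max K0 cK (continuous_subspaceT cN).
pose W := `|v xw tw - K * tw|.
have W0 : 0 <= W by exact: normr_ge0.
have {}hW x t : x0 - rho <= x <= x0 + rho -> t1 <= t <= t3 -> `|v x t - K * t| <= W.
  by move=> xr tr; apply: (hW (x, t)); rewrite inE; split; rewrite /= in_itv.
(* The first summand of A absorbs the x-variation of v at time t1 by Young's inequality;
   the second one makes phi exceed the oscillation 2 W of v - K t on the sides of the
   rectangle.  Likewise n makes phi exceed it at the top. *)
pose A := U ^+ 2 / th + (2 * W + sg + 1) / rho ^+ 2.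
pose n := (2 * W + 1) / (sg * rho).
have rho20 : 0 < rho ^+ 2 by rewrite exprn_gt0.
have nE : n * (sg * rho) = 2 * W + 1 by rewrite /n mulfVK// gt_eqF// mulr_gt0.
have n0 : 0 < n by apply: divr_gt0; [apply: ltr_wpDl => //; exact: mulr_ge0|exact: mulr_gt0].
have B0 : 0 <= 2 * W + sg + 1 by apply: addr_ge0 => //; apply: addr_ge0; [exact: mulr_ge0|exact: ltW].
have A1 : U ^+ 2 / th <= A by rewrite /A lerDl; apply: divr_ge0; [exact: B0|exact: ltW].
have A2 : 2 * W + sg + 1 <= A * rho ^+ 2.
  have /(ler_wpM2r (ltW rho20)) : (2 * W + sg + 1) / rho ^+ 2 <= A.
    by rewrite /A lerDr; apply: divr_ge0; [exact: sqr_ge0|exact: ltW].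
  by rewrite mulfVK// gt_eqF.
have A0 : 0 <= A by apply: le_trans A1; apply: divr_ge0; [exact: sqr_ge0|exact: ltW].
pose phi x t := K * t + sg * expR (n * (t - t2)) + A * (x - x0) ^+ 2.
have phix (x t : R) : is_derive x 1 (fun y => phi y t) (2 * A * (x - x0)).
  by rewrite /phi; apply: is_derive_eq; rewrite /GRing.scale /=; lra.
have phit (x t : R) : is_derive t 1 (fun s => phi x s) (K + sg * (n * expR (n * (t - t2)))).
  rewrite /phi.
  have e1 : is_derive t 1 (fun s : R => expR (n * (s - t2))) (expR (n * (t - t2)) * n).
    apply: (@is_derive1_comp R expR (fun s => n * (s - t2)) t).
    by apply: is_derive_eq; rewrite /GRing.scale /=; lra.
  by apply: is_derive_eq; rewrite /GRing.scale /=; lra.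
have fxE x t : fx phi x t = 2 * A * (x - x0).
  by rewrite /fx derive1E; have := phix x t => ?; rewrite derive_val.
have ftE x t : ft phi x t = K + sg * (n * expR (n * (t - t2))).
  by rewrite /ft derive1E; have := phit x t => ?; rewrite derive_val.
have cexp : continuous (fun z : R * R => expR (n * (z.2 - t2))).
  move=> z; apply: (@continuous_comp _ _ _ (fun z : R * R => n * (z.2 - t2)) expR z); last exact: continuous_expR.
  apply: cvgM; [exact: cvg_cst|apply: cvgB; [exact: cvg_snd|exact: cvg_cst]].
have phiC : C1_2 phi.
  split.
  - move=> x t; split.
      by have := phix x t => h; exact: (@ex_derive _ _ _ _ _ _ _ h).
    by have := phit x t => h; exact: (@ex_derive _ _ _ _ _ _ _ h).
  - rewrite (_ : (fun z : R * R => _) = (fun z => 2 * A * (z.1 - x0))); last by apply/funext => z; rewrite fxE.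
    by move=> z; apply: cvgM; [exact: cvg_cst|apply: cvgB; [exact: cvg_fst|exact: cvg_cst]].
  - rewrite (_ : (fun z : R * R => _) = (fun z => K + sg * (n * expR (n * (z.2 - t2))))); last by apply/funext => z; rewrite ftE.
    move=> z; apply: cvgD; first exact: cvg_cst.
    by apply: cvgM; [exact: cvg_cst|apply: cvgM; [exact: cvg_cst|exact: cexp]].
have cphi : continuous (fun z : R * R => v z.1 z.2 - phi z.1 z.2).
  rewrite (_ : (fun z : R * R => _) = (fun z : R * R => (v z.1 z.2 - K * z.2) - sg * expR (n * (z.2 - t2)) - A * ((z.1 - x0) * (z.1 - x0)))); last first.
    by apply/funext => z; rewrite /phi expr2; lra.
  move=> z; apply: cvgB; first apply: cvgB; first exact: c1.
    by apply: cvgM; [exact: cvg_cst|exact: cexp].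
  apply: cvgM; first exact: cvg_cst.
  by apply: cvgM; apply: cvgB; (try exact: cvg_fst); exact: cvg_cst.
have [[xs ts]] := compact_EVT_max K0 cK (continuous_subspaceT cphi).
rewrite inE => -[]; rewrite /= !in_itv /= => xsr tsr M.
have {}M x t : x0 - rho <= x <= x0 + rho -> t1 <= t <= t3 -> v x t - phi x t <= v xs ts - phi xs ts.
  by move=> xr tr; apply: (M (x, t)); rewrite inE; split; rewrite /= in_itv.
have x0r : x0 - rho <= x0 <= x0 + rho by move: rho0; clear => rho0; apply/andP; split; lra.
have t2r : t1 <= t2 <= t3 by rewrite /t3; move: rho0 t12; clear => rho0 t12; apply/andP; split; lra.
have Mc := M x0 t2 x0r t2r.
have phic : phi x0 t2 = K * t2 + sg by rewrite /phi !subrr mulr0 expR0 expr2 mulr0; clear; lra.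
have b0 := hW x0 t2 x0r t2r; have bs := hW xs ts xsr tsr.
have es0 := expR_ge0 (n * (ts - t2)).
move: b0 bs; rewrite !ler_norml => /andP[b01 b02] /andP[bs1 bs2].
have sges : 0 <= sg * expR (n * (ts - t2)) by rewrite mulr_ge0// ltW.
have xin : `|xs - x0| < rho.
  rewrite ltNge; apply/negP => h.
  have : rho ^+ 2 <= (xs - x0) ^+ 2 by rewrite -[leRHS]real_normK ?num_real// lerXn2r// nnegrE ltW.
  move=> /(ler_wpM2l A0) h2.
  by move: Mc A2 h2 sges b01 b02 bs1 bs2 sg0; rewrite phic /phi; clear; lra.
have tin : t1 < ts < t3.
  move: tsr => /andP[]; rewrite le_eqVlt => /predU1P[E _|->].
    exfalso; move: Mc; rewrite phic /phi -E.
    have hv : v xs t1 - v x0 t1 <= U * `|xs - x0|.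
      apply: (le_trans (ler_norm _)).
      exact: (@bounded_derivative_lipschitz R (v^~ t1) (u^~ t1) U xs x0 (vu^~ t1) (uU^~ t1)).
    have hq : U * `|xs - x0| <= A * (xs - x0) ^+ 2 + th / 4.
      apply: (@le_trans _ _ (U ^+ 2 / th * (xs - x0) ^+ 2 + th / 4)); last first.
        by rewrite lerD2r ler_wpM2r// sqr_ge0.
      by rewrite -(real_normK (num_real (xs - x0))); exact: young_inequality.
    move: sges; rewrite -E => sges; have sgE : 4 * sg = th by rewrite /sg mulrC divfK.
    by move=> Mc; move: Mc sges hv hq sgE sg0; rewrite /th /D /=; clear; lra.
  rewrite le_eqVlt => /predU1P[E|//].
  exfalso; move: Mc; rewrite phic /phi.
  have : 1 + n * (ts - t2) <= expR (n * (ts - t2)) by exact: expR_ge1Dx.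
  rewrite E /t3 (_ : t2 + rho - t2 = rho); last by clear; lra.
  move=> /(ler_wpM2l (ltW sg0)) h.
  have A0' : 0 <= A * (xs - x0) ^+ 2 by apply: mulr_ge0 => //; exact: sqr_ge0.
  by move: h A0' nE b01 b02 bs1 bs2; rewrite E /t3; clear; lra.
have xin' : x0 - rho < xs < x0 + rho by move: xin; rewrite ltr_norml; clear => /andP[? ?]; apply/andP; split; lra.
have near_max : \forall z \near (xs, ts), v z.1 z.2 - phi z.1 z.2 <= v xs ts - phi xs ts.
  exists (`]x0 - rho, x0 + rho[%classic, `]t1, t3[%classic) => /=.
    by split; apply: open_nbhs_nbhs; (split; first exact: interval_open); rewrite /= in_itv.
  move=> [x t] /= []; rewrite !in_itv /= => /andP[/ltW a1 /ltW a2] /andP[/ltW a3 /ltW a4].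
  by apply: M; apply/andP.
have fermat : fx phi xs ts = u xs ts.
  have d (y : R) : is_derive y 1 (fun y => v y ts - phi y ts) (u y ts - 2 * A * (y - x0)).
    by have := vu y ts; have := phix y ts => ? ?; apply: is_deriveB.
  have h := @derive1_at_max R (fun y => v y ts - phi y ts) (x0 - rho) (x0 + rho) xs.
  have : is_derive xs 1 (fun y => v y ts - phi y ts) 0.
    apply: h.
    - by move: rho0; clear; lra.
    - by move=> t _; have := d t => dd; exact: (@ex_derive _ _ _ _ _ _ _ dd).
    - by rewrite in_itv.
    - move=> t; rewrite in_itv /= => /andP[/ltW a1 /ltW a2]; apply: M; first by rewrite a1.
      by case/andP: tin => /ltW -> /ltW ->.
  move=> h0; have := @derive_val _ _ _ _ _ _ _ h0; have := d xs => ?.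
  by rewrite derive_val fxE => /eqP; rewrite subr_eq0 => /eqP.
have := visc phi xs ts phiC near_max fermat.
rewrite ftE.
have : 0 <= sg * (n * expR (n * (ts - t2))).
  by apply: mulr_ge0; [exact: ltW|apply: mulr_ge0; [exact: ltW|exact: es0]].
have := FL xs ts x0 t1.
move=> /(le_trans (ler_norm _)) h1 h2 h3.
have h4 : `|ts - t1| <= D + rho.
  by case/andP: tin => a1 a2; rewrite ger0_norm ?subr_ge0 ?(ltW a1)//; move: a2; rewrite /t3 /D; clear; lra.
have h5 : L * (`|xs - x0| + `|ts - t1|) <= L * (rho + (D + rho)).
  by rewrite ler_wpM2l// lerD// ltW.
by move: rhoL h1 h2 h3 h5 eps0; rewrite /K; clear; lra.
Qed.

End SmoothFunctions.

(** * Regularity of the exact solution *)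

Section RegularSolutions.
Context {R : realType}.

Definition drift (H : R -> R -> R -> R) (c : R) (ubar : R -> R -> R) (x t : R) : R :=
  Dp H x t (c + ubar x t).

(** The quantitative regularity of a classical solution that the error analysis of
    the scheme consumes. *)
Record regular_solution (H : R -> R -> R -> R) (c hbar : R)
    (ubar vbar : R -> R -> R) (U L : R) : Prop := RegularSolution {
  reg_U : forall x t, `|ubar x t| <= U ;
  reg_L : 0 <= L ;
  reg_u_lipschitz : forall x t y s,
    `|ubar x t - ubar y s| <= L * (`|x - y| + `|t - s|) ;
  reg_drift_lipschitz : forall x t y s,
    `|drift H c ubar x t - drift H c ubar y s| <= L * (`|x - y| + `|t - s|) ;
  reg_drift_bound : forall x t, `|drift H c ubar x t| <= L ;
  reg_u_periodic : Z2_periodic ubar ;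
  reg_v_periodic : Z2_periodic vbar ;
  reg_v_derive : forall x t : R, is_derive x 1 (fun y => vbar y t) (ubar x t) ;
  reg_v_step : forall x t d, 0 <= d ->
    `|vbar x (t + d) - vbar x t - d * (hbar - H x t (c + ubar x t))| <= L * d ^+ 2 ;
  reg_v_time : forall x t d, 0 <= d <= 1 -> `|vbar x (t + d) - vbar x t| <= L * d }.

Lemma regular_v_lipschitz H c hbar ubar vbar U L :
  regular_solution H c hbar ubar vbar U L ->
  forall x y t, `|vbar x t - vbar y t| <= U * `|x - y|.
Proof.
move=> reg x y t.
exact: (@bounded_derivative_lipschitz R (vbar^~ t) (ubar^~ t) U x y (fun z => reg_v_derive reg z t) (fun z => reg_U reg z t)).
Qed.

Lemma regular_v_taylor H c hbar ubar vbar U L :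
  regular_solution H c hbar ubar vbar U L ->
  forall x t d, `|vbar (x + d) t - vbar x t - ubar x t * d| <= L / 2 * d ^+ 2.
Proof.
move=> reg x t d.
have := @lipschitz_derivative_taylor R (fun y => vbar y t) (fun y => ubar y t) L x (x + d).
rewrite (addrAC x d) subrr add0r; apply => [z|z w].
  exact: (reg_v_derive reg).
by have := reg_u_lipschitz reg z t w t; rewrite subrr normr0 addr0.
Qed.

Section Exists.
Variables (H : R -> R -> R -> R) (hH : hamiltonian H) (c hbar : R) (ubar vbar : R -> R -> R).
Hypotheses (up : Z2_periodic ubar) (uC : C1_2 ubar).
Hypothesis visc : periodic_viscosity_solution H c hbar vbar.
Hypothesis vu : forall x t : R, is_derive x 1 (fun y => vbar y t) (ubar x t).

Lemma fx_eq (f : R -> R -> R) (x t d : R) : is_derive x 1 (fun y => f y t) d -> fx f x t = d.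
Proof. by move=> h; rewrite /fx derive1E derive_val. Qed.

Lemma ft_eq (f : R -> R -> R) (x t d : R) : is_derive t 1 (fun s => f x s) d -> ft f x t = d.
Proof. by move=> h; rewrite /ft derive1E derive_val. Qed.

Lemma C1_2_opp (phi : R -> R -> R) : C1_2 phi ->
  [/\ C1_2 (fun x t => - phi x t),
      forall x t, fx (fun x t => - phi x t) x t = - fx phi x t &
      forall x t, ft (fun x t => - phi x t) x t = - ft phi x t].
Proof.
move=> [dp cx ct].
have fxN x t : fx (fun x t => - phi x t) x t = - fx phi x t.
  apply: fx_eq; have h := derivable_is_derive1 (dp x t).1; exact: (is_deriveN h).
have ftN x t : ft (fun x t => - phi x t) x t = - ft phi x t.
  apply: ft_eq; have h := derivable_is_derive1 (dp x t).2; exact: (is_deriveN h).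
split; [split|exact: fxN|exact: ftN].
- by move=> x t; split; apply: derivableN; [exact: (dp x t).1|exact: (dp x t).2].
- rewrite (_ : (fun z : R * R => _) = (fun z => - fx phi z.1 z.2)); last by apply/funext => z; rewrite fxN.
  by move=> z; apply: (continuous_comp (cx z)); exact: opp_continuous.
- rewrite (_ : (fun z : R * R => _) = (fun z => - ft phi z.1 z.2)); last by apply/funext => z; rewrite ftN.
  by move=> z; apply: (continuous_comp (ct z)); exact: opp_continuous.
Qed.

(** The subsolution property bounds the increments of $\bar v$ in time from above, the
    supersolution property those of $-\bar v$.  Since a test function touching $\bar v$ has
    the slope $\bar u$, they say that $\bar v_t=\bar h-H(x,t,c+\bar u)$ in an integrated
    form, although $\bar v$ is only known to be differentiable in $x$. *)
Lemma regular_solution_exists : exists U L, regular_solution H c hbar ubar vbar U L.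
Proof.
have perH := ham_periodic hH.
have [vp [vc sub sup]] := visc.
have [Lu Lu0 hLu] := C1_2_periodic_lipschitz up uC.
have uc : continuous (fun z : R * R => ubar z.1 z.2).
  move=> [x t]; apply/cvgrPdist_le => /= e e0.
  pose d := e / (2 * (Lu + 1)).
  have d0 : 0 < d by rewrite divr_gt0// mulr_gt0// ltr_wpDl.
  exists (ball x d, ball t d) => /=; first by split; exact: nbhsx_ballx.
  move=> [y s] /= [/ltW xy /ltW ts]; apply: (le_trans (hLu x t y s)).
  have dE : d * (2 * (Lu + 1)) = e by rewrite /d mulfVK// gt_eqF// mulr_gt0// ltr_wpDl.
  apply: (@le_trans _ _ (Lu * (d + d))); first by rewrite ler_wpM2l// lerD.
  by rewrite -dE; have := ltW d0; nra.
have [U hU] := Z2_periodic_bounded up uc.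
have U0 : 0 <= U := le_trans (normr_ge0 _) (hU 0 0).
pose P := `|c| + U.
have inP x t : `|c + ubar x t| <= P by rewrite (le_trans (ler_normD _ _))// lerD2l.
have [LH LH0 hLH] := C1_3_strip_lipschitz perH (H_C1 hH) P.
have [LD LD0 hLD] := C1_3_strip_lipschitz (Dp_periodic perH) (DpH_C1 hH) P.
have cDp : continuous (fun z : R * R * R => Dp H z.1.1 z.1.2 z.2) by case: (H_C1 hH).
have [BD BD0 hBD] := Z2_periodic_strip_bounded P (Dp_periodic perH) cDp.
have [BH BH0 hBH] := Z2_periodic_strip_bounded P perH (C1_3_continuous perH (H_C1 hH)).
have comp (G : R -> R -> R -> R) A : 0 <= A ->
    (forall x t p y s q, `|p| <= P -> `|q| <= P ->
      `|G x t p - G y s q| <= A * (`|x - y| + `|t - s| + `|p - q|)) ->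
    forall x t y s, `|G x t (c + ubar x t) - G y s (c + ubar y s)|
      <= (A * (1 + Lu)) * (`|x - y| + `|t - s|).
  move=> A0 hA x t y s; apply: (le_trans (hA _ _ _ _ _ _ (inP x t) (inP y s))).
  rewrite -mulrA ler_wpM2l// mulrDl mul1r lerD2l.
  by rewrite (_ : c + _ - _ = ubar x t - ubar y s)// opprD addrACA subrr add0r.
pose F x t := hbar - H x t (c + ubar x t).
pose LF := LH * (1 + Lu).
have LF0 : 0 <= LF by rewrite mulr_ge0// addr_ge0.
have hLF x t y s : `|F x t - F y s| <= LF * (`|x - y| + `|t - s|).
  rewrite (_ : F x t - F y s = - (H x t (c + ubar x t) - H y s (c + ubar y s))); last by rewrite /F; lra.
  by rewrite normrN; exact: comp.
have vup x t t' : t <= t' -> vbar x t' - vbar x t <= (t' - t) * (F x t + LF * (t' - t)).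
  apply: (@test_functions_bound_increment R vbar ubar F LF U) => //.
  move=> phi y s phiC mx fxE.
  by have := sub phi y s phiC mx; rewrite fxE /F; lra.
have vdown x t t' : t <= t' -> (- vbar x t') - (- vbar x t) <= (t' - t) * (- F x t + LF * (t' - t)).
  apply: (@test_functions_bound_increment R (fun x t => - vbar x t) (fun x t => - ubar x t) (fun x t => - F x t) LF U) => //.
  - by move=> z; apply: (continuous_comp (vc z)); exact: opp_continuous.
  - by move=> y s; rewrite normrN.
  - by move=> y s y' s'; rewrite -opprD normrN.
  - move=> phi y s phiC mx fxE.
    have [NC fxN ftN] := C1_2_opp phiC.
    have := sup (fun x t => - phi x t) y s NC.
    rewrite fxN ftN fxE !opprK /F => h.
    suff : hbar <= - ft phi y s + H y s (c + ubar y s) by lra.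
    apply: h; apply: filterS mx => z /=; lra.
have vstep x t d : 0 <= d ->
    `|vbar x (t + d) - vbar x t - d * F x t| <= LF * d ^+ 2.
  move=> d0; have td : t <= t + d by rewrite lerDl.
  have := vup x _ _ td; have := vdown x _ _ td.
  rewrite (_ : t + d - t = d); last by rewrite addrAC subrr add0r.
  by rewrite ler_norml expr2; clear => ? ?; apply/andP; split; lra.
have BF x t : `|F x t| <= `|hbar| + BH.
  by rewrite (le_trans (ler_normB _ _))// lerD2l hBH.
pose LDD := LD * (1 + Lu).
have LDD0 : 0 <= LDD by rewrite mulr_ge0// addr_ge0.
have hb0 := normr_ge0 hbar.
exists U, (Lu + LDD + BD + LF + (`|hbar| + BH)).
split => //.
- by rewrite !addr_ge0.
- move=> x t y s; apply: (le_trans (hLu _ _ _ _)); rewrite ler_wpM2r ?addr_ge0//; lra.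
- move=> x t y s; apply: (le_trans (comp _ _ LD0 hLD _ _ _ _)).
  rewrite ler_wpM2r ?addr_ge0// -/LDD; lra.
- move=> x t; apply: (le_trans (hBD x t _ (inP x t))); lra.
- move=> x t d d0; apply: (le_trans (vstep _ _ _ d0)); rewrite ler_wpM2r ?sqr_ge0//; lra.
- move=> x t d /andP[d0 d1].
  have h1 := vstep x t d d0.
  have h2 : `|d * F x t| <= d * (`|hbar| + BH) by rewrite normrM ger0_norm// ler_wpM2l.
  have h3 : LF * d ^+ 2 <= LF * d by rewrite ler_wpM2l// expr2 ler_piMl.
  rewrite -[X in `|X|](subrK (d * F x t)); apply: (le_trans (ler_normD _ _)).
  have : 0 <= (Lu + LDD + BD) * d by rewrite mulr_ge0 ?addr_ge0.
  lra.
Qed.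

End Exists.
End RegularSolutions.

(** * Averaging along characteristics on the mesh *)

Section Grid.
Context {R : realType}.

Lemma even_nodeSl k m : even_node k.+1 m = ~~ even_node k m.
Proof. by rewrite /even_node; lia. Qed.

Lemma even_nodeD1 k m : even_node k (m + 1) = ~~ even_node k m.
Proof. by rewrite /even_node; lia. Qed.

Lemma even_nodeB1 k m : even_node k (m - 1) = ~~ even_node k m.
Proof. by rewrite /even_node; lia. Qed.

Lemma even_nodeDn k m n : even_node k (m + 2 * n) = even_node k m.
Proof. by rewrite /even_node; lia. Qed.

Lemma even_node_time k m n : even_node (k + 2 * n) m = even_node k m.
Proof. by rewrite /even_node; lia. Qed.

Variables (N K : nat).
Hypothesis NK : (0 < N <= K)%N.
Local Notation dx := (dx N : R).
Local Notation dt := (dt K : R).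
Local Notation x_ m := (xm N m : R).
Local Notation t_ k := (tk K k : R).

Lemma N_gt0 : 0 < N%:R :> R. Proof. by rewrite ltr0n; case/andP: NK. Qed.
Lemma K_gt0 : 0 < K%:R :> R.
Proof. by rewrite ltr0n; case/andP: NK => /leq_trans; apply. Qed.
Lemma dx_gt0 : 0 < dx. Proof. by rewrite invr_gt0 mulr_gt0// N_gt0. Qed.
Lemma dt_gt0 : 0 < dt. Proof. by rewrite invr_gt0 mulr_gt0// K_gt0. Qed.
Lemma dx_le : dx <= 2^-1.
Proof.
rewrite /Defs.dx lef_pV2 ?posrE ?mulr_gt0 ?N_gt0// ler_peMr// ler1n.
by case/andP: NK.
Qed.
Lemma dt_le_dx : dt <= dx.
Proof.
rewrite /Defs.dx /Defs.dt lef_pV2 ?posrE ?mulr_gt0 ?N_gt0 ?K_gt0// ler_wpM2l// ler_nat.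
by case/andP: NK.
Qed.
Lemma lamE : lam N K * dx = dt. Proof. by rewrite /lam mulfVK// gt_eqF// dx_gt0. Qed.
Lemma lam_gt0 : 0 < lam N K :> R. Proof. by rewrite divr_gt0 ?dx_gt0 ?dt_gt0. Qed.
Lemma xmD m n : x_ (m + n) = x_ m + x_ n. Proof. by rewrite /xm intrD mulrDl. Qed.
Lemma xm1 : x_ 1 = dx. Proof. by rewrite /xm mul1r. Qed.
Lemma xmD1 m : x_ (m + 1) = x_ m + dx. Proof. by rewrite xmD xm1. Qed.
Lemma xmB1 m : x_ (m - 1) = x_ m - dx.
Proof. by rewrite /xm intrB mulrBl mul1r. Qed.
Lemma xm_period (m z : int) : x_ (m + (2 * N)%:Z * z) = x_ m + z%:~R.
Proof.
rewrite /xm intrD mulrDl intrM -mulrA (mulrC z%:~R) mulrA; congr (_ + _).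
by rewrite /Defs.dx -pmulrn natrM divff ?mul1r// gt_eqF// mulr_gt0// N_gt0.
Qed.
Lemma tkS k : t_ k.+1 = t_ k + dt. Proof. by rewrite /tk -natr1 mulrDl mul1r. Qed.
Lemma tk_period k j : t_ (k + 2 * K * j) = t_ k + j%:R.
Proof.
rewrite /tk natrD mulrDl !natrM; congr (_ + _).
by rewrite mulrAC /Defs.dt divff ?mul1r// gt_eqF// mulr_gt0// K_gt0.
Qed.
Lemma tk_one : t_ (2 * K) = 1.
Proof. by rewrite -[(2 * K)%N]add0n -[(2 * K)%N]muln1 tk_period /tk mul0r add0r. Qed.
Lemma tk0 : t_ 0 = 0. Proof. by rewrite /tk mul0r. Qed.

Lemma odd_node_near (x : R) k : exists2 m, ~~ even_node k m & `|x_ m - x| <= 2 * dx.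
Proof.
have dx0 := dx_gt0.
have /andP[fl fu] := floor_itv (x / dx).
set m := Num.floor (x / dx) in fl fu.
have mx : x_ m <= x by rewrite /xm -ler_pdivlMr.
have xm' : x <= x_ m + dx by rewrite -xmD1 /xm -ler_pdivrMr// ltW.
have [e|o] := boolP (even_node k m).
  exists (m + 1); first by rewrite even_nodeD1 e.
  by rewrite xmD1 ler_norml; apply/andP; split; lra.
by exists m => //; rewrite ler_norml; apply/andP; split; lra.
Qed.

Lemma periodic_max (f : int -> R) : (forall m, f (m + (2 * N)%:Z) = f m) ->
  exists m0, forall m, f m <= f m0.
Proof.
move=> pf.
have pfz n m : f (m + (2 * N)%:Z * n%:Z) = f m.
  elim: n => [|n IH]; first by rewrite mulr0 addr0.
  by rewrite -[RHS]IH -[RHS]pf; congr f; lia.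
have N0 : (0 < 2 * N)%N by rewrite muln_gt0; case/andP: NK.
pose i0 : 'I_(2 * N) := Ordinal N0.
have [i _ hi] := arg_maxP (fun i : 'I_(2 * N) => f i%:Z) (erefl (xpredT i0)).
exists i%:Z => m.
have r0 : (0 <= m %% (2 * N)%:Z)%Z by rewrite modz_ge0//; lia.
have r1 : (m %% (2 * N)%:Z < (2 * N)%:Z)%Z by rewrite ltz_pmod//; lia.
have -> : f m = f (m %% (2 * N)%:Z)%Z.
  rewrite [in LHS](divz_eq m (2 * N)%:Z) addrC mulrC.
  case: (m %/ _)%Z => n; first by rewrite pfz.
  by rewrite -[LHS](pfz n.+1) NegzE mulrN subrK.
have lt : (`|(m %% (2 * N)%:Z)%Z| < 2 * N)%N by lia.
have := hi (Ordinal lt) isT; rewrite /=.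
by rewrite gez0_abs.
Qed.

(** Read backwards in time the two weights are the step probabilities of a random walk on
    the nodes, with mean displacement $-w\,\Delta t$; the bound on $\lambda w$ makes them
    nonnegative. *)
Definition monotone_step (e : nat -> int -> R) (w : nat -> int -> R) (kap : R) (k : nat) :=
  forall m, even_node k m ->
    `|lam N K * w k m| <= 1 /\
    e k.+1 m <= (1 + lam N K * w k m) / 2 * e k (m - 1)
              + (1 - lam N K * w k m) / 2 * e k (m + 1) + kap.

Lemma average_le (b p q A B : R) : `|b| <= 1 -> p <= A -> q <= B ->
  (1 + b) / 2 * p + (1 - b) / 2 * q <= (1 + b) / 2 * A + (1 - b) / 2 * B.
Proof.
by rewrite ler_norml => /andP[? ?] ? ?; rewrite lerD// ler_wpM2l//; lra.
Qed.

Lemma maximum_principle e w kap A T :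
    (forall k, (k < T)%N -> monotone_step e w kap k) ->
    (forall m, ~~ even_node 0 m -> e 0%N m <= A) ->
  forall k, (k <= T)%N -> forall m, ~~ even_node k m -> e k m <= A + k%:R * kap.
Proof.
move=> st e0; elim=> [|k IH] kT m; first by rewrite mul0r addr0; exact: e0.
rewrite even_nodeSl negbK => em.
have [b1 he] := st k kT m em; apply: (le_trans he).
have p1 := IH (ltnW kT) (m - 1); have p2 := IH (ltnW kT) (m + 1).
rewrite even_nodeB1 em in p1; rewrite even_nodeD1 em in p2.
have := average_le b1 (p1 isT) (p2 isT); rewrite -[k.+1%:R]natr1; lra.
Qed.

(** The second moment about a characteristic curve propagates through the averaging
    step up to a factor $1 + O(\Delta t)$ and an additive $O(\Delta x\Delta t)$, so
    that after unit time the random walk of the scheme has drifted from the curve by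
    $O(\sqrt{\Delta x})$ in mean square. *)
Lemma second_moment_step (lambda0 L : R) (gam : R -> R) (b : R -> R -> R) k m :
    let w := b (x_ m) (t_ k) in
    0 < lambda0 <= lam N K -> 0 <= L ->
    (forall x y t, `|b x t - b y t| <= L * `|x - y|) ->
    (forall x t, `|b x t| <= L) ->
    (forall s d, 0 <= d -> `|gam (s + d) - gam s - d * b (gam s) s| <= L * d ^+ 2) ->
  (1 + lam N K * w) / 2 * (x_ (m - 1) - gam (t_ k)) ^+ 2
  + (1 - lam N K * w) / 2 * (x_ (m + 1) - gam (t_ k)) ^+ 2
  <= (1 + (2 * L ^+ 2 + 2 * L + 1) * dt) * (x_ m - gam (t_ k.+1)) ^+ 2
     + (3 * (2 * L ^+ 2 + L) ^+ 2 + lambda0^-1) * (dt * dx).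
Proof.
move=> w /andP[l0 ll] L0 bL bB gT.
have dx0 := dx_gt0; have dt0 := dt_gt0; have dtx := dt_le_dx; have dx1 := dx_le.
have := gT (t_ k) dt (ltW dt0); rewrite -tkS.
set g := gam (t_ k); set g' := gam (t_ k.+1); set bg := b g (t_ k).
set rho := g' - g - dt * bg => hrho.
have hb : `|bg - w| <= L * `|x_ m - g| by rewrite distrC; exact: bL.
have hbg : `|bg| <= L by exact: bB.
set M := 2 * L ^+ 2 + L.
have M0 : 0 <= M by rewrite addr_ge0// mulr_ge0// sqr_ge0.
pose d := x_ m - g; pose d' := x_ m - g'.
pose r := dt * (bg - w) + rho.
have dr : d - dt * w = d' + r by rewrite /d /d' /r /rho; lra.
have dt1 : dt <= 1 by lra.
have dtdt : dt ^+ 2 <= dt by rewrite expr2 ler_piMl// ltW.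
have hd : `|d| <= `|d'| + 2 * L * dt.
  rewrite (_ : d = d' + (dt * bg + rho)); last by rewrite /d /d' /rho; lra.
  apply: (le_trans (ler_normD _ _)); rewrite lerD2l.
  apply: (le_trans (ler_normD _ _)); rewrite normrM (gtr0_norm dt0).
  have := ler_wpM2l (ltW dt0) hbg; have := ler_wpM2l L0 dtdt; lra.
have hr : `|r| <= L * dt * `|d'| + M * dt ^+ 2.
  apply: (le_trans (ler_normD _ _)); rewrite normrM (gtr0_norm dt0).
  have h1 := ler_wpM2l (ltW dt0) hb.
  have h2 := ler_wpM2l (mulr_ge0 (ltW dt0) L0) hd.
  rewrite /M expr2 in hrho *; rewrite expr2.
  by move: h1 h2 hrho; rewrite -/d; lra.
have hsum : (1 + lam N K * w) / 2 * (x_ (m - 1) - g) ^+ 2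
  + (1 - lam N K * w) / 2 * (x_ (m + 1) - g) ^+ 2 = (d' + r) ^+ 2 + dx ^+ 2 - (dt * w) ^+ 2.
  by rewrite -dr xmB1 xmD1 /d -lamE; set la := lam N K; field.
rewrite hsum.
have hx : dx ^+ 2 <= lambda0^-1 * (dt * dx).
  have : 1 <= lambda0^-1 * lam N K by rewrite ler_pdivlMl// mulr1.
  by move=> /(ler_wpM2r (sqr_ge0 dx)); rewrite -lamE expr2; lra.
have hw : 0 <= (dt * w) ^+ 2 by exact: sqr_ge0.
have ht : dt ^+ 3 <= dt * dx by rewrite exprS ler_pM2l//; lra.
have n0 := normr_ge0 d'.
have q : (d' + r) ^+ 2 <= d' ^+ 2 + 2 * (`|d'| * `|r|) + `|r| ^+ 2.
  have := ler_norm (d' * r).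
  by rewrite normrM (real_normK (num_real r)) sqrrD; lra.
set a := `|d'| in n0 hd hr q *.
have a2 : d' ^+ 2 = a ^+ 2 by rewrite /a real_normK ?num_real.
rewrite -/d' a2; rewrite a2 in q.
have r0 := normr_ge0 r; set z := `|r| in r0 hr q *.
pose y := L * dt * a + M * dt ^+ 2.
have y1 : a * z <= a * y by rewrite ler_wpM2l.
have y2 : z ^+ 2 <= y ^+ 2 by rewrite lerXn2r// nnegrE // (le_trans r0).
have y3 : 2 * (a * y) <= (2 * L + 1) * dt * a ^+ 2 + M ^+ 2 * dt ^+ 3.
  have := mulr_ge0 (ltW dt0) (sqr_ge0 (a - M * dt)); rewrite /y !expr2 exprS expr2; lra.
have y4 : y ^+ 2 <= 2 * L ^+ 2 * dt * a ^+ 2 + 2 * M ^+ 2 * dt ^+ 3.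
  have := sqr_ge0 (L * dt * a - M * dt ^+ 2).
  have : 2 * (L ^+ 2 * a ^+ 2) * dt ^+ 2 <= 2 * (L ^+ 2 * a ^+ 2) * dt.
    apply: ler_wpM2l => //; apply: mulr_ge0 => //.
    by apply: mulr_ge0; exact: sqr_ge0.
  have : 2 * M ^+ 2 * dt ^+ 2 * dt ^+ 2 <= 2 * M ^+ 2 * dt ^+ 2 * dt.
    apply: ler_wpM2l => //; apply: mulr_ge0; last exact: sqr_ge0.
    by apply: mulr_ge0 => //; exact: sqr_ge0.
  rewrite /y !expr2 exprS expr2; lra.
have y5 : 3 * M ^+ 2 * dt ^+ 3 <= 3 * M ^+ 2 * (dt * dx).
  by apply: ler_wpM2l => //; apply: mulr_ge0 => //; exact: sqr_ge0.
lra.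
Qed.

Section Block.
Variables (lambda0 L kap l : R) (e : nat -> int -> R) (b : R -> R -> R).
Hypotheses (l0 : 0 < lambda0 <= lam N K) (L0 : 0 <= L) (ll0 : 0 <= l).
Hypothesis bL : forall x y t, `|b x t - b y t| <= L * `|x - y|.
Hypothesis bB : forall x t, `|b x t| <= L.
Hypothesis st : forall k, (k < 2 * K)%N -> monotone_step e (fun k m => b (x_ m) (t_ k)) kap k.
Let C2 := 2 * L ^+ 2 + 2 * L + 1.
Let C3 := 3 * (2 * L ^+ 2 + L) ^+ 2 + lambda0^-1.
Definition block_const := (expR C2 * (C3 + 4) + 1) / 2.

(** The cone $l\,|x-\gamma(0)|$ lies below the parabola
    $l\,((x-\gamma(0))^2/(2s)+s/2)$ for every $s>0$, and parabolas are what the second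
    moment estimate transports.  After unit time the second moment near $\gamma(1)$ is
    $O(\Delta x)$, so $s=\sqrt{\Delta x}$ is the best choice. *)
Lemma block_estimate (gam : R -> R) A :
    (forall s d, 0 <= d -> `|gam (s + d) - gam s - d * b (gam s) s| <= L * d ^+ 2) ->
    (forall m, ~~ even_node 0 m -> e 0%N m <= A + l * `|x_ m - gam 0|) ->
  forall m, ~~ even_node (2 * K) m -> `|x_ m - gam 1| <= 2 * dx ->
  e (2 * K)%N m <= A + (2 * K)%:R * kap + l * block_const * Num.sqrt dx.
Proof.
move=> gT e0.
have dx0 := dx_gt0; have dt0 := dt_gt0; have dtx := dt_le_dx; have dx1 := dx_le.
have li0 : 0 < lambda0 by case/andP: l0.
pose s := Num.sqrt dx; have s0 : 0 < s by rewrite sqrtr_gt0.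
have s2 : s ^+ 2 = dx by rewrite sqr_sqrtr// ltW.
have sE : Num.sqrt dx = s by [].
clearbody s.
have C20 : 0 <= C2 by rewrite !addr_ge0// !mulr_ge0// sqr_ge0.
have C30 : 0 <= C3.
  by apply: addr_ge0; [apply: mulr_ge0 => //; exact: sqr_ge0|rewrite invr_ge0 ltW].
pose G := 1 + C2 * dt.
have G1 : 1 <= G by rewrite lerDl mulr_ge0// ltW.
have Gk k : 0 <= G ^+ k by rewrite exprn_ge0// (le_trans ler01).
pose D := l / (2 * s); have D0 : 0 <= D by rewrite divr_ge0// mulr_ge0// ltW.
have cdd : 0 <= C3 * (dt * dx) by rewrite !mulr_ge0// ltW.
have claim k : (k <= 2 * K)%N -> forall m, ~~ even_node k m ->
    e k m <= A + k%:R * kap + D * (G ^+ k * ((x_ m - gam (t_ k)) ^+ 2 + C3 * (dt * dx) * k%:R)) + l * s / 2.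
  elim: k => [|k IH] kK m.
    move=> /e0 h; apply: (le_trans h); rewrite tk0 mul0r addr0 expr0 mul1r mulr0 addr0 -addrA lerD2l.
    rewrite -(real_normK (num_real (x_ m - gam 0))); set y := `|_|.
    rewrite -subr_ge0 (_ : _ - _ = D * (y - s) ^+ 2); first by rewrite mulr_ge0// sqr_ge0.
    by rewrite /D; field; rewrite gt_eqF.
  rewrite even_nodeSl negbK => em.
  have [b1 he] := st kK em; apply: (le_trans he).
  have p1 := IH (ltnW kK) (m - 1); have p2 := IH (ltnW kK) (m + 1).
  rewrite even_nodeB1 em in p1; rewrite even_nodeD1 em in p2.
  have h1 := average_le b1 (p1 isT) (p2 isT).
  have h2 := second_moment_step k m l0 L0 bL bB gT.
  rewrite -/C2 -/C3 -/G in h2.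
  have h3 := ler_wpM2l (mulr_ge0 D0 (Gk k)) h2.
  have h4 : D * G ^+ k * (C3 * (dt * dx)) * k.+1%:R <= D * G ^+ k.+1 * (C3 * (dt * dx)) * k.+1%:R.
    rewrite ler_wpM2r// ler_wpM2r// ler_wpM2l// exprS ler_peMl//.
  move: h1 h2 h3 h4; rewrite -[k.+1%:R]natr1 (exprS G k).
  set lw := lam N K * _; set X := (x_ (m - 1) - _) ^+ 2; set Y := (x_ (m + 1) - _) ^+ 2.
  set Z := (x_ m - _) ^+ 2; set Gn := G ^+ k; lra.
move=> m om hm; apply: (le_trans (claim _ (leqnn _) m om)).
rewrite -addrA lerD2l tk_one.
have dtK : dt * (2 * K)%:R = 1 by rewrite mulrC; exact: tk_one.
have GE : G ^+ (2 * K) <= expR C2.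
  have h : G <= expR (C2 * dt) by exact: expR_ge1Dx.
  apply: (le_trans (lerXn2r _ _ _ h)); rewrite ?nnegrE ?expR_ge0 ?(le_trans ler01)//.
  by rewrite -expRM_natl mulrCA [_ * dt]mulrC dtK mulr1.
have h1 : (x_ m - gam 1) ^+ 2 + C3 * (dt * dx) * (2 * K)%:R <= (C3 + 4) * dx.
  rewrite -(real_normK (num_real (x_ m - gam 1))) (_ : C3 * _ * _ = C3 * dx * (dt * (2 * K)%:R)); last by lra.
  rewrite dtK mulr1.
  have : `|x_ m - gam 1| ^+ 2 <= (2 * dx) ^+ 2 by rewrite lerXn2r// nnegrE mulr_ge0// ltW.
  have : dx ^+ 2 <= dx by rewrite expr2 ler_piMl ?ltW// (le_lt_trans dx1)// invf_lt1// ltr1n.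
  by rewrite exprMn; lra.
have h2 : G ^+ (2 * K) * ((x_ m - gam 1) ^+ 2 + C3 * (dt * dx) * (2 * K)%:R) <= expR C2 * (C3 + 4) * dx.
  rewrite -[leRHS]mulrA; apply: ler_pM => //.
  by apply: addr_ge0; [exact: sqr_ge0|exact: mulr_ge0 cdd (ler0n _ _)].
apply: (le_trans (lerD (ler_wpM2l D0 h2) (lexx _))).
rewrite sE -s2 /D /block_const le_eqVlt; apply/orP; left; apply/eqP.
by field; rewrite gt_eqF.
Qed.

(** The estimate near $\gamma(1)$ extends to all nodes by the Lipschitz bound on the
    periodic nodal error, which restores the cone shape of the hypothesis at time zero
    around the next point of the curve.  The constant $l$ stays the same, so the errors
    add up linearly along the characteristic. *)
Lemma orbit_estimate (gam : R -> R) A :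
    (forall x t, b x (t + 1) = b x t) ->
    (forall s d, 0 <= d -> `|gam (s + d) - gam s - d * b (gam s) s| <= L * d ^+ 2) ->
    (forall m, ~~ even_node 0 m -> e (2 * K)%N m = e 0%N m) ->
    (forall m m', ~~ even_node 0 m -> ~~ even_node 0 m' -> `|e 0%N m - e 0%N m'| <= l * `|x_ m - x_ m'|) ->
    (forall m, ~~ even_node 0 m -> e 0%N m <= A + l * `|x_ m - gam 0|) ->
  forall j m, ~~ even_node 0 m ->
  e 0%N m <= A + j%:R * ((2 * K)%:R * kap + l * block_const * Num.sqrt dx + 2 * l * dx)
             + l * `|x_ m - gam j%:R|.
Proof.
move=> bper gT eper eL e0; elim=> [|j IH] m om; first by rewrite mul0r addr0 e0.
have bj x t : b x (t + j%:R) = b x t.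
  by elim: (j) => [|i IHi]; rewrite ?addr0// -[i.+1%:R]natr1 addrA bper.
have gTj s d : 0 <= d ->
    `|gam (s + d + j%:R) - gam (s + j%:R) - d * b (gam (s + j%:R)) s| <= L * d ^+ 2.
  by move=> d0; rewrite -(bj _ s) (addrAC s d); exact: gT.
have [m' om' hm'] := odd_node_near (gam (1 + j%:R)) 0.
have om2 : ~~ even_node (2 * K) m' by rewrite -[(2 * K)%N]add0n even_node_time.
have IH0 m0 : ~~ even_node 0 m0 -> e 0%N m0 <= A + j%:R * ((2 * K)%:R * kap + l * block_const * Num.sqrt dx + 2 * l * dx) + l * `|x_ m0 - gam (0 + j%:R)|.
  by rewrite add0r; exact: IH.
have h := block_estimate gTj IH0 om2 hm'.
rewrite (eper _ om') in h.
have h2 := eL m m' om om'; rewrite ler_norml in h2; case/andP: h2 => _ h2.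
have h3 : `|x_ m - x_ m'| <= `|x_ m - gam j.+1%:R| + 2 * dx.
  rewrite -[_ - x_ m'](subrKA (gam j.+1%:R)) (le_trans (ler_normD _ _))// lerD2l.
  by rewrite distrC -natr1 (addrC j%:R).
have h4 := ler_wpM2l ll0 h3.
by move: h h2 h4; rewrite -[j.+1%:R]natr1; lra.
Qed.
End Block.

End Grid.

(** * The error equation of the scheme *)

Section Scheme.
Context {R : realType}.
Variables (H : R -> R -> R -> R) (c : R) (N K : nat).
Hypothesis NK : (0 < N <= K)%N.
Local Notation dx := (dx N : R).
Local Notation dt := (dt K : R).
Local Notation x_ m := (xm N m : R).
Local Notation t_ k := (tk K k : R).

Definition grid_solution (h : R) (v : nat -> int -> R) : Prop :=
  (forall k m, even_node k m ->
     (v k.+1 m - (v k (m - 1) + v k (m + 1)) / 2) / dt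
     + H (x_ m) (t_ k) (c + (v k (m + 1) - v k (m - 1)) / (2 * dx)) = h) /\
  (forall k m, even_node k m -> v k (m + 1 + (2 * N)%:Z) = v k (m + 1)).

Definition slope (v : nat -> int -> R) (k : nat) (m : int) : R :=
  (v k (m + 1) - v k (m - 1)) / (2 * dx).

Lemma grid_step h v k m : grid_solution h v -> even_node k m ->
  v k.+1 m = (v k (m - 1) + v k (m + 1)) / 2 - dt * (H (x_ m) (t_ k) (c + slope v k m) - h).
Proof.
move=> [rec _] em; have := rec k m em; rewrite -/(slope v k m) => <-.
have d0 : 0 < dt by exact: (dt_gt0 NK).
by field; rewrite gt_eqF.
Qed.

Lemma grid_periodic h v : grid_solution h v ->
  forall k m, ~~ even_node k m -> v k (m + (2 * N)%:Z) = v k m.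
Proof.
move=> [_ per] k m om; have := per k (m - 1).
by rewrite even_nodeB1 om subrK; apply.
Qed.

Lemma grid_periodicz h v : grid_solution h v ->
  forall k m (z : int), ~~ even_node k m -> v k (m + (2 * N)%:Z * z) = v k m.
Proof.
move=> gv k m z om.
have P n m' : ~~ even_node k m' -> v k (m' + (2 * N)%:Z * n%:Z) = v k m'.
  move=> om'; elim: n => [|n IH]; first by rewrite mulr0 addr0.
  rewrite intS mulrDr mulr1 addrA addrAC (grid_periodic gv)//.
  by rewrite PoszM -mulrA even_nodeDn.
case: z => n; first exact: P.
rewrite -[LHS](P n.+1); last by rewrite PoszM -mulrA even_nodeDn.
by rewrite NegzE mulrN subrK.
Qed.

Lemma slope_step h v k m : grid_solution h v -> even_node k m ->
  (slope v k.+1 (m + 1) - (slope v k m + slope v k (m + 2)) / 2) / dt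
  + (H (x_ (m + 2)) (t_ k) (c + slope v k (m + 2)) - H (x_ m) (t_ k) (c + slope v k m)) / (2 * dx) = 0.
Proof.
move=> gv em; have d0 : 0 < dt by exact: (dt_gt0 NK).
have x0 : 0 < dx by exact: (dx_gt0 NK).
have em2 : even_node k (m + 2) by rewrite -[2]mulr1 even_nodeDn.
have s1 := grid_step gv em; have s2 := grid_step gv em2.
rewrite {1}/slope (_ : m + 1 + 1 = m + 2); last by lia.
rewrite addrK s1 s2.
set h1 := H _ _ _; set h2 := H _ _ _.
rewrite /slope (_ : m + 2 - 1 = m + 1); last by lia.
by field; rewrite !gt_eqF.
Qed.

Section Error.
Variables (hbar U L lambda0 : R) (ubar vbar : R -> R -> R).
Hypothesis reg : regular_solution H c hbar ubar vbar U L.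
Hypothesis Hconvex : forall x t p q, H x t p + Dp H x t p * (q - p) <= H x t q.
Hypothesis hl0 : 0 < lambda0 <= lam N K.
Variables (h : R) (v : nat -> int -> R).
Hypothesis gv : grid_solution h v.

Definition grid_error k m : R := v k m - vbar (x_ m) (t_ k).
(** The three summands bound the time Taylor error, the artificial viscosity (where
    $\Delta x^2\le\lambda_0^{-1}\Delta t\Delta x$) and the error of the central difference
    multiplied by the drift. *)
Definition consistency_const (B : R) := L + L / (2 * lambda0) + B * L / 2.

Lemma vbar_average x t :
  `|(vbar (x - dx) t + vbar (x + dx) t) / 2 - vbar x t| <= L / (2 * lambda0) * (dt * dx).
Proof.
have d0 : 0 < dt by exact: (dt_gt0 NK).
have x0 : 0 < dx by exact: (dx_gt0 NK).
case/andP: hl0 => l0 ll.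
have h1 := regular_v_taylor reg x t dx; have h2 := regular_v_taylor reg x t (- dx).
have L0 := reg_L reg.
have : L / 2 * dx ^+ 2 <= L / (2 * lambda0) * (dt * dx).
  have : 1 <= lambda0^-1 * lam N K by rewrite ler_pdivlMl// mulr1.
  move=> /(ler_wpM2r (sqr_ge0 dx)) h3.
  have := ler_wpM2l L0 h3; rewrite -(lamE NK) invfM expr2; lra.
move: h1 h2; rewrite sqrrN !ler_norml => /andP[? ?] /andP[? ?] ?; apply/andP; split; lra.
Qed.

Lemma vbar_slope x t :
  `|(vbar (x + dx) t - vbar (x - dx) t) / (2 * dx) - ubar x t| <= L / 2 * dx.
Proof.
have x0 : 0 < dx by exact: (dx_gt0 NK).
have h1 := regular_v_taylor reg x t dx; have h2 := regular_v_taylor reg x t (- dx).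
have -> : (vbar (x + dx) t - vbar (x - dx) t) / (2 * dx) - ubar x t =
    ((vbar (x + dx) t - vbar x t - ubar x t * dx) - (vbar (x - dx) t - vbar x t - ubar x t * - dx)) / (2 * dx).
  by field; rewrite gt_eqF.
rewrite normrM normfV (gtr0_norm (_ : 0 < 2 * dx)) ?mulr_gt0// ler_pdivrMr ?mulr_gt0//.
rewrite sqrrN in h2.
by apply: (le_trans (ler_normB _ _)); apply: (le_trans (lerD h1 h2)); rewrite expr2; lra.
Qed.

Lemma error_slope k m : slope v k m =
  (grid_error k (m + 1) - grid_error k (m - 1)) / (2 * dx)
  + (vbar (x_ m + dx) (t_ k) - vbar (x_ m - dx) (t_ k)) / (2 * dx).
Proof. by rewrite /slope /grid_error xmD1 xmB1 -mulrDl; congr (_ / _); lra. Qed.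

Lemma transport_algebra b (a1 a2 : R) :
  dt * (b * ((a1 - a2) / (2 * dx))) = lam N K * b / 2 * (a1 - a2).
Proof.
have x0 : 0 < dx by exact: (dx_gt0 NK).
rewrite -(lamE NK); set la := lam N K.
by field; rewrite gt_eqF.
Qed.

(** Convexity at the exact slope: the error is a subsolution of a linear scheme whose
    drift is that of the exact characteristics. *)
Lemma error_upper_step k m b : even_node k m ->
  b = drift H c ubar (x_ m) (t_ k) ->
  grid_error k.+1 m <= (1 + lam N K * b) / 2 * grid_error k (m - 1)
    + (1 - lam N K * b) / 2 * grid_error k (m + 1)
    + (dt * (h - hbar) + consistency_const L * (dt * dx)).
Proof.
move=> em bE; have d0 : 0 < dt by exact: (dt_gt0 NK).
have x0 : 0 < dx by exact: (dx_gt0 NK).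
have L0 := reg_L reg.
rewrite {1}/grid_error (grid_step gv em) tkS.
have h1 := reg_v_step reg (x_ m) (t_ k) (ltW d0).
have h2 := vbar_average (x_ m) (t_ k).
have h3 := vbar_slope (x_ m) (t_ k).
have h4 := Hconvex (x_ m) (t_ k) (c + ubar (x_ m) (t_ k)) (c + slope v k m).
rewrite -/(drift H c ubar (x_ m) (t_ k)) -bE error_slope in h4.
have bB : `|b| <= L by rewrite bE; exact: (reg_drift_bound reg).
move: h1 h2 h3 h4; rewrite error_slope.
set De := (grid_error k (m + 1) - grid_error k (m - 1)) / (2 * dx).
set Db := (vbar _ _ - _) / (2 * dx).
have tr := transport_algebra b (grid_error k (m + 1)) (grid_error k (m - 1)).
rewrite -/De in tr.
set ub := ubar _ _; set H1 := H _ _ (c + ub); set H2 := H _ _ (c + (De + Db)).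
move=> h1 h2 h3 h4.
have h5 : `|b * (Db - ub)| <= L * (L / 2 * dx).
  by rewrite normrM ler_pM.
have h6 : L * dt ^+ 2 <= L * (dt * dx) by rewrite ler_wpM2l// expr2 ler_wpM2l ?(ltW d0)// (dt_le_dx NK).
have h7 := ler_wpM2l (ltW d0) h4.
have h8 : - (dt * (b * (Db - ub))) <= dt * (L * (L / 2 * dx)).
  rewrite -mulrN ler_wpM2l ?(ltW d0)//.
  by apply: le_trans h5; rewrite -normrN ler_norm.
have vE : v k (m - 1) + v k (m + 1) = grid_error k (m - 1) + grid_error k (m + 1)
    + (vbar (x_ m - dx) (t_ k) + vbar (x_ m + dx) (t_ k)).
  by rewrite /grid_error xmD1 xmB1; lra.
rewrite vE; move: h1 h2; rewrite !ler_norml => /andP[h1 _] /andP[_ h2].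
rewrite /consistency_const.
move: h1 h2 tr h7 h8 h6; clear; lra.
Qed.

(** The mirror image: expanding at the discrete slope controls the error from below,
    with the drift of the discrete solution. *)
Lemma error_lower_step (B : R) k m b : even_node k m ->
  b = Dp H (x_ m) (t_ k) (c + slope v k m) ->
  `|b| <= B ->
  - grid_error k.+1 m <= (1 + lam N K * b) / 2 * (- grid_error k (m - 1))
    + (1 - lam N K * b) / 2 * (- grid_error k (m + 1))
    + (dt * (hbar - h) + consistency_const B * (dt * dx)).
Proof.
move=> em bE bB; have d0 : 0 < dt by exact: (dt_gt0 NK).
have x0 : 0 < dx by exact: (dx_gt0 NK).
have L0 := reg_L reg.
rewrite {1}/grid_error (grid_step gv em) tkS.
have h1 := reg_v_step reg (x_ m) (t_ k) (ltW d0).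
have h2 := vbar_average (x_ m) (t_ k).
have h3 := vbar_slope (x_ m) (t_ k).
have h4 := Hconvex (x_ m) (t_ k) (c + slope v k m) (c + ubar (x_ m) (t_ k)).
rewrite -bE in h4.
move: h1 h2 h3 h4; rewrite error_slope.
set De := (grid_error k (m + 1) - grid_error k (m - 1)) / (2 * dx).
set Db := (vbar _ _ - _) / (2 * dx).
have tr := transport_algebra b (grid_error k (m + 1)) (grid_error k (m - 1)).
rewrite -/De in tr.
set ub := ubar _ _; set H1 := H _ _ (c + ub); set H2 := H _ _ (c + (De + Db)).
move=> h1 h2 h3 h4.
have h5 : `|b * (Db - ub)| <= B * (L / 2 * dx).
  by rewrite normrM ler_pM.
have h6 : L * dt ^+ 2 <= L * (dt * dx) by rewrite ler_wpM2l// expr2 ler_wpM2l ?(ltW d0)// (dt_le_dx NK).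
have h7 := ler_wpM2l (ltW d0) h4.
have h8 : dt * (b * (Db - ub)) <= dt * (B * (L / 2 * dx)).
  rewrite ler_wpM2l ?(ltW d0)//.
  by apply: le_trans h5; rewrite ler_norm.
have vE : v k (m - 1) + v k (m + 1) = grid_error k (m - 1) + grid_error k (m + 1)
    + (vbar (x_ m - dx) (t_ k) + vbar (x_ m + dx) (t_ k)).
  by rewrite /grid_error xmD1 xmB1; lra.
rewrite vE; move: h1 h2; rewrite !ler_norml => /andP[_ h1] /andP[h2 _].
rewrite /consistency_const.
move: h1 h2 tr h7 h8 h6; clear; lra.
Qed.

End Error.
End Scheme.

(** * Existence of characteristic curves *)

Section Antiderivative.
Context {R : realType}.

Lemma zero_derivative_eq (f : R -> R) (a b : R) :
  (forall z, Num.min a b <= z <= Num.max a b -> is_derive z 1 f 0) -> f a = f b.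
Proof.
move=> h; apply/eqP; rewrite -subr_eq0 -normr_le0 -[leRHS](mul0r `|a - b|).
apply: (@derivative_bound_lipschitz R f (fun=> 0) 0 (Num.min a b) (Num.max a b)) => //.
- by move=> z _; rewrite normr0.
- by rewrite ge_min le_max !lexx.
- by rewrite ge_min le_max !lexx !orbT.
Qed.

(** The fundamental theorem of calculus differentiates $\int_a^x g$ at interior points
    only; on the whole line the antiderivatives based at $-n$ are glued together. *)
Lemma antiderivative_exists (g : R -> R) : continuous g ->
  exists G : R -> R, G 0 = 0 /\ forall s : R, is_derive s 1 G (g s).
Proof.
move=> cg.
pose I a x : R := \int[@lebesgue_measure R]_(t in `[a, x]) g t.
have dI (a x : R) : a < x -> is_derive x 1 (I a) (g x).
  move=> ax.
  have xu : x < x + 1 by rewrite ltrDl.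
  have int : (@lebesgue_measure R).-integrable [set` Interval (BLeft a) (BRight (x + 1))] (EFin \o g).
    by apply: continuous_compact_integrable; [exact: segment_compact|exact: continuous_subspaceT].
  have [] := @continuous_FTC1 R g (BLeft a) x (x + 1) xu int _ (cg x).
    by rewrite lte_fin.
  by move=> d1 d2; rewrite -d2; exact: derivable_is_derive1.
pose J (n : nat) s := I (- n%:R) s - I (- n%:R) 0.
have J0 n : J n 0 = 0 by rewrite /J subrr.
have dJ n (s : R) : - n%:R < s -> is_derive s 1 (J n) (g s).
  move=> ns; rewrite /J; have := dI _ _ ns => h.
  by rewrite -[g s]subr0; apply: is_deriveB.
have JJ n m s : (0 < n)%N -> (0 < m)%N -> - n%:R < s -> - m%:R < s -> J n s = J m s.
  move=> n0 m0 ns ms; apply/eqP; rewrite -subr_eq0; apply/eqP.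
  suff -> : J n s - J m s = J n 0 - J m 0 by rewrite !J0 subrr.
  apply: (@zero_derivative_eq (fun s => J n s - J m s) s 0) => z /andP[zmin _].
  have nz : - n%:R < z by apply: lt_le_trans zmin; rewrite lt_min ns oppr_lt0 ltr0n.
  have mz : - m%:R < z by apply: lt_le_trans zmin; rewrite lt_min ms oppr_lt0 ltr0n.
  by have h1 := dJ _ _ nz; have h2 := dJ _ _ mz; rewrite -(subrr (g z)); apply: is_deriveB.
pose k (s : R) := (Num.truncn `|s|).+1.
have ks (s : R) : - (k s)%:R < s.
  by have := truncnS_gt `|s|; rewrite ltrNl => /(le_lt_trans _); apply; rewrite -normrN ler_norm.
exists (fun s => J (k s) s); split; first by rewrite J0.
move=> s.
have h := dJ (k s) s (ks s).
apply: (near_eq_is_derive (f := J (k s))).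
have : \forall z \near s, - (k s)%:R < z by exact: (cvgr_gt _ (@cvg_id _ (nbhs s))).
by apply: filterS => z kz; apply: JJ => //.
Qed.

End Antiderivative.

Section Characteristics.
Context {R : realType}.

(** The contraction step of the Picard iteration: the integral of $2a\,e^{2a|z|}$ stays
    below $e^{2a|s|}$ on either side of the origin. *)
Lemma exponential_comparison (G dG : R -> R) (a s : R) : 0 <= a ->
    (forall z : R, is_derive z 1 G (dG z)) -> G 0 = 0 ->
    (forall z, `|dG z| <= 2 * a * expR (2 * a * `|z|)) ->
  `|G s| <= expR (2 * a * `|s|).
Proof.
move=> a0.
have pos (F dF : R -> R) (z : R) : 0 <= z -> (forall z : R, is_derive z 1 F (dF z)) -> F 0 = 0 ->
    (forall z, dF z <= 2 * a * expR (2 * a * `|z|)) -> F z <= expR (2 * a * `|z|).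
  move=> z0 dF' F0 bd.
  pose h (y : R) := expR (2 * a * y) - F y.
  have dh (y : R) : is_derive y 1 h (expR (2 * a * y) * (2 * a) - dF y).
    have e1 : is_derive y 1 (fun s : R => expR (2 * a * s)) (expR (2 * a * y) * (2 * a)).
      have e : is_derive y 1 (fun s : R => 2 * a * s) (2 * a).
        by apply: is_derive_eq; rewrite /GRing.scale /=; lra.
      exact: (@is_derive1_comp R expR (fun s => 2 * a * s) y _ _ (is_derive_expR _) e).
    by have := dF' y => ?; apply: is_deriveB.
  have [y /andP[y0 yz] E] := mvt (f := h) (df := fun y => expR (2 * a * y) * (2 * a) - dF y) z0 (fun y _ => dh y).
  have : 0 <= h z - h 0.
    by rewrite E mulr_ge0 ?subr0// subr_ge0; have := bd y; rewrite ger0_norm// mulrC.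
  by rewrite /h F0 mulr0 expR0 (ger0_norm z0); lra.
move=> GdG G0 bd.
have dN (z : R) : is_derive z 1 (fun z => - G z) (- dG z) by have := GdG z => ?; apply: is_deriveN.
have dR (z : R) : is_derive z 1 (fun z => G (- z)) (- dG (- z)).
  have e : is_derive z 1 (fun z : R => - z) (- 1) by have := is_derive_id z (1 : R) => ?; apply: is_deriveN.
  by rewrite -[- dG _]mulrN1; exact: (@is_derive1_comp R G (fun z => - z) z _ _ (GdG (- z)) e).
have dNR (z : R) : is_derive z 1 (fun z => - G (- z)) (dG (- z)).
  by rewrite -[dG _]opprK; have := dR z => ?; apply: is_deriveN.
have [s0|/ltW s0] := leP 0 s.
  rewrite ler_norml; apply/andP; split.
    rewrite lerNl; apply: (pos (fun z => - G z) (fun z => - dG z)) => //; first by rewrite G0 oppr0.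
    by move=> z; apply: le_trans (bd z); rewrite -normrN ler_norm.
  by apply: (pos G dG) => // z; apply: le_trans (bd z); rewrite ler_norm.
have ns0 : 0 <= - s by rewrite oppr_ge0.
rewrite -(normrN s) -[s in G s]opprK ler_norml; apply/andP; split.
  rewrite lerNl; apply: (pos (fun z => - G (- z)) (fun z => dG (- z))) => //; first by rewrite oppr0 G0 oppr0.
  by move=> z; rewrite -(normrN z); apply: le_trans (bd (- z)); rewrite ler_norm.
apply: (pos (fun z => G (- z)) (fun z => - dG (- z))) => //; first by rewrite oppr0 G0.
by move=> z; rewrite -(normrN z); apply: le_trans (bd (- z)); rewrite -normrN ler_norm.
Qed.

Lemma le_of_geometric_error (a b C : R) : (forall n, a <= b + C * 2^-1 ^+ n) -> a <= b.
Proof.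
move=> h; rewrite leNgt; apply/negP => ba.
have := @cvg_geometric R C 2^-1.
rewrite ger0_norm ?invr_ge0// => /(_ _); rewrite invf_lt1// ltr1n => /(_ isT) cv.
have : \forall n \near \oo, C * 2^-1 ^+ n < a - b.
  by apply: (cvgr_lt _ cv); rewrite subr_gt0.
move=> [n _ hn]; have := hn n (leqnn n) => /= h1; have := h n.
lra.
Qed.

(** Picard iteration in the weighted norm $\sup_s e^{-2L|s|}|\cdot|$, in which the
    integral operator contracts by $1/2$ on the whole line at once. *)
Lemma characteristic_exists (b : R -> R -> R) (L x0 : R) : 0 <= L ->
    (forall x t y s, `|b x t - b y s| <= L * (`|x - y| + `|t - s|)) ->
    (forall x t, `|b x t| <= L) ->
  exists gam : R -> R, gam 0 = x0 /\ forall s : R, is_derive s 1 gam (b (gam s) s).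
Proof.
move=> L0 bL bB.
pose A (g : R -> R) := if pselect (continuous g) is left h then sval (cid (antiderivative_exists h)) else 0.
have A0 (g : R -> R) : continuous g -> A g 0 = 0.
  by rewrite /A; case: pselect => // h _; case: cid => G [].
have dA (g : R -> R) : continuous g -> forall s : R, is_derive s 1 (A g) (g s).
  by rewrite /A; case: pselect => // h _; case: cid => G [].
have cb (gam : R -> R) (M : R) : 0 <= M -> (forall s t, `|gam s - gam t| <= M * `|s - t|) ->
    continuous (fun s => b (gam s) s).
  move=> M0 gM s; apply/cvgrPdist_le => /= e e0.
  pose d := e / (L * (M + 1) + 1).
  have q0 : 0 < L * (M + 1) + 1 by rewrite ltr_wpDl// mulr_ge0// addr_ge0.
  have d0 : 0 < d by rewrite divr_gt0.
  exists d => //= t st; apply: (le_trans (bL _ _ _ _)).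
  have h1 : `|gam s - gam t| + `|s - t| <= (M + 1) * d.
    rewrite mulrDl mul1r lerD ?(ltW st)//; apply: (le_trans (gM s t)).
    by rewrite ler_wpM2l// ltW.
  apply: (le_trans (ler_wpM2l L0 h1)).
  have : d * (L * (M + 1) + 1) = e by rewrite /d mulfVK// gt_eqF.
  lra.
pose T (gam : R -> R) s := x0 + A (fun s => b (gam s) s) s.
have T0 (gam : R -> R) : continuous (fun s => b (gam s) s) -> T gam 0 = x0.
  by move=> c; rewrite /T A0// addr0.
have dT (gam : R -> R) (s : R) : continuous (fun s => b (gam s) s) -> is_derive s 1 (T gam) (b (gam s) s).
  by move=> c; have := dA _ c s => h; rewrite -[b _ _]add0r; apply: is_deriveD.
pose p n := iter n T (fun=> x0).
have pL n s t : `|p n s - p n t| <= L * `|s - t|.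
  elim: n s t => [|n IH] s t; first by rewrite /p /= subrr normr0 mulr_ge0.
  apply: (bounded_derivative_lipschitz (df := fun s => b (p n s) s)) => // z.
  by apply: dT; exact: (cb _ L).
have cp n : continuous (fun s => b (p n s) s) by exact: (cb _ L).
have p0 n : p n 0 = x0 by case: n => [|n] //; exact: T0.
pose W (s : R) := expR (2 * L * `|s|).
have W1 s : 1 <= W s by rewrite -expR0 ler_expR !mulr_ge0.
have contract (G dG : R -> R) (M : R) : 0 < M -> G 0 = 0 -> (forall s : R, is_derive s 1 G (dG s)) ->
    (forall s, `|dG s| <= L * (M * W s)) -> forall s, `|G s| <= M / 2 * W s.
  move=> M0 G0 GdG bd s.
  have M2 : 0 < M / 2 by rewrite divr_gt0.
  have := @exponential_comparison (fun s => (M / 2)^-1 * G s) (fun s => (M / 2)^-1 * dG s) L s L0.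
  rewrite normrM normfV (gtr0_norm M2) ler_pdivrMl//; apply.
  - by rewrite G0 mulr0.
  - move=> z; rewrite normrM normfV (gtr0_norm M2) ler_pdivrMl//.
    by apply: (le_trans (bd z)); rewrite -/(W z); lra.
have step n s : `|p n.+1 s - p n s| <= 2^-1 ^+ n * W s.
  elim: n s => [|n IH] s.
    have two : 2 / 2 = 1 :> R by rewrite divff.
    rewrite expr0 -[X in X * W s]two.
    apply: (contract (fun s => p 1%N s - p 0%N s) (fun s => b (p 0%N s) s)) => //.
    - by rewrite !p0 subrr.
    - by move=> z; have h := dT (p 0%N) z (cp 0%N); rewrite -[b _ _]subr0; apply: is_deriveB.
    - by move=> z; apply: (le_trans (bB _ _)); rewrite ler_peMr// mulr_ege1 ?ler1n.
  rewrite exprSr; apply: (contract (fun s => p n.+2 s - p n.+1 s) (fun s => b (p n.+1 s) s - b (p n s) s)).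
  - by rewrite exprn_gt0// invr_gt0.
  - by rewrite !p0 subrr.
  - move=> z; have h1 := dT (p n.+1) z (cp n.+1); have h2 := dT (p n) z (cp n).
    exact: is_deriveB.
  - by move=> z; apply: (le_trans (bL _ _ _ _)); rewrite subrr normr0 addr0 ler_wpM2l.
have W0 s : 0 <= W s by apply: le_trans (W1 s).
have tail n k s : `|p (n + k)%N s - p n s| <= 2 * (2^-1 ^+ n - 2^-1 ^+ (n + k)) * W s.
  elim: k => [|k IH]; first by rewrite addn0 !subrr normr0 mulr0 mul0r.
  rewrite addnS -[_ - p n s](subrKA (p (n + k)%N s)) (le_trans (ler_normD _ _))//.
  apply: (le_trans (lerD (step _ _) IH)).
  by rewrite exprS; set y := _ ^+ (n + k); lra.
have tail' n m s : `|p m s - p n s| <= 2 * (2^-1 ^+ n + 2^-1 ^+ m) * W s.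
  have i0 k : 0 <= 2^-1 ^+ k :> R by rewrite exprn_ge0// invr_ge0.
  have [nm|/ltnW mn] := leqP n m.
    rewrite -(subnKC nm); apply: (le_trans (tail _ _ _)); rewrite ler_wpM2r// ler_wpM2l//.
    by rewrite lerD2l ge0_cp.
  rewrite -(subnKC mn) distrC; apply: (le_trans (tail _ _ _)); rewrite ler_wpM2r// ler_wpM2l// addrC.
  by rewrite lerD2r ge0_cp.
pose a s n := p n s - 2 * 2^-1 ^+ n * W s.
(* The limit as a supremum of the lower ends of the nested intervals around the iterates. *)
pose gam s := sup [set a s n | n in setT].
have gamP n s : `|gam s - p n s| <= 2 * W s * 2^-1 ^+ n.
  have ub m k : a s m <= p k s + 2 * 2^-1 ^+ k * W s.
    by have := tail' k m s; rewrite ler_norml /a => /andP[_]; lra.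
  have h1 : a s n <= gam s.
    apply: ub_le_sup; last by exists n.
    by exists (p 0%N s + 2 * 2^-1 ^+ 0 * W s) => _ [m _ <-].
  have h2 : gam s <= p n s + 2 * 2^-1 ^+ n * W s.
    by apply: ge_sup; [exists (a s 0%N), 0%N|move=> _ [m _ <-]].
  by move: h1; rewrite /a ler_norml => h1; apply/andP; split; lra.
have gamL s t : `|gam s - gam t| <= L * `|s - t|.
  apply: (@le_of_geometric_error _ _ (2 * W s + 2 * W t)) => n.
  have -> : gam s - gam t = (gam s - p n s) + (p n s - p n t) + (p n t - gam t) by lra.
  have := gamP n s; have := gamP n t; have := pL n s t; rewrite (distrC (gam t)).
  move=> h1 h2 h3; apply: (le_trans (ler_normD _ _)).
  apply: (le_trans (lerD (ler_normD _ _) (lexx _))); lra.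
have cgam : continuous (fun s => b (gam s) s) by exact: (cb _ L).
have fix_gam s : gam s = T gam s.
  apply/eqP; rewrite -subr_eq0 -normr_le0.
  apply: (@le_of_geometric_error _ _ (2 * W s)) => n; rewrite add0r.
  have h1 := gamP n.+1 s.
  have h2 : `|T gam s - p n.+1 s| <= (2 * 2^-1 ^+ n) / 2 * W s.
    apply: (contract (fun s => T gam s - p n.+1 s) (fun s => b (gam s) s - b (p n s) s)).
    - by rewrite mulr_gt0// exprn_gt0// invr_gt0.
    - by rewrite p0 T0// subrr.
    - move=> z; have e1 := dT gam z cgam; have e2 := dT (p n) z (cp n).
      exact: is_deriveB.
    - move=> z; apply: (le_trans (bL _ _ _ _)); rewrite subrr normr0 addr0 ler_wpM2l//.
      by rewrite mulrAC; exact: gamP.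
  have -> : gam s - T gam s = (gam s - p n.+1 s) - (T gam s - p n.+1 s) by lra.
  apply: (le_trans (ler_normB _ _)); move: h1 h2; rewrite exprS; lra.
exists gam; split; first by rewrite fix_gam T0.
move=> s; have -> : gam = T gam by apply/funext.
by rewrite -[T gam s]fix_gam; exact: dT.
Qed.

End Characteristics.

(** * Covering rate of a Diophantine rotation *)

Section Diophantine.
Context {R : realType}.

(** The pigeonhole principle for the fractional parts of $0,\omega,\dots,T\omega$ in $T$ boxes. *)
Lemma dirichlet_approximation (w : R) (T : nat) : (0 < T)%N ->
  exists q p : int, [/\ 0 < q <= T%:Z & `|q%:~R * w - p%:~R| < T%:R^-1].
Proof.
move=> T0; have T0R : 0 < T%:R :> R by rewrite ltr0n.
pose fr (i : nat) : R := i%:R * w - (Num.floor (i%:R * w))%:~R.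
have fr01 i : 0 <= fr i < 1.
  by have /andP[a b] := floor_itv (i%:R * w); move: b; rewrite intrD /fr => b; apply/andP; split; lra.
have box i : (Num.truncn (T%:R * fr i) < T)%N.
  have /andP[f0 f1] := fr01 i; rewrite truncn_lt_nat; last by rewrite mulr_ge0// ltW.
  by rewrite gtr_pMr.
pose f (i : 'I_T.+1) : 'I_T := Ordinal (box i).
have : ~ injective f by move=> /leq_card; rewrite !card_ord ltnn.
move=> /existsNP[i /existsNP[j /not_implyP[fij /eqP ij]]].
wlog lij : i j fij ij / (i < j)%N.
  move=> wl; case: (ltngtP i j) => h; first exact: (wl i j).
    by apply: (wl j i) => //; rewrite eq_sym.
  by move/eqP: ij; case; apply: val_inj.
exists (j%:Z - i%:Z), (Num.floor (j%:R * w) - Num.floor (i%:R * w)); split.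
  by have := ltn_ord j; have := ltn_ord i; lia.
have close : `|T%:R * fr j - T%:R * fr i| < 1.
  have tij : Num.truncn (T%:R * fr i) = Num.truncn (T%:R * fr j) by have := congr1 val fij.
  have pos k : 0 <= T%:R * fr k by rewrite mulr_ge0 ?(ltW T0R)//; case/andP: (fr01 k).
  have /andP[a1 a2] := truncn_itv (pos i); have /andP[b1 b2] := truncn_itv (pos j).
  move: a1 a2 b1 b2; rewrite tij -natr1 ltr_norml => ? ? ? ?; apply/andP; split; lra.
rewrite -(ltr_pM2l T0R) divff ?gt_eqF//.
move: close; rewrite -mulrBr normrM (gtr0_norm T0R).
rewrite (_ : fr j - fr i = (j%:Z - i%:Z)%:~R * w - (Num.floor (j%:R * w) - Num.floor (i%:R * w))%:~R)//.
by rewrite /fr !intrB -!pmulrn; lra.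
Qed.

Lemma coprime_residue (q p a : int) : 0 < q -> coprimez q p ->
  exists2 j : int, 0 <= j < q & exists s : int, j * p = a + q * s.
Proof.
move=> q0 cop; have [u [v uv]] := Bezoutz q p.
rewrite (eqP cop) in uv.
exists ((a * v) %% q)%Z; first by rewrite modz_ge0 ?gt_eqF// ltz_pmod.
have := divz_eq (a * v) q => E.
exists (- (a * u) - (a * v %/ q)%Z * p).
have -> : (a * v %% q)%Z = a * v - (a * v %/ q)%Z * q by lia.
have : a * (u * q + v * p) = a by rewrite uv mulr1.
by nia.
Qed.

(** The sharp covering exponent comes from approximating $\omega_1$ by one reduced
    fraction $p/q$ with $Q\le q\lesssim Q^\tau$: Dirichlet gives
    $|q\omega_1-p|<1/T$ with $q\le T\sim Q^\tau$, and the Diophantine condition forces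
    $q\ge Q$.  The first $q$ multiples of $\omega_1$ then stay $1/q$-close to the
    full grid $\frac1q\mathbb Z$. *)
Lemma diophantine_orbit_dense (nu tau w : R) : diophantine nu tau (w, 1) ->
  exists2 C : R, 0 < C & forall Q y : R, 1 <= Q ->
  exists (j : nat) (s : int), j%:R <= C * Q `^ tau /\ `|w * j%:R - y - s%:~R| <= 2 / Q.
Proof.
move=> [nu0 tau0 dio].
pose B := 2 + `|w|; have B0 : 0 < B by rewrite ltr_wpDr.
exists (B `^ tau / nu + 1); first by rewrite ltr_wpDl// divr_ge0 ?powR_ge0// ltW.
move=> Q y Q1; have Q0 : 0 < Q := lt_le_trans ltr01 Q1.
(* Since |q| + |p| <= B q, the Diophantine condition with q < Q would give a gap of at
   least nu (B Q)^(-tau) > 1/T. *)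
pose T := (Num.truncn ((B * Q) `^ tau / nu)).+1.
have T0 : (0 < T)%N by [].
have T0R : 0 < T%:R :> R by rewrite ltr0n.
have TB : (B * Q) `^ tau / nu < T%:R by exact: truncnS_gt.
have [q1 [p1 [/andP[q10 q1T] qp1]]] := dirichlet_approximation w T0.
have g0 : 0 < gcdz q1 p1 by rewrite lt_neqAle eq_sym gcdz_eq0 negb_and gt_eqF.
pose g := gcdz q1 p1.
have /dvdzP[q qE] := dvdz_gcdl q1 p1; have /dvdzP[p pE] := dvdz_gcdr q1 p1.
rewrite -/g in g0 qE pE.
have q0 : 0 < q by rewrite qE pmulr_lgt0 in q10.
have cop : coprimez q p.
  rewrite /coprimez; have : gcdz q1 p1 = g by [].
  rewrite qE pE -mulz_gcdl (gtz0_abs g0) => h.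
  have gn0 : g != 0 by rewrite gt_eqF.
  by apply/eqP; apply: (mulIf gn0); rewrite mul1r.
have qq1 : q <= q1 by rewrite qE ler_peMr ?(ltW q0)// -gtz0_ge1.
have g1 : 1 <= g%:~R :> R by rewrite ler1z -gtz0_ge1.
have qR0 : 0 < q%:~R :> R by rewrite ltr0z.
have qp : `|q%:~R * w - p%:~R| < T%:R^-1.
  apply: le_lt_trans qp1.
  have -> : q1%:~R * w - p1%:~R = g%:~R * (q%:~R * w - p%:~R).
    by rewrite {1}qE {1}pE !intrM; lra.
  by rewrite normrM ger0_norm ?(le_trans ler01)// ler_peMl.
have qT : q%:~R <= T%:R :> R by rewrite (le_trans (y := q1%:~R))// ?ler_int// -[T%:R]/(T%:Z%:~R) ler_int.
have Ti : T%:R^-1 <= q%:~R^-1 :> R by rewrite lef_pV2.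
have i1 : q%:~R^-1 <= 1 :> R by rewrite invf_le1// ler1z -gtz0_ge1.
have sz : (`|q| + `|p|)%:~R <= q%:~R * B :> R.
  rewrite intrD !intr_norm (gtr0_norm qR0).
  have -> : p%:~R = q%:~R * w - (q%:~R * w - p%:~R) :> R by lra.
  have := ler_normB (q%:~R * w) (q%:~R * w - p%:~R); rewrite normrM (gtr0_norm qR0) /B.
  have : 1 <= q%:~R :> R by rewrite ler1z -gtz0_ge1.
  have := ltW (lt_le_trans qp (le_trans Ti i1)); lra.
have Qq : Q <= q%:~R.
  rewrite leNgt; apply/negP => qQ.
  have := dio q (- p); rewrite xpair_eqE negb_and gt_eqF// => /(_ isT) /=.
  rewrite mul1r intrN (normrN p) (mulrC w) => h.
  have n0 : 0 < (`|q| + `|p|)%:~R :> R by rewrite ltr0z ltr_wpDr// normr_gt0 gt_eqF.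
  have h1 : nu * (B * Q) `^ (- tau) <= nu * ((`|q| + `|p|)%:~R `^ (- tau)).
    rewrite ler_wpM2l ?(ltW nu0)// !powRN lef_pV2 ?posrE ?powR_gt0 ?mulr_gt0//.
    apply: ge0_ler_powR; rewrite ?nnegrE ?ltW ?mulr_gt0//.
    apply: (le_lt_trans sz); rewrite mulrC ltr_pM2l//.
  have P0 : 0 < (B * Q) `^ tau by rewrite powR_gt0 ?mulr_gt0.
  have h2 : nu * (B * Q) `^ (- tau) < T%:R^-1 := le_lt_trans (le_trans h1 h) qp.
  rewrite powRN -[nu]invrK -invfM ltf_pV2 ?posrE ?mulr_gt0 ?invr_gt0// in h2.
  by have := lt_trans TB h2; rewrite mulrC ltxx.
have [j /andP[j0 jq] [s js]] := coprime_residue (Num.floor (q%:~R * y)) q0 cop.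
exists `|j|%N, s; rewrite natr_absz (ger0_norm j0); split.
  apply: (@le_trans _ _ T%:R).
    by apply: le_trans qT; rewrite ler_int ltW.
  have -> : T%:R = (Num.truncn ((B * Q) `^ tau / nu))%:R + 1 :> R by rewrite -natr1.
  have : (Num.truncn ((B * Q) `^ tau / nu))%:R <= (B * Q) `^ tau / nu.
    by rewrite truncn_le divr_ge0 ?powR_ge0// ltW.
  set X := (Num.truncn _)%:R; rewrite powRM ?(ltW B0) ?(ltW Q0)// => hX.
  have : 1 <= Q `^ tau by rewrite -(powRr0 Q) ler_powR// ltW.
  by move: hX; clear; lra.
have jR : 0 <= j%:~R :> R by rewrite ler0z.
have jqR : j%:~R <= q%:~R :> R by rewrite ler_int ltW.
have /andP[f1 f2] := floor_itv (q%:~R * y); rewrite intrD in f2.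
have E : j%:~R * p%:~R = (Num.floor (q%:~R * y))%:~R + q%:~R * s%:~R :> R by rewrite -!intrM js intrD intrM.
apply: (@le_trans _ _ (2 / q%:~R)); last by rewrite ler_pM2l// lef_pV2.
rewrite -(ler_pM2l qR0) mulrCA divff ?gt_eqF// mulr1.
rewrite -{1}(gtr0_norm qR0) -normrM.
have -> : q%:~R * (w * j%:~R - y - s%:~R) = j%:~R * (q%:~R * w - p%:~R) + ((Num.floor (q%:~R * y))%:~R - q%:~R * y) :> R.
  by rewrite (mulrBr j%:~R) E; lra.
apply: (le_trans (ler_normD _ _)).
have h1 : `|j%:~R * (q%:~R * w - p%:~R)| <= 1 :> R.
  rewrite normrM (ger0_norm jR); apply: (le_trans (ler_pM _ _ jqR (ltW (lt_le_trans qp Ti)))) => //.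
  by rewrite divff// gt_eqF.
have h2 : `|(Num.floor (q%:~R * y))%:~R - q%:~R * y| <= 1 by move: f1 f2; rewrite ler_norml; clear => f1 f2; apply/andP; split; lra.
move: h1 h2; clear; lra.
Qed.

End Diophantine.

(** * Covering rate of the characteristics on a KAM torus *)

Section KamOrbits.
Context {R : realType}.

Lemma torus_eq_trans (a b d : R * R) : torus_eq a b -> torus_eq b d -> torus_eq a d.
Proof.
move=> [h1 h2] [h3 h4]; split.
  by have := rpredD h1 h3; rewrite addrA subrK.
by have := rpredD h2 h4; rewrite addrA subrK.
Qed.

Lemma torus_eq_shift (a1 a2 b1 b2 : R) (z1 z2 : int) :
  a1 = b1 + z1%:~R -> a2 = b2 + z2%:~R -> torus_eq (a1, a2) (b1, b2).
Proof. by move=> -> ->; split; rewrite /= addrAC subrr add0r intr_int. Qed.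

Lemma torus_eqP (a b : R * R) : torus_eq a b ->
  exists z1 z2 : int, a.1 = b.1 + z1%:~R /\ a.2 = b.2 + z2%:~R.
Proof.
move=> [/intrP[z1 h1] /intrP[z2 h2]]; exists z1, z2.
by rewrite -h1 -h2 !(addrC _ (_ - _)) !subrK.
Qed.

(** The linear flow meets every cross-section of the torus in an orbit of the rotation
    by $\omega_1$; the conjugacy, being Lipschitz, carries the covering rate of that
    rotation over to the characteristic observed at integer times. *)
Lemma kam_orbit_dense (H : R -> R -> R -> R) (c nu tau L : R) (ubar : R -> R -> R) :
    KAM_torus H c nu tau ubar -> 0 <= L ->
  exists2 C : R, 0 < C & forall (gam : R -> R) (Q x1 : R), characteristic H c ubar gam ->
    (forall s t, `|gam s - gam t| <= L * `|s - t|) -> 1 <= Q ->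
  exists (n : nat) (z : int), n%:R <= C * Q `^ tau /\ `|gam n%:R - x1 - z%:~R| <= C / Q.
Proof.
move=> [_ _ [F [w [[[Fper F1 F2] [G [_ _ FG]]] w2 dio Fgam]]]] L0.
case: w w2 dio Fgam => w1 w2 /= -> dio Fgam.
have t0 : 0 < tau by case: dio.
have [C0 C00 dense] := diophantine_orbit_dense dio.
have le23 : - 2 <= 3 :> R by lra.
have [A A0 hA] := C1_2_locally_lipschitz le23 F1.
have [B B0 hB] := C1_2_locally_lipschitz le23 F2.
pose D := 2 * (A + B); have D0 : 0 <= D by rewrite mulr_ge0// addr_ge0.
exists (C0 + 2 + D + L * D); first by rewrite -!addrA ltr_wpDr// !addr_ge0// mulr_ge0.
move=> gam Q x1 chg gamL Q1; have Q0 : 0 < Q := lt_le_trans ltr01 Q1.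
have [[th1 th2] /= gE] := Fgam gam chg.
(* Normalizing the preimage of (x1, 0) to the unit square keeps all points at which F is
   evaluated in the fixed box [-2, 3]^2, where F is Lipschitz. *)
pose a1 := (G (x1, 0)).1 - (Num.floor (G (x1, 0)).1)%:~R.
pose a2 := (G (x1, 0)).2 - (Num.floor (G (x1, 0)).2)%:~R.
have a101 : 0 <= a1 <= 1 by have /andP[? h] := floor_itv (G (x1, 0)).1; move: h; rewrite intrD /a1 => h; apply/andP; split; lra.
have a201 : 0 <= a2 <= 1 by have /andP[? h] := floor_itv (G (x1, 0)).2; move: h; rewrite intrD /a2 => h; apply/andP; split; lra.
have Fa : torus_eq (F (a1, a2)) (x1, 0).
  apply: torus_eq_trans (FG _); apply: Fper; rewrite [G _ in X in torus_eq _ X]surjective_pairing.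
  by apply: (@torus_eq_shift _ _ _ _ (- Num.floor (G (x1, 0)).1) (- Num.floor (G (x1, 0)).2)); rewrite intrN.
pose i0 : int := Num.floor (a2 - th2).
pose s0 := a2 - th2 - i0%:~R + 1.
have /andP[s01 s02] : 1 <= s0 <= 2.
  by have /andP[? h] := floor_itv (a2 - th2); move: h; rewrite intrD /s0 /i0 => h; apply/andP; split; lra.
have [j [z [jC hj]]] := dense Q (a1 - w1 * s0 - th1) Q1.
pose s := s0 + j%:R.
pose del := w1 * j%:R - (a1 - w1 * s0 - th1) - z%:~R.
have dl2 : `|del| <= 2 by apply: (le_trans hj); rewrite ler_pdivrMr// ler_peMr.
have Fs : torus_eq (gam s, s) (F (a1 + del, a2)).
  apply: torus_eq_trans (gE s) _; apply: Fper.
  apply: (@torus_eq_shift _ _ _ _ z (j%:Z + 1 - i0)); rewrite /del /s ?mul1r; first by lra.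
  by rewrite intrB intrD /s0 -pmulrn; lra.
have a1i : - 2 <= a1 <= 3 by move: a101; clear => /andP[? ?]; apply/andP; split; lra.
have a2i : - 2 <= a2 <= 3 by move: a201; clear => /andP[? ?]; apply/andP; split; lra.
have adi : - 2 <= a1 + del <= 3.
  by move: dl2 a101; rewrite ler_norml; clear => /andP[? ?] /andP[? ?]; apply/andP; split; lra.
have hdel (E : R) : 0 <= E -> E <= A + B -> E * (`|a1 + del - a1| + `|a2 - a2|) <= D / Q.
  move=> E0 EAB; rewrite subrr normr0 addr0 (addrC a1) addrK.
  apply: (le_trans (ler_pM E0 (normr_ge0 _) EAB hj)).
  by rewrite /D; clear; lra.
have e1 : `|(F (a1 + del, a2)).1 - (F (a1, a2)).1| <= D / Q.
  by apply: (le_trans (hA _ _ _ _ adi a2i a1i a2i)); apply: hdel => //; rewrite lerDl.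
have e2 : `|(F (a1 + del, a2)).2 - (F (a1, a2)).2| <= D / Q.
  by apply: (le_trans (hB _ _ _ _ adi a2i a1i a2i)); apply: hdel => //; rewrite lerDr.
have [z1 [z2 /= [g1 g2]]] := torus_eqP Fs.
have [z3 [z4 /= [g3 g4]]] := torus_eqP Fa.
have h1 : `|gam s - x1 - (z1 + z3)%:~R| <= D / Q.
  by apply: le_trans e1; rewrite g3 intrD le_eqVlt; apply/orP; left; apply/eqP; congr `|_|; move: g1; clear; lra.
have h2 : `|s - (z2 + z4)%:~R| <= D / Q.
  by apply: le_trans e2; rewrite g4 intrD le_eqVlt; apply/orP; left; apply/eqP; congr `|_|; move: g2; clear; lra.
have DQ : D / Q <= D by rewrite ler_pdivrMr// ler_peMr.
have Qt : 1 <= Q `^ tau by rewrite -(powRr0 Q) ler_powR// ltW.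
have LD0 : 0 <= L * D by rewrite mulr_ge0.
(* The point of the orbit is reached at a time D/Q-close to the integer z2 + z4, up to
   which gam moves by at most L D / Q.  A negative integer forces D/Q >= 1, and then any
   time will do. *)
have [i0'|ineg] := leP 0 (z2 + z4).
  exists (absz (z2 + z4)%R), (z1 + z3); rewrite natr_absz (ger0_norm i0'); split.
    move: h2; rewrite ler_norml => /andP[h2 _].
    have : (z2 + z4)%:~R <= s + D by move: h2 DQ; clear; lra.
    rewrite /s.
    have p0 : 0 <= 2 + D + L * D by rewrite !addr_ge0.
    have := ler_wpM2l p0 Qt; rewrite mulr1; move: jC s02 LD0; clear; lra.
  have h3 := gamL (z2 + z4)%:~R s; rewrite distrC in h2.
  have h4 := le_trans h3 (ler_wpM2l L0 h2).
  rewrite -[_ - x1](subrKA (gam s)) -addrA.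
  apply: (le_trans (ler_normD _ _)); apply: (le_trans (lerD h4 h1)).
  rewrite mulrA -mulrDl ler_pM2r ?invr_gt0//; move: C00; clear; lra.
have zm1 : (z2 + z4)%:~R <= 0 :> R by rewrite lerz0 ltW.
have D1 : 1 <= D / Q.
  move: h2; rewrite ler_norml => /andP[_ h2]; apply: le_trans h2.
  by rewrite /s; have := ler0n R j; move: s01 zm1; clear; lra.
exists 0%N, (Num.floor (gam 0 - x1)); split.
  by rewrite mulr_ge0 ?powR_ge0// !addr_ge0// ltW.
have /andP[f1 f2] := floor_itv (gam 0 - x1); rewrite intrD in f2.
apply: (@le_trans _ _ (D / Q)).
  by apply: le_trans D1; rewrite ler_norml; move: f1 f2; clear => f1 f2; apply/andP; split; lra.
rewrite ler_pM2r ?invr_gt0//; move: C00 LD0; clear; lra.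
Qed.

End KamOrbits.

(** * Essential bounds, step functions and cell averages *)

Section EssentialBounds.
Context {R : realType}.
Local Notation mu := (@lebesgue_measure R).

Lemma Linf_normP (f : R -> R) (M : R) :
  (Linf_norm f <= M%:E)%E <-> {ae mu, forall x, `|f x| <= M}.
Proof.
have mT : (0 < mu [set: R])%E.
  have m01 : mu `[0, 1]%classic = 1%E by rewrite lebesgue_measure_itv /= lte_fin ltr01 -EFinD subr0.
  apply: (@lt_le_trans _ _ (mu `[0, 1]%classic)); first by rewrite m01.
  by apply: le_measure; rewrite ?inE.
rewrite /Linf_norm unlock mT; split => [/ess_supP h|h].
  by apply: filterS h => x /=; rewrite lee_fin.
apply/ess_supP; apply: (@filterS _ _ (ae_filter_ringOfSetsType mu) _ _ _ h) => x /=.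
by rewrite lee_fin.
Qed.

(** By continuity a violation at one point spreads to a ball, which is not a null set. *)
Lemma continuous_Linf_bound (f : R -> R) (M : R) : continuous f ->
  (Linf_norm f <= M%:E)%E -> forall x, `|f x| <= M.
Proof.
move=> cf /Linf_normP [A [mA A0 sub]] x; rewrite leNgt; apply/negP => Mx.
have cN : continuous (fun z => `|f z|) by exact: continuous_normr.
have : \forall z \near x, M < `|f z| by exact: (cvgr_gt _ (cN x)).
move=> [e /= e0 he].
have bA : ball x e `<=` A.
  by move=> z /he /= zM; apply: sub => /= zM'; move: zM; rewrite ltNge zM'.
have : (mu (ball x e) <= mu A)%E.
  by apply: le_measure; rewrite ?inE //; rewrite ball_itv; exact: measurable_itv.
rewrite A0 (lebesgue_measure_ball _ (ltW e0)).
by rewrite lee_fin leNgt mulrn_wgt0.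
Qed.

End EssentialBounds.

Section CellAverages.
Context {R : realType}.
Local Notation mu := (@lebesgue_measure R).
Variable N : nat.
Hypothesis N0 : (0 < N)%N.
Local Notation dx := (dx N : R).
Local Notation x_ m := (xm N m : R).

Let dx0 : 0 < dx. Proof. by rewrite invr_gt0 mulr_gt0// ltr0n. Qed.

(** The floor picks the even node whose cell, half-open to the right, contains $x$. *)
Definition step_function (s : int -> R) (x : R) : R :=
  s (2 * Num.floor ((x + dx) / (2 * dx))).

Lemma step_functionE s (i : int) x : x_ (2 * i) - dx <= x < x_ (2 * i) + dx ->
  step_function s x = s (2 * i).
Proof.
move=> /andP[h1 h2]; rewrite /step_function; congr (s (2 * _)); apply: floor_def.
have p : 0 < 2 * dx by rewrite mulr_gt0.
rewrite intrD ler_pdivlMr// ltr_pdivrMr//.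
move: h1 h2; rewrite /xm intrM => h1 h2; apply/andP; split; lra.
Qed.

Lemma step_function_cell (x : R) : exists i : int, x_ (2 * i) - dx <= x < x_ (2 * i) + dx.
Proof.
have p : 0 < 2 * dx by rewrite mulr_gt0.
exists (Num.floor ((x + dx) / (2 * dx))).
have := floor_itv ((x + dx) / (2 * dx)).
rewrite intrD ler_pdivlMr// ltr_pdivrMr// /xm intrM => /andP[h1 h2].
by apply/andP; split; lra.
Qed.

Lemma measurable_step_function s : measurable_fun [set: R] (step_function s).
Proof.
move=> _ Y _; rewrite setTI.
have -> : step_function s @^-1` Y = \bigcup_(i : int) (if `[< Y (s (2 * i)) >] then `[x_ (2 * i) - dx, x_ (2 * i) + dx[%classic else set0).
  apply/seteqP; split => x /=.
    move=> hx; have [i ci] := step_function_cell x; exists i => //.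
    by rewrite -(step_functionE s ci); case: asboolP => // _; rewrite /= in_itv.
  move=> [i _]; case: asboolP => //= hi; rewrite in_itv /= => ci.
  by rewrite (step_functionE s ci).
apply: countable_bigcupT_measurable; first exact: countableP.
by move=> i; case: ifP => _; [exact: measurable_itv|exact: measurable0].
Qed.

Section Bounded.
Variables (s : int -> R) (M : R).
Hypotheses (sM : forall i, `|s (2 * i)| <= M).

Lemma step_function_bound x : `|step_function s x| <= M. Proof. exact: sM. Qed.

Lemma step_function_integrable a b : mu.-integrable `[a, b] (EFin \o step_function s).
Proof.
apply: measurable_bounded_integrable.
- exact: measurable_itv.
- by apply: compact_finite_measure; exact: segment_compact.
- by apply: measurable_funS (measurable_step_function s).
- exists M; split; first exact: num_real.
  by move=> y My x _ /=; apply: le_trans (ltW My); exact: step_function_bound.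
Qed.

Lemma step_integral_split a b d : a <= b -> b <= d ->
  \int[mu]_(x in `[a, d]) step_function s x =
  \int[mu]_(x in `[a, b]) step_function s x + \int[mu]_(x in `[b, d]) step_function s x.
Proof.
move=> ab bd; have := @Rintegral_itvB R (step_function s) (BLeft a) (BRight d) b (step_function_integrable a d).
rewrite !bnd_simp => /(_ ab bd) E.
rewrite Rintegral_itv_obnd_cbnd in E.
  by rewrite -E addrC subrK.
by apply: integrableS (step_function_integrable a d) => //; apply: subset_itvr; rewrite bnd_simp.
Qed.

Lemma step_integral_cst a b v : a <= b -> (forall x, a <= x < b -> step_function s x = v) ->
  \int[mu]_(x in `[a, b]) step_function s x = v * (b - a).
Proof.
move=> ab h.
rewrite -Rintegral_itv_bndo_bndc; last first.
  by apply: integrableS (step_function_integrable a b) => //; apply: subset_itvl; rewrite bnd_simp.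
rewrite (@eq_Rintegral _ _ _ mu _ (fun=> v)); last first.
  by move=> x; rewrite inE /= in_itv /= => /h.
rewrite Rintegral_cst//; congr (_ * _).
have E : mu `[a, b[%classic = (b - a)%:E.
  rewrite lebesgue_measure_itv /= lte_fin; case: ltP => // ba.
  by rewrite (le_anti (_ : a <= b <= a)) ?subrr// ab.
exact: (congr1 fine E).
Qed.

Lemma step_cell_integral i :
  \int[mu]_(x in `[x_ (2 * i) - dx, x_ (2 * i) + dx]) step_function s x = s (2 * i) * (2 * dx).
Proof.
rewrite (@step_integral_cst _ _ (s (2 * i))).
- by congr (_ * _); lra.
- by have := dx0; lra.
- by move=> x; exact: step_functionE.
Qed.

Lemma step_cells_integral n :
  \int[mu]_(x in `[- dx, x_ (2 * n%:Z) - dx]) step_function s x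
  = 2 * dx * \sum_(i < n) s (2 * i%:Z).
Proof.
elim: n => [|n IH].
  have x0 : x_ (2 * 0%:Z) = 0 by rewrite /xm mulr0 mul0r.
  rewrite big_ord0 x0 sub0r (@step_integral_cst _ _ 0).
  - by rewrite mul0r mulr0.
  - exact: lexx.
  - by move=> x /andP[h1 h2]; have := le_lt_trans h1 h2; rewrite ltxx.
have E : x_ (2 * n.+1%:Z) - dx = x_ (2 * n%:Z) + dx.
  by rewrite intS mulrDr mulr1 /xm intrD mulrDl; lra.
rewrite E (@step_integral_split _ (x_ (2 * n%:Z) - dx)).
- by rewrite IH step_cell_integral big_ord_recr /=; lra.
- by rewrite lerBDr addNr /xm; apply: mulr_ge0; [rewrite ler0z; lia|exact: ltW].
- by have := dx0; lra.
Qed.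

(** The unit interval cuts the cell of the node $0 \equiv 2N$ in two halves. *)
Lemma step_period_integral : (forall i, s (2 * i + (2 * N)%:Z) = s (2 * i)) ->
  \int[mu]_(x in `[0, 1]) step_function s x = 2 * dx * \sum_(i < N) s (2 * i%:Z).
Proof.
move=> sper.
have dxN : 2 * N%:R * dx = 1 by rewrite /Defs.dx divff// gt_eqF// mulr_gt0// ltr0n.
have x2N : x_ (2 * N%:Z) = 1 by rewrite /xm intrM -pmulrn.
have N1 : 1 <= N%:R :> R by rewrite ler1n.
have h1 := dx0.
have dx1 : dx <= 1 - dx.
  have := ler_wpM2r (ltW h1) N1.
  lra.
have I1 : \int[mu]_(x in `[- dx, 0]) step_function s x = s (2 * 0) * (0 - (- dx)).
  apply: step_integral_cst; first lra.
  by move=> x /andP[? ?]; apply: step_functionE; rewrite /xm mulr0 mul0r; apply/andP; split; lra.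
have I2 : \int[mu]_(x in `[1 - dx, 1]) step_function s x = s (2 * N%:Z) * (1 - (1 - dx)).
  apply: step_integral_cst; first lra.
  by move=> x /andP[? ?]; apply: step_functionE; rewrite x2N; apply/andP; split; lra.
have A := step_cells_integral N; rewrite x2N in A.
have B : \int[mu]_(x in `[- dx, 1 - dx]) step_function s x =
   \int[mu]_(x in `[- dx, 0]) step_function s x + \int[mu]_(x in `[0, 1 - dx]) step_function s x.
  by apply: step_integral_split; lra.
have D : \int[mu]_(x in `[0, 1]) step_function s x =
   \int[mu]_(x in `[0, 1 - dx]) step_function s x + \int[mu]_(x in `[1 - dx, 1]) step_function s x.
  by apply: step_integral_split; lra.
have E : s (2 * N%:Z) = s (2 * 0) by rewrite -[LHS]/(s (2 * N)%:Z) -(sper 0) mulr0 add0r.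
rewrite -A B D I1 I2 E {A B D I1 I2}; lra.
Qed.

Lemma step_function_periodic : (forall i, s (2 * i + (2 * N)%:Z) = s (2 * i)) ->
  periodic (step_function s) 1.
Proof.
move=> sper x; have [i ci] := step_function_cell x.
have x2N : x_ (2 * (i + N%:Z)) = x_ (2 * i) + 1.
  rewrite mulrDr /xm intrD mulrDl; congr (_ + _).
  by rewrite intrM -pmulrn /Defs.dx divff// gt_eqF// mulr_gt0// ltr0n.
rewrite (step_functionE s ci) (@step_functionE s (i + N%:Z)).
  by rewrite mulrDr -[2 * N%:Z]/((2 * N)%:Z) sper.
by case/andP: ci => ? ?; rewrite x2N; apply/andP; split; lra.
Qed.

End Bounded.

Lemma step_function_Linf_r0 (s : int -> R) (M : R) : (forall i, `|s (2 * i)| <= M) ->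
  (forall i, s (2 * i + (2 * N)%:Z) = s (2 * i)) -> \sum_(i < N) s (2 * i%:Z) = 0 ->
  Linf_r0 M (step_function s).
Proof.
move=> sM sper s0.
have L : (Linf_norm (step_function s) <= M%:E)%E.
  by apply/Linf_normP; apply: aeW => x; exact: step_function_bound.
split => //; split.
- exact: measurable_step_function.
- exact: step_function_periodic.
- by apply: le_lt_trans L _; exact: ltry.
- by rewrite (step_period_integral sM sper) s0 mulr0.
Qed.

Lemma ae_eq_Rintegral (f g : R -> R) a b : measurable_fun [set: R] f ->
  measurable_fun [set: R] g -> {ae mu, forall x, f x = g x} ->
  \int[mu]_(x in `[a, b]) f x = \int[mu]_(x in `[a, b]) g x.
Proof.
move=> mf mg fg; rewrite /Rintegral; congr fine; apply: ae_eq_integral.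
- exact: measurable_itv.
- by apply/measurable_EFinP; exact: measurable_funS mf.
- by apply/measurable_EFinP; exact: measurable_funS mg.
- by apply: (@filterS _ _ (ae_filter_ringOfSetsType mu) _ _ _ fg) => x /= -> _.
Qed.

End CellAverages.

(** * One-sided Lipschitz bound on the discrete slopes *)

Section NodeShift.
Context {R : realType}.

Lemma even_nodeD2 k m : even_node k (m + 2) = even_node k m.
Proof. by rewrite -[2]mulr1 even_nodeDn. Qed.

Lemma even_nodeB2 k m : even_node k (m - 2) = even_node k m.
Proof. by rewrite -(even_nodeD2 k (m - 2)) subrK. Qed.

Lemma xmD2 N m : xm N (m + 2) = xm N m + 2 * dx N :> R.
Proof. by rewrite xmD. Qed.

Lemma xmB2 N m : xm N (m - 2) = xm N m - 2 * dx N :> R.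
Proof. by rewrite -[in RHS](subrK 2 m) xmD2 addrK. Qed.

Lemma subB2D1 (m : int) : m - 2 + 1 = m - 1.
Proof. by lia. Qed.

End NodeShift.

Section JumpBound.
Context {R : realType}.

(** The quadratic gain dominates the linear loss by Young's inequality up to the constant
    $Z$.  The larger of the two weights, at least $1/2$, forces the corresponding jump to
    be close to $M$, and the quadratic term forces the same jump to be small. *)
Lemma jump_algebra (A B a a' M la h D E : R) :
    0 <= A -> 0 <= B -> A + B = 1 -> 0 <= la <= 1 -> 0 < h -> a <= M -> a' <= M -> 0 <= E ->
    0 < la ->
    M <= A * a + B * a' - la / 2 * (h / 2 * (a ^+ 2 + a' ^+ 2) - D * (`|a| + `|a'|) - E) ->
  let Z := 3 / 2 * D ^+ 2 / h + E in
  exists q d, [/\ M = q + d, q ^+ 2 <= 4 * Z / h & d <= Z].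
Proof.
wlog BA : A B a a' / A <= B.
  move=> wl A0 B0 AB la01 h0 aM a'M E0 la0 hM Z; have [AleB|/ltW BleA] := leP A B.
    exact: (wl A B a a').
  apply: (wl B A a' a) => //; first by rewrite addrC.
  by move: hM; rewrite (addrC (a ^+ 2)) (addrC `|a|) (addrC (A * a)).
move=> A0 B0 AB /andP[_ la1] h0 aM a'M E0 la0 hM Z.
have young (y w : R) : 0 < w -> D * `|y| <= w * y ^+ 2 + D ^+ 2 / (4 * w).
  move=> w0; rewrite -(real_normK (num_real y)) -subr_ge0.
  rewrite (_ : _ - _ = w * (`|y| - D / (2 * w)) ^+ 2); last by field; rewrite gt_eqF.
  by rewrite mulr_ge0 ?sqr_ge0 ?ltW.
have h2 : 0 < h / 2 by rewrite divr_gt0.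
have h4 : 0 < h / 4 by rewrite divr_gt0.
have y1 := young a _ h2; have y2 := young a' _ h4.
pose d := M - a'; have d0 : 0 <= d by rewrite subr_ge0.
have Bh : 2^-1 <= B by lra.
have Bd : 2^-1 * d <= B * d by rewrite ler_wpM2r.
have AM : A * a <= A * M by rewrite ler_wpM2l.
have yy : h / 2 * (a ^+ 2 + a' ^+ 2) - D * (`|a| + `|a'|) - E >= h / 4 * a' ^+ 2 - Z.
  have -> : Z = D ^+ 2 / (4 * (h / 2)) + D ^+ 2 / (4 * (h / 4)) + E by rewrite /Z; field; rewrite gt_eqF.
  lra.
have lz := ler_wpM2l (ltW (divr_gt0 la0 (ltr0n R 2 : 0 < 2))) yy.
have main : 2^-1 * d + la / 2 * (h / 4 * a' ^+ 2) <= la / 2 * Z.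
  have : M = A * M + B * M by rewrite -mulrDl AB mul1r.
  by move: hM lz AM Bd; rewrite /d; lra.
have Z0 : 0 <= Z.
  by apply: addr_ge0 => //; apply: divr_ge0; [apply: mulr_ge0 => //; exact: sqr_ge0|exact: ltW].
have a20 : 0 <= h / 4 * a' ^+ 2 by apply: mulr_ge0; [exact: ltW|exact: sqr_ge0].
exists a', d; split; first by rewrite /d; lra.
- rewrite ler_pdivlMr// -(ler_pM2l (_ : 0 < la / 2 / 4)) ?divr_gt0//.
  by move: main; lra.
- have : la / 2 * Z <= 2^-1 * Z by rewrite ler_wpM2r// ; lra.
  have : 0 <= la / 2 * (h / 4 * a' ^+ 2) by rewrite mulr_ge0// divr_ge0// ltW.
  lra.
Qed.

Section Oleinik.
Variables (H : R -> R -> R -> R) (c P h C1 C2 : R).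
Hypotheses (h0 : 0 < h) (C10 : 0 <= C1) (C20 : 0 <= C2).
Hypothesis Hh : forall x t p q, `|p| <= P -> `|q| <= P ->
  H x t p + Dp H x t p * (q - p) + h / 2 * (q - p) ^+ 2 <= H x t q.
Hypothesis HC1 : forall x t p d, `|p| <= P -> 0 <= d ->
  - C1 * d ^+ 2 <= H (x + d) t p + H (x - d) t p - 2 * H x t p.
Hypothesis HC2 : forall x y t p, `|p| <= P -> `|Dp H x t p - Dp H y t p| <= C2 * `|x - y|.

Let Z0 := 6 * C2 ^+ 2 / h + 4 * C1.
Definition jump_const := 1 + 4 * Z0 / h + Z0.

Variables (N K : nat).
Hypothesis NK : (0 < N <= K)%N.
Local Notation dx := (dx N : R).
Local Notation dt := (dt K : R).
Local Notation x_ m := (xm N m : R).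
Local Notation t_ k := (tk K k : R).

Variable u : nat -> int -> R.
Hypothesis urec : forall k m, even_node k m ->
  u k.+1 (m + 1) = (u k m + u k (m + 2)) / 2
    - lam N K / 2 * (H (x_ (m + 2)) (t_ k) (c + u k (m + 2)) - H (x_ m) (t_ k) (c + u k m)).
Hypothesis uP : forall k m, even_node k m -> `|c + u k m| <= P.
Hypothesis ub : forall k m, even_node k m -> `|lam N K * Dp H (x_ m) (t_ k) (c + u k m)| <= 1.

(** Discrete one-sided Lipschitz estimate: at a node where the upward jump is maximal
    in space and in time the quadratic gain from uniform convexity must be paid for by
    the $O(\Delta x^2)$ inhomogeneity of $H$ in $x$. *)
Lemma jump_step k m (M : R) : even_node k m ->
    (forall m, even_node k m -> u k (m + 2) - u k m <= M) ->
    M <= u k.+1 (m + 1) - u k.+1 (m - 1) ->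
  M <= jump_const * dx.
Proof.
move=> em hM hw; have x0 : 0 < dx by exact: (dx_gt0 NK).
have l0 : 0 < lam N K :> R by exact: (lam_gt0 NK).
have em2 : even_node k (m - 2) by rewrite even_nodeB2.
have ep2 : even_node k (m + 2) by rewrite even_nodeD2.
have u1 := urec em; have u2 := urec em2.
have E2 : m - 2 + 2 = m by rewrite subrK.
have E1 := subB2D1 m.
rewrite E1 E2 in u2.
pose a := u k (m + 2) - u k m; pose a' := u k m - u k (m - 2).
have aM : a <= M by exact: hM.
have a'M : a' <= M by have := hM _ em2; rewrite E2.
set p := c + u k m in u1 u2.
pose b := Dp H (x_ m) (t_ k) p.
have pp := uP em; have ppp := uP ep2; have ppm := uP em2.
have xp : x_ (m + 2) = x_ m + 2 * dx by exact: xmD2.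
have xq : x_ (m - 2) = x_ m - 2 * dx by exact: xmB2.
have hp := Hh (x_ (m + 2)) (t_ k) pp ppp; have hq := Hh (x_ (m - 2)) (t_ k) pp ppm.
rewrite -/p (_ : c + u k (m + 2) - p = a) in hp; last by rewrite /p /a; lra.
rewrite -/p (_ : c + u k (m - 2) - p = - a') in hq; last by rewrite /p /a'; lra.
have dp : `|Dp H (x_ (m + 2)) (t_ k) p - b| <= C2 * (2 * dx).
  by have := HC2 (x_ (m + 2)) (x_ m) (t_ k) pp; rewrite xp addrAC subrr add0r (gtr0_norm (_ : 0 < 2 * dx)) ?mulr_gt0.
have dq : `|Dp H (x_ (m - 2)) (t_ k) p - b| <= C2 * (2 * dx).
  by have := HC2 (x_ (m - 2)) (x_ m) (t_ k) pp; rewrite xq addrAC subrr add0r normrN (gtr0_norm (_ : 0 < 2 * dx)) ?mulr_gt0.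
have s2 := HC1 (x_ m) (t_ k) pp (_ : 0 <= 2 * dx).
have {}s2 := s2 (ltW (mulr_gt0 (ltr0n R 2) x0)).
rewrite -xp -xq -/p in s2.
pose D := 2 * dx * C2; pose E := 4 * C1 * dx ^+ 2.
have fp : - (D * `|a|) <= (Dp H (x_ (m + 2)) (t_ k) p - b) * a.
  rewrite lerNl -mulNr; apply: (le_trans (ler_norm _)); rewrite normrM normrN ler_wpM2r//.
  by rewrite /D; apply: (le_trans dp); lra.
have fq : - (D * `|a'|) <= (Dp H (x_ (m - 2)) (t_ k) p - b) * - a'.
  rewrite lerNl -mulNr; apply: (le_trans (ler_norm _)); rewrite normrM !normrN ler_wpM2r//.
  by rewrite /D; apply: (le_trans dq); lra.
pose lb := lam N K * b.
have lb1 : `|lb| <= 1 by exact: ub em.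
have [A0 B0] : 0 <= (1 - lb) / 2 /\ 0 <= (1 + lb) / 2.
  by move: lb1; rewrite ler_norml => /andP[? ?]; split; lra.
have AB : (1 - lb) / 2 + (1 + lb) / 2 = 1 by lra.
have l1 : lam N K <= 1 :> R by rewrite ler_pdivrMr// mul1r; exact: (dt_le_dx NK).
have E0 : 0 <= E by apply: mulr_ge0; [exact: mulr_ge0|exact: sqr_ge0].
have key : M <= (1 - lb) / 2 * a + (1 + lb) / 2 * a'
     - lam N K / 2 * (h / 2 * (a ^+ 2 + a' ^+ 2) - D * (`|a| + `|a'|) - E).
  apply: (le_trans hw); rewrite u1 u2.
  have : h / 2 * (a ^+ 2 + a' ^+ 2) - D * (`|a| + `|a'|) - E + b * (a - a') <=
     H (x_ (m + 2)) (t_ k) (c + u k (m + 2)) + H (x_ (m - 2)) (t_ k) (c + u k (m - 2)) - 2 * H (x_ m) (t_ k) p.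
    by move: hp hq fp fq s2; rewrite sqrrN /E; lra.
  move=> /(ler_wpM2l (ltW (divr_gt0 l0 (ltr0n R 2 : 0 < 2)))).
  by rewrite /lb /a /a'; lra.
have l01 : 0 <= (lam N K : R) <= 1 by rewrite (ltW l0).
have [q [d [-> q2 dZ]]] := @jump_algebra _ _ a a' M (lam N K) h D E A0 B0 AB l01 h0 aM a'M E0 l0 key.
have ZE : 3 / 2 * D ^+ 2 / h + E = Z0 * dx ^+ 2 by rewrite /D /E /Z0; field; rewrite gt_eqF.
rewrite ZE in q2 dZ.
have Z00 : 0 <= Z0.
  apply: addr_ge0; last exact: mulr_ge0.
  by apply: divr_ge0; [apply: mulr_ge0 => //; exact: sqr_ge0|exact: ltW].
have dx1 : dx <= 1 by have := dx_le NK (R := R); lra.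
have dle : d <= Z0 * dx by apply: (le_trans dZ); rewrite ler_wpM2l// expr2 ler_piMl// ltW.
have qle : q <= (1 + 4 * Z0 / h) * dx.
  rewrite leNgt; apply/negP => hq'.
  have y0 : 0 <= 4 * Z0 / h by apply: divr_ge0; [exact: mulr_ge0|exact: ltW].
  have : ((1 + 4 * Z0 / h) * dx) ^+ 2 < q ^+ 2.
    by rewrite ltrXn2r ?nnegrE ?mulr_ge0 ?addr_ge0 ?(ltW x0)// ltW// (le_lt_trans _ hq')// mulr_ge0 ?addr_ge0 ?(ltW x0).
  move/lt_le_trans => /(_ _ q2).
  rewrite exprMn (_ : 4 * (Z0 * dx ^+ 2) / h = 4 * Z0 / h * dx ^+ 2); last by lra.
  rewrite ltr_pM2r ?exprn_gt0//; move: y0; set y := 4 * Z0 / h; nra.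
rewrite /jump_const; move: qle dle; lra.
Qed.

Hypothesis per_m : forall k m, even_node k m -> u k (m + (2 * N)%:Z) = u k m.
Hypothesis per_k : forall k m, even_node k m -> u (k + 2 * K)%N m = u k m.

(** By periodicity in space and time a node with the largest jump exists, and that jump
    is not smaller than the jumps one time level before. *)
Lemma jump_bound k m : even_node k m -> u k (m + 2) - u k m <= jump_const * dx.
Proof.
pose g k (i : int) := u k (2 * i + k%:Z + 2) - u k (2 * i + k%:Z).
have en k' i : even_node k' (2 * i + k'%:Z) by rewrite /even_node; lia.
have en2 k' i : even_node k' (2 * i + k'%:Z + 2) by rewrite /even_node; lia.
have gper k' i : g k' (i + (2 * N)%:Z) = g k' i.
  have e m' : even_node k' m' -> u k' (m' + 2 * (2 * N)%:Z) = u k' m'.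
    move=> em'; have E : m' + 2 * (2 * N)%:Z = m' + (2 * N)%:Z + (2 * N)%:Z by lia.
    rewrite E per_m ?per_m//.
    by rewrite PoszM even_nodeDn.
  rewrite /g -(e _ (en k' i)) -(e _ (en2 k' i)).
  by congr (u k' _ - u k' _); lia.
have gmax k' : exists i0, forall i, g k' i <= g k' i0 by exact: (periodic_max NK (gper k')).
pose im k' := sval (cid (gmax k')).
have imP k' i : g k' i <= g k' (im k') by rewrite /im; case: cid.
have K0 : (0 < 2 * K)%N by rewrite muln_gt0; case/andP: NK => n0 /(leq_trans n0).
pose k0 : 'I_(2 * K) := Ordinal K0.
have [ks _ hks] := arg_maxP (fun k : 'I_(2 * K) => g k (im k)) (erefl (xpredT k0)).
have perkj k' m' j : even_node k' m' -> u (k' + 2 * K * j)%N m' = u k' m'.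
  elim: j => [|j IH] em'; first by rewrite muln0 addn0.
  have -> : (k' + 2 * K * j.+1 = (k' + 2 * K * j) + 2 * K)%N by lia.
  rewrite per_k ?IH// -mulnA; by rewrite even_node_time.
have jump k' m' : even_node k' m' -> u k' (m' + 2) - u k' m' <= g ks (im ks).
  move=> em'.
  pose r : 'I_(2 * K) := Ordinal (ltn_pmod k' K0).
  have kE : k' = (r + 2 * K * (k' %/ (2 * K)))%N by rewrite /= addnC mulnC -divn_eq.
  have er : even_node r m' by move: em'; rewrite {1}kE -mulnA even_node_time.
  have er2 : even_node r (m' + 2) by rewrite even_nodeD2.
  rewrite {1 2}kE !perkj//.
  apply: (le_trans _ (hks r isT)).
  have [i mE] : exists i : int, m' = 2 * i + r%:Z.
    exists ((m' - (r : nat)%:Z) %/ 2)%Z; move: er; rewrite /even_node; lia.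
  rewrite mE; exact: imP.
move=> em; apply: (le_trans (jump k m em)).
pose k1 := (ks + 2 * K).-1; have k1E : k1.+1 = (ks + 2 * K)%N by rewrite /k1; lia.
pose m1 := 2 * im ks + (ks : nat)%:Z + 1.
apply: (@jump_step k1 m1).
- by rewrite -[even_node _ _]negbK -even_nodeSl k1E even_node_time /m1 even_nodeD1 negbK en.
- by move=> m'; exact: jump.
- rewrite k1E /m1 addrK -[_ + 1 + 1]addrA !per_k//.
Qed.

End Oleinik.
End JumpBound.

(** * Error of the grid values *)

Section Rates.
Context {R : realType}.

(** The last identity balances $Q^\tau$ periods, each costing $\sqrt{\Delta x}$, against
    the covering distance $1/Q$ for $Q=\kappa^{-1}$; the square root of $\kappa$ is the
    resolution at which slopes are read off from values. *)
Lemma rate_facts (tau d : R) : 0 < tau -> 0 < d <= 1 ->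
  let kap := d `^ (2 * (1 + tau))^-1 in
  let rho := d `^ (4 * (1 + tau))^-1 in
  [/\ 0 < kap <= 1, 0 < rho, rho ^+ 2 = kap,
      d <= kap /\ d <= rho & kap^-1 `^ tau * Num.sqrt d = kap].
Proof.
move=> t0 /andP[d0 d1] kap rho.
have p0 : 0 < 1 + tau by rewrite addr_gt0.
have e2 : 0 < (2 * (1 + tau))^-1 by rewrite invr_gt0 mulr_gt0.
have e4 : 0 < (4 * (1 + tau))^-1 by rewrite invr_gt0 mulr_gt0.
have le1 e : 0 <= e -> d `^ e <= 1.
  move=> e0; have -> : 1 = 1 `^ e :> R by rewrite powR1.
  by rewrite ge0_ler_powR ?nnegrE// ltW.
have led e : 0 < e -> e <= 1 -> d <= d `^ e.
  move=> e0 e1; rewrite -[leLHS](powRr1 (ltW d0)) -[X in d `^ X <= _](subrK e 1).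
  rewrite powRD; last by rewrite (gt_eqF d0) implybT.
  by rewrite ler_piMl ?powR_ge0// le1// subr_ge0.
split.
- by rewrite powR_gt0 //= le1// ltW.
- by rewrite powR_gt0.
- rewrite -powR_mulrn ?powR_ge0// -powRrM; congr (_ `^ _).
  by field; rewrite gt_eqF.
- by split; apply: led => //; rewrite invf_le1 ?mulr_gt0//; lra.
- rewrite -powR12_sqrt ?(ltW d0)//.
  rewrite -[kap^-1]/((d `^ _)^-1) -powRN -powRrM -powRD; last by rewrite (gt_eqF d0) ?implybT.
  by congr (_ `^ _); field; rewrite gt_eqF.
Qed.

End Rates.

Lemma odd_shiftS (n : int) (j : nat) : n + 2 * j.+1%:Z = n + 2 * j%:Z + 1 + 1.
Proof. by rewrite intS; lia. Qed.

Section GridConvergence.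
Context {R : realType}.
Variables (H : R -> R -> R -> R) (hH : hamiltonian H) (c hbar U L : R) (ubar vbar : R -> R -> R).
Hypothesis reg : regular_solution H c hbar ubar vbar U L.
Variables (lambda0 B : R).
Hypothesis B0 : 0 <= B.

Let Hconvex := H_above_tangent hH.
Let perH := ham_periodic hH.

Section Mesh.
Variables (N K : nat).
Hypothesis NK : (0 < N <= K)%N.
Hypothesis hl0 : 0 < lambda0 <= lam N K.
Hypothesis lamB : lam N K * B <= 1.
Local Notation dx := (dx N : R).
Local Notation dt := (dt K : R).
Local Notation x_ m := (xm N m : R).
Local Notation t_ k := (tk K k : R).
Variables (h : R) (v : nat -> int -> R).
Hypothesis gv : grid_solution H c N K h v.
Hypothesis bB : forall k m, even_node k m -> `|Dp H (x_ m) (t_ k) (c + slope N v k m)| <= B.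

Let e := grid_error N K vbar v.
(** One constant serving both the exact drift, bounded by $L$, and the discrete drift,
    bounded by $B$. *)
Definition total_consistency := consistency_const L lambda0 L + consistency_const L lambda0 B.
Let Cc := total_consistency.

Lemma consistency_ge0 A : 0 <= A -> 0 <= consistency_const L lambda0 A.
Proof.
move=> A0; have L0 := reg_L reg; case/andP: hl0 => l0 _.
by rewrite /consistency_const !addr_ge0// ?divr_ge0// ?mulr_ge0// ltW.
Qed.

Lemma lam_le1 b : `|b| <= B -> `|lam N K * b| <= 1.
Proof.
move=> bb; have l0 : 0 < lam N K :> R by exact: (lam_gt0 NK).
rewrite normrM (gtr0_norm l0); apply: le_trans lamB.
by rewrite ler_wpM2l// ltW.
Qed.

Lemma upper_monotone_step k : (forall x, `|lam N K * drift H c ubar x (t_ k)| <= 1) ->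
  monotone_step N K e (fun k m => drift H c ubar (x_ m) (t_ k)) (dt * (h - hbar) + Cc * (dt * dx)) k.
Proof.
move=> bk m em; split; first exact: bk.
apply: (le_trans (error_upper_step NK reg Hconvex hl0 gv em erefl)).
rewrite lerD2l lerD2l ler_wpM2r ?mulr_ge0 ?(ltW (dt_gt0 NK)) ?(ltW (dx_gt0 NK))//.
by rewrite lerDl consistency_ge0.
Qed.

Lemma lower_monotone_step k :
  monotone_step N K (fun k m => - e k m) (fun k m => Dp H (x_ m) (t_ k) (c + slope N v k m))
    (dt * (hbar - h) + Cc * (dt * dx)) k.
Proof.
move=> m em; split; first by apply: lam_le1; exact: bB.
apply: (le_trans (error_lower_step NK reg Hconvex hl0 gv em erefl (bB em))).
rewrite lerD2l lerD2l ler_wpM2r ?mulr_ge0 ?(ltW (dt_gt0 NK)) ?(ltW (dx_gt0 NK))//.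
by rewrite lerDr consistency_ge0// (reg_L reg).
Qed.

Section Periodic.
Hypothesis driftB : forall x t, `|drift H c ubar x t| <= B.
Hypothesis vper : forall m, ~~ even_node 0 m -> v (2 * K)%N m = v 0%N m.

Let dtK : dt * (2 * K)%:R = 1. Proof. by rewrite mulrC; exact: (tk_one NK). Qed.

(** Agreement after one period at the initial level propagates, as $H$ is periodic in
    $t$. *)
Lemma grid_time_periodic k m : ~~ even_node k m -> v (k + 2 * K)%N m = v k m.
Proof.
elim: k m => [|k IH] m; first exact: vper.
rewrite even_nodeSl negbK => em.
have em' : even_node (k + 2 * K) m by rewrite even_node_time.
rewrite addSn (grid_step NK gv em') (grid_step NK gv em).
have m1 : v (k + 2 * K)%N (m - 1) = v k (m - 1) by apply: IH; rewrite even_nodeB1 em.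
have p1 : v (k + 2 * K)%N (m + 1) = v k (m + 1) by apply: IH; rewrite even_nodeD1 em.
have tp : t_ (k + 2 * K) = t_ k + 1%:R by rewrite -(tk_period NK k 1) muln1.
by rewrite /slope m1 p1 tp (perH _).2.
Qed.

Lemma error_time_periodic k m : ~~ even_node k m -> e (k + 2 * K)%N m = e k m.
Proof.
move=> om; rewrite /e /grid_error grid_time_periodic//.
have -> : t_ (k + 2 * K) = t_ k + 1 by rewrite -(tk_period NK k 1) muln1.
by rewrite (reg_v_periodic reg).2.
Qed.

Lemma error_time_periodicn k j m : ~~ even_node k m -> e (k + 2 * K * j)%N m = e k m.
Proof.
move=> om; elim: j => [|j IH]; first by rewrite muln0 addn0.
have -> : (k + 2 * K * j.+1 = (k + 2 * K * j) + 2 * K)%N by rewrite mulnS addnCA addnC.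
by rewrite error_time_periodic ?IH// -mulnA even_node_time.
Qed.

Lemma error_periodicz k m (z : int) : ~~ even_node k m -> e k (m + (2 * N)%:Z * z) = e k m.
Proof.
move=> om; rewrite /e /grid_error (grid_periodicz gv)// (xm_period NK).
by rewrite (periodicz ((reg_v_periodic reg).1 _)).
Qed.

Lemma error_max (f : int -> R) : (forall m (z : int), ~~ even_node 0 m -> f (m + (2 * N)%:Z * z) = f m) ->
  exists2 m0, ~~ even_node 0 m0 & forall m, ~~ even_node 0 m -> f m <= f m0.
Proof.
move=> pf.
have on (i : int) : ~~ even_node 0 (2 * i + 1) by rewrite /even_node; lia.
have [|i0 hi0] := periodic_max NK (f := fun i => f (2 * i + 1)).
  move=> i; rewrite -(pf (2 * i + 1) 2 (on i)); congr f; lia.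
exists (2 * i0 + 1); first exact: on.
move=> m om; have [i ->] : exists i, m = 2 * i + 1.
  by exists ((m - 1) %/ 2)%Z; move: om; rewrite /even_node; lia.
exact: hi0.
Qed.

(** Averaging over one time period: the extrema of a periodic error cannot drift, so
    the two effective constants agree up to the consistency error. *)
Lemma effective_constant_error : `|h - hbar| <= Cc * dx.
Proof.
have stu k : (k < 2 * K)%N -> monotone_step N K e (fun k m => drift H c ubar (x_ m) (t_ k)) (dt * (h - hbar) + Cc * (dt * dx)) k.
  by move=> _; apply: upper_monotone_step => x; exact: lam_le1.
have stl k : (k < 2 * K)%N -> monotone_step N K (fun k m => - e k m) (fun k m => Dp H (x_ m) (t_ k) (c + slope N v k m)) (dt * (hbar - h) + Cc * (dt * dx)) k.
  by move=> _; exact: lower_monotone_step.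
have gain d : (2 * K)%:R * (dt * d + Cc * (dt * dx)) = d + Cc * dx.
  by rewrite mulrDr !mulrA (mulrC _ dt) dtK mul1r (mulrC _ Cc) -(mulrA Cc) (mulrC _ dt) dtK mulr1.
have [m0 o0 h0] := error_max (fun m z om => error_periodicz z om).
have [m1 o1 h1] := @error_max (fun m => - e 0%N m) (fun m z om => congr1 -%R (error_periodicz z om)).
have p0 : e (2 * K)%N m0 = e 0%N m0 by exact: (error_time_periodic (k := 0%N)).
have p1 : e (2 * K)%N m1 = e 0%N m1 by exact: (error_time_periodic (k := 0%N)).
have o0' : ~~ even_node (2 * K) m0 by rewrite -[(2 * K)%N]add0n even_node_time.
have o1' : ~~ even_node (2 * K) m1 by rewrite -[(2 * K)%N]add0n even_node_time.
have a1 := maximum_principle stu h0 (leqnn _) o0'.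
have a2 := maximum_principle stl h1 (leqnn _) o1'.
rewrite /= gain p0 in a1; rewrite /= gain p1 in a2.
by rewrite ler_norml; apply/andP; split; lra.
Qed.

Variable Us : R.
Hypothesis slopeU : forall k m, even_node k m -> `|slope N v k m| <= Us.

Lemma error_lipschitz k m m' : ~~ even_node k m -> ~~ even_node k m' ->
  `|e k m - e k m'| <= (Us + U) * `|x_ m - x_ m'|.
Proof.
have x0 : 0 < dx by exact: (dx_gt0 NK).
have Lv (j : nat) n : ~~ even_node k n -> `|v k (n + 2 * j%:Z) - v k n| <= Us * (2 * dx * j%:R).
  move=> on; elim: j => [|j IH]; first by rewrite mulr0 addr0 subrr normr0 !mulr0.
  have ev : even_node k (n + 2 * j%:Z + 1) by rewrite even_nodeD1 even_nodeDn.
  have hs := slopeU ev; rewrite /slope addrK in hs.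
  rewrite normrM normfV (gtr0_norm (_ : 0 < 2 * dx)) ?mulr_gt0// ler_pdivrMr ?mulr_gt0// in hs.
  rewrite odd_shiftS.
  rewrite -[_ - v k n](subrKA (v k (n + 2 * j%:Z))).
  apply: (le_trans (ler_normD _ _)); apply: (le_trans (lerD hs IH)).
  by rewrite -[j.+1%:R]natr1; lra.
have Lvz (z : int) n : ~~ even_node k n -> `|v k (n + 2 * z) - v k n| <= Us * `|x_ (n + 2 * z) - x_ n|.
  move=> on.
  have xE (j : nat) : x_ (2 * j%:Z) = 2 * dx * j%:R by rewrite /xm intrM -pmulrn; lra.
  have xd n' (j : int) : x_ (n' + j) - x_ n' = x_ j by rewrite xmD addrAC subrr add0r.
  have xE0 j : `|x_ (2 * j%:Z)| = 2 * dx * j%:R by rewrite xE ger0_norm// !mulr_ge0// ltW.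
  case: z => j; first by rewrite xd xE0; exact: Lv.
  have on' : ~~ even_node k (n + 2 * Negz j) by rewrite even_nodeDn.
  have := Lv j.+1 _ on'; rewrite NegzE mulrN subrK => h1.
  rewrite distrC (distrC (x_ _)); apply: (le_trans h1).
  by rewrite -[X in x_ X - _](subrK (2 * j.+1%:Z) n) xd xE0.
move=> om om'.
have [z ->] : exists z, m = m' + 2 * z.
  by exists ((m - m') %/ 2)%Z; move: om om'; rewrite /even_node; lia.
have h1 := Lvz z _ om'.
have h2 := regular_v_lipschitz reg (x_ (m' + 2 * z)) (x_ m') (t_ k).
have -> : e k (m' + 2 * z) - e k m' = (v k (m' + 2 * z) - v k m') - (vbar (x_ (m' + 2 * z)) (t_ k) - vbar (x_ m') (t_ k)).
  by rewrite /e /grid_error; lra.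
by rewrite [leRHS]mulrDl; apply: (le_trans (ler_normB _ _)); exact: (lerD h1 h2).
Qed.

End Periodic.
End Mesh.

Section Oscillation.
Hypothesis l00 : 0 < lambda0.
Hypothesis driftB : forall x t, `|drift H c ubar x t| <= B.
Variables (tau Us Ck : R).
Hypothesis tau0 : 0 < tau.
Hypothesis Us0 : 0 <= Us.
Hypothesis Ck0 : 0 < Ck.
Hypothesis orbit : forall (gam : R -> R) (Q x1 : R), characteristic H c ubar gam ->
    (forall s t, `|gam s - gam t| <= L * `|s - t|) -> 1 <= Q ->
  exists (n : nat) (z : int), n%:R <= Ck * Q `^ tau /\ `|gam n%:R - x1 - z%:~R| <= Ck / Q.

Let L1 := L * (L + 1) + L.
Let l := Us + U.
Definition osc_const :=
  Ck * (2 * total_consistency + l * block_const lambda0 L1 + 2 * l) + l * Ck.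

(** Transport along the characteristic through $x_{m'}$: by the covering rate it reaches
    every node within $O(Q^\tau)$ periods up to distance $O(1/Q)$, each period costing
    $O(\sqrt{\Delta x})$; $Q = \Delta x^{-1/(2(1+\tau))}$ balances the two errors. *)
Lemma initial_oscillation N K h v : (0 < N <= K)%N -> lambda0 <= lam N K -> lam N K * B <= 1 ->
    grid_solution H c N K h v ->
    (forall k m, even_node k m -> `|Dp H (xm N m) (tk K k) (c + slope N v k m)| <= B) ->
    (forall k m, even_node k m -> `|slope N v k m| <= Us) ->
    (forall m, ~~ even_node 0 m -> v (2 * K)%N m = v 0%N m) ->
  forall m m', ~~ even_node 0 m -> ~~ even_node 0 m' ->
  grid_error N K vbar v 0 m <= grid_error N K vbar v 0 m' + osc_const * dx N `^ (2 * (1 + tau))^-1.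
Proof.
move=> NK ll lamB gv bB slopeU vper m m' om om'.
have hl0 : 0 < lambda0 <= lam N K by rewrite l00.
have L0 := reg_L reg.
have d0 : 0 < dx N :> R by exact: (dx_gt0 NK).
have d1 : dx N <= 1 :> R by have := dx_le NK (R := R); lra.
have [|/andP[k0 k1] _ _ [dk _] Qk] := rate_facts tau0 (_ : 0 < dx N <= 1); first by rewrite d0.
set kap := dx N `^ _ in k0 k1 dk Qk *.
have U0 : 0 <= U := le_trans (normr_ge0 _) (reg_U reg 0 0).
have bL x t y s : `|drift H c ubar x t - drift H c ubar y s| <= L * (`|x - y| + `|t - s|) by exact: (reg_drift_lipschitz reg).
have [gam [gam0 dgam]] := characteristic_exists (xm N m') L0 bL (reg_drift_bound reg).
have gamL s t : `|gam s - gam t| <= L * `|s - t|.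
  exact: (@bounded_derivative_lipschitz R gam (fun s => drift H c ubar (gam s) s) L s t dgam (fun s => reg_drift_bound reg (gam s) s)).
have L10 : 0 <= L1 by rewrite addr_ge0// mulr_ge0// addr_ge0.
have LL1 : L <= L1 by rewrite lerDr mulr_ge0// addr_ge0.
have gT s d : 0 <= d -> `|gam (s + d) - gam s - d * drift H c ubar (gam s) s| <= L1 * d ^+ 2.
  move=> dd.
  have lip z w : `|drift H c ubar (gam z) z - drift H c ubar (gam w) w| <= L * (L + 1) * `|z - w|.
    apply: (le_trans (bL _ _ _ _)); rewrite -mulrA ler_wpM2l// mulrDl mul1r lerD2r.
    exact: gamL.
  have := lipschitz_derivative_taylor s (s + d) dgam lip.
  rewrite (_ : s + d - s = d); last by rewrite addrAC subrr add0r.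
  rewrite (mulrC _ d) => /le_trans; apply; rewrite ler_wpM2r ?sqr_ge0//.
  by have : 0 <= L * (L + 1) by [rewrite mulr_ge0// addr_ge0]; rewrite /L1; lra.
have bL1 x y t : `|drift H c ubar x t - drift H c ubar y t| <= L1 * `|x - y|.
  by apply: (le_trans (bL _ _ _ _)); rewrite subrr normr0 addr0 ler_wpM2r.
have bB1 x t : `|drift H c ubar x t| <= L1 by apply: (le_trans (reg_drift_bound reg x t)).
have l0 : 0 <= l by rewrite addr_ge0.
have bper x t : drift H c ubar x (t + 1) = drift H c ubar x t.
  by rewrite /drift (reg_u_periodic reg).2 (Dp_periodic perH _).2.
have st k : (k < 2 * K)%N -> monotone_step N K (grid_error N K vbar v) (fun k m => drift H c ubar (xm N m) (tk K k))
    (dt K * (h - hbar) + total_consistency * (dt K * dx N)) k.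
  by move=> _; apply: (upper_monotone_step NK hl0 gv) => x; exact: (lam_le1 NK lamB).
have eper n : ~~ even_node 0 n -> grid_error N K vbar v (2 * K) n = grid_error N K vbar v 0 n.
  by move=> on; exact: (error_time_periodic NK gv vper (k := 0%N)).
have eL n n' : ~~ even_node 0 n -> ~~ even_node 0 n' ->
    `|grid_error N K vbar v 0 n - grid_error N K vbar v 0 n'| <= l * `|xm N n - xm N n'|.
  by move=> on on'; exact: (error_lipschitz NK hl0 lamB slopeU on on').
have e0 n : ~~ even_node 0 n -> grid_error N K vbar v 0 n <= grid_error N K vbar v 0 m' + l * `|xm N n - gam 0|.
  by move=> on; have := eL _ _ on om'; rewrite gam0 ler_norml => /andP[_]; lra.
have Q1 : 1 <= kap^-1 by rewrite invf_ge1.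
have [n [z [nQ hz]]] := orbit (xm N m) dgam gamL Q1.
have omz : ~~ even_node 0 (m + (2 * N)%:Z * z) by rewrite PoszM -mulrA even_nodeDn.
have := orbit_estimate NK hl0 L10 l0 bL1 bB1 st bper gT eper eL e0 n omz.
rewrite (error_periodicz NK gv _ om) (xm_period NK).
have {}hz : `|xm N m + z%:~R - gam n%:R| <= Ck / kap^-1 by rewrite distrC opprD addrA.
move=> est; apply: (le_trans est); rewrite -addrA lerD2l.
have hc := effective_constant_error NK hl0 lamB gv bB driftB vper.
set Cc := total_consistency in hc *.
have sd0 : 0 <= Num.sqrt (dx N) :> R by exact: sqrtr_ge0.
have dsd : dx N <= Num.sqrt (dx N) :> R.
  rewrite -[leLHS](sqr_sqrtr (ltW d0)) expr2 ler_piMl//.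
  by rewrite -[leRHS]sqrtr1 ler_wsqrtr.
have Cc0 : 0 <= Cc by apply: addr_ge0; apply: (consistency_ge0 hl0).
have lam01 : 0 < lambda0 by [].
have bc0 : 0 <= block_const lambda0 L1.
  have i0 : 0 <= lambda0^-1 by rewrite invr_ge0 ltW.
  apply: divr_ge0 => //; apply: addr_ge0 => //; apply: mulr_ge0; first exact: expR_ge0.
  by apply: addr_ge0 => //; apply: addr_ge0 => //; apply: mulr_ge0 => //; exact: sqr_ge0.
have dtK : (2 * K)%:R * dt K = 1 :> R by exact: (tk_one NK).
have s1 : (2 * K)%:R * (dt K * (h - hbar) + Cc * (dt K * dx N)) <= 2 * Cc * Num.sqrt (dx N).
  rewrite (_ : _ * (_ + _) = ((2 * K)%:R * dt K) * ((h - hbar) + Cc * dx N)); last by lra.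
  rewrite dtK mul1r; move: hc; rewrite ler_norml => /andP[_ hc].
  by have := ler_wpM2l Cc0 dsd; lra.
pose S := 2 * Cc + l * block_const lambda0 L1 + 2 * l.
have S0 : 0 <= S.
  apply: addr_ge0; first (apply: addr_ge0; [exact: mulr_ge0|exact: mulr_ge0]).
  by rewrite mulr_ge0.
have s2 : (2 * K)%:R * (dt K * (h - hbar) + Cc * (dt K * dx N)) + l * block_const lambda0 L1 * Num.sqrt (dx N) + 2 * l * dx N <= S * Num.sqrt (dx N).
  by have := ler_wpM2l l0 dsd; rewrite /S; lra.
have s3 := ler_wpM2l (ler0n R n) s2.
have s4 : n%:R * (S * Num.sqrt (dx N)) <= Ck * S * kap.
  have := ler_wpM2r (mulr_ge0 S0 sd0) nQ; rewrite -[in X in _ -> X]Qk; lra.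
have s5 := ler_wpM2l l0 hz; rewrite invrK in s5.
apply: (le_trans (lerD (le_trans s3 s4) s5)).
by rewrite /osc_const -/Cc -/S; lra.
Qed.

(** The maximum principle spreads the initial bound over one period, from above with the
    exact drift and from below with the discrete one; the constant $a$ makes the error
    vanish at a reference node. *)
Lemma error_oscillation N K h v : (0 < N <= K)%N -> lambda0 <= lam N K -> lam N K * B <= 1 ->
    grid_solution H c N K h v ->
    (forall k m, even_node k m -> `|Dp H (xm N m) (tk K k) (c + slope N v k m)| <= B) ->
    (forall k m, even_node k m -> `|slope N v k m| <= Us) ->
    (forall m, ~~ even_node 0 m -> v (2 * K)%N m = v 0%N m) ->
  exists a : R, forall k m, ~~ even_node k m ->
  `|grid_error N K vbar v k m + a| <= (osc_const + 2 * total_consistency) * dx N `^ (2 * (1 + tau))^-1.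
Proof.
move=> NK ll lamB gv bB slopeU vper.
have hl0 : 0 < lambda0 <= lam N K by rewrite l00.
have L0 := reg_L reg.
have d0 : 0 < dx N :> R by exact: (dx_gt0 NK).
have d1 : dx N <= 1 :> R by have := dx_le NK (R := R); lra.
have [|/andP[k0 k1] _ _ [dk _] Qk] := rate_facts tau0 (_ : 0 < dx N <= 1); first by rewrite d0.
have o1 : ~~ even_node 0 1 by [].
exists (- grid_error N K vbar v 0 1).
have osc m := initial_oscillation NK ll lamB gv bB slopeU vper (m := m).
set kap := dx N `^ _ in k0 k1 dk Qk osc *.
have hc := effective_constant_error NK hl0 lamB gv bB driftB vper.
set Cc := total_consistency in hc *.
have Cc0 : 0 <= Cc by apply: addr_ge0; apply: (consistency_ge0 hl0).
move: hc; rewrite ler_norml => /andP[hc1 hc2].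
have dtk0 : 0 < dt K :> R by exact: (dt_gt0 NK).
have stu k : (k < 2 * K)%N -> monotone_step N K (grid_error N K vbar v) (fun k m => drift H c ubar (xm N m) (tk K k)) (dt K * (h - hbar) + Cc * (dt K * dx N)) k.
  by move=> _; apply: (upper_monotone_step NK hl0 gv) => x; exact: (lam_le1 NK lamB).
have stl k : (k < 2 * K)%N -> monotone_step N K (fun k m => - grid_error N K vbar v k m) (fun k m => Dp H (xm N m) (tk K k) (c + slope N v k m)) (dt K * (hbar - h) + Cc * (dt K * dx N)) k.
  by move=> _; apply: (lower_monotone_step NK hl0 lamB gv bB).
have kt k : (k <= 2 * K)%N -> k%:R * dt K <= 1 :> R.
  have dtK : (2 * K)%:R * dt K = 1 :> R by exact: (tk_one NK).
  by move=> kK; rewrite -[leRHS]dtK ler_wpM2r ?(ltW dtk0)// ler_nat.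
have base k m : (k <= 2 * K)%N -> ~~ even_node k m ->
    `|grid_error N K vbar v k m + - grid_error N K vbar v 0 1| <= (osc_const + 2 * Cc) * kap.
  move=> kK om.
  have a1 := maximum_principle stu (fun m om => osc m 1 om o1) kK om.
  have low n : ~~ even_node 0 n -> - grid_error N K vbar v 0 n <= - grid_error N K vbar v 0 1 + osc_const * kap.
    by move=> on; have := osc 1 n o1 on; lra.
  have a2 := maximum_principle stl low kK om.
  have t1 := kt k kK.
  have cdk := ler_wpM2l Cc0 dk.
  have cd0 : 0 <= 2 * (Cc * dx N) by rewrite !mulr_ge0// ltW.
  have b1 : k%:R * (dt K * (h - hbar) + Cc * (dt K * dx N)) <= 2 * (Cc * dx N).
    rewrite (_ : _ * _ = (k%:R * dt K) * (h - hbar + Cc * dx N)); last by lra.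
    apply: (@le_trans _ _ (k%:R * dt K * (2 * (Cc * dx N)))); last by rewrite ler_piMl.
    by rewrite ler_wpM2l ?mulr_ge0 ?(ltW dtk0)//; lra.
  have b2 : k%:R * (dt K * (hbar - h) + Cc * (dt K * dx N)) <= 2 * (Cc * dx N).
    rewrite (_ : _ * _ = (k%:R * dt K) * (hbar - h + Cc * dx N)); last by lra.
    apply: (@le_trans _ _ (k%:R * dt K * (2 * (Cc * dx N)))); last by rewrite ler_piMl.
    by rewrite ler_wpM2l ?mulr_ge0 ?(ltW dtk0)//; lra.
  by rewrite ler_norml; apply/andP; split; lra.
move=> k m om.
have K0 : (0 < 2 * K)%N by rewrite muln_gt0; case/andP: NK => n0 /(leq_trans n0).
have kE : k = ((k %% (2 * K)) + 2 * K * (k %/ (2 * K)))%N by rewrite addnC mulnC -divn_eq.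
have om' : ~~ even_node (k %% (2 * K)) m by move: om; rewrite {1}kE -mulnA even_node_time.
rewrite {1}kE (error_time_periodicn NK gv vper _ om').
by apply: base om'; rewrite ltnW// ltn_pmod.
Qed.

End Oscillation.
End GridConvergence.

(** * Error of the grid slopes *)

Lemma even_shiftS (n : int) (j : nat) : n + 2 * j.+1%:Z = n + 2 * j%:Z + 2.
Proof. by rewrite intS; lia. Qed.

Lemma odd_shiftB (n : int) (j : nat) : n + 1 - 2 * j.+1%:Z = n - 2 * j%:Z - 1.
Proof. by rewrite intS; lia. Qed.

Section SlopeError.
Context {R : realType}.
Variables (H : R -> R -> R -> R) (c hbar U L : R) (ubar vbar : R -> R -> R).
Hypothesis reg : regular_solution H c hbar ubar vbar U L.
Variables (N K : nat).
Hypothesis NK : (0 < N <= K)%N.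
Local Notation dx := (dx N : R).
Local Notation x_ m := (xm N m : R).
Local Notation t_ k := (tk K k : R).
Variables (v : nat -> int -> R) (J E a : R) (k : nat).
Hypothesis J0 : 0 <= J.
Hypothesis jump : forall m, even_node k m -> slope N v k (m + 2) - slope N v k m <= J * dx.
Hypothesis errE : forall m, ~~ even_node k m -> `|grid_error N K vbar v k m + a| <= E.

Lemma slope_increment m : v k (m + 1) - v k (m - 1) = 2 * dx * slope N v k m.
Proof.
have x0 : 0 < dx by exact: (dx_gt0 NK).
by rewrite /slope; field; rewrite gt_eqF.
Qed.

Lemma slope_above m n : even_node k m -> slope N v k (m + 2 * n%:Z) <= slope N v k m + n%:R * (J * dx).
Proof.
move=> em; elim: n => [|n IH]; first by rewrite mulr0 addr0 mul0r addr0.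
have := jump (m := m + 2 * n%:Z); rewrite even_nodeDn => /(_ em).
rewrite even_shiftS -[n.+1%:R]natr1; lra.
Qed.

Lemma slope_below m n : even_node k m -> slope N v k m - n%:R * (J * dx) <= slope N v k (m - 2 * n%:Z).
Proof.
move=> em; have := @slope_above (m - 2 * n%:Z) n.
by rewrite -mulrN even_nodeDn em mulrN subrK => /(_ isT); lra.
Qed.

Lemma increment_above m n : even_node k m ->
  v k (m - 1 + 2 * n%:Z) - v k (m - 1) <= 2 * dx * n%:R * (slope N v k m + n%:R * (J * dx)).
Proof.
move=> em; have x0 : 0 < dx by exact: (dx_gt0 NK).
elim: n => [|n IH]; first by rewrite mulr0 addr0 subrr mulr0 mul0r.
have h1 := slope_increment (m + 2 * n%:Z).
have E1 : m - 1 + 2 * n%:Z = m + 2 * n%:Z - 1 by rewrite addrAC.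
have E2 : m - 1 + 2 * n.+1%:Z = m + 2 * n%:Z + 1 by rewrite odd_shiftS E1 subrK.
rewrite E1 in IH; rewrite E2.
have h2 := ler_wpM2l (mulr_ge0 (ler0n R 2) (ltW x0)) (slope_above n em).
have h3 : 0 <= dx * (n%:R + 1) * (J * dx) by rewrite !mulr_ge0 ?addr_ge0 ?(ltW x0).
have h4 : 0 <= dx * n%:R * (J * dx) by rewrite !mulr_ge0 ?(ltW x0).
move: h1 h2 h3 h4 IH; rewrite -[n.+1%:R]natr1; lra.
Qed.

Lemma increment_below m n : even_node k m ->
  2 * dx * n%:R * (slope N v k m - n%:R * (J * dx)) <= v k (m + 1) - v k (m + 1 - 2 * n%:Z).
Proof.
move=> em; have x0 : 0 < dx by exact: (dx_gt0 NK).
elim: n => [|n IH]; first by rewrite !(mulr0, mul0r, subr0, subrr).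
have h1 := slope_increment (m - 2 * n%:Z).
have E1 : m - 2 * n%:Z + 1 = m + 1 - 2 * n%:Z by rewrite addrAC.
have E2 := odd_shiftB m n.
rewrite E1 in h1; rewrite E2.
have h2 := ler_wpM2l (mulr_ge0 (ler0n R 2) (ltW x0)) (slope_below n em).
have h3 : 0 <= dx * (n%:R + 1) * (J * dx) by rewrite !mulr_ge0 ?addr_ge0 ?(ltW x0).
have h4 : 0 <= dx * n%:R * (J * dx) by rewrite !mulr_ge0 ?(ltW x0).
move: h1 h2 h3 h4 IH; rewrite -[n.+1%:R]natr1; lra.
Qed.

Lemma vbar_increment x t n : (0 < n)%N ->
  `|vbar (x + dx) t - vbar (x + dx - 2 * dx * n%:R) t - 2 * dx * n%:R * ubar x t| <= 2 * dx * n%:R * (L * n%:R * dx) /\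
  `|vbar (x - dx + 2 * dx * n%:R) t - vbar (x - dx) t - 2 * dx * n%:R * ubar x t| <= 2 * dx * n%:R * (L * n%:R * dx).
Proof.
move=> n0; have n1 : 1 <= n%:R :> R by rewrite ler1n.
have L0 := reg_L reg.
have q d d' : d - d' = 2 * dx * n%:R -> d ^+ 2 + d' ^+ 2 <= 4 * dx ^+ 2 * n%:R ^+ 2 ->
   `|vbar (x + d) t - vbar (x + d') t - 2 * dx * n%:R * ubar x t| <= 2 * dx * n%:R * (L * n%:R * dx).
  move=> dd dq; have h1 := regular_v_taylor reg x t d; have h2 := regular_v_taylor reg x t d'.
  have -> : vbar (x + d) t - vbar (x + d') t - 2 * dx * n%:R * ubar x t =
     (vbar (x + d) t - vbar x t - ubar x t * d) - (vbar (x + d') t - vbar x t - ubar x t * d').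
    by rewrite -dd; lra.
  apply: (le_trans (ler_normB _ _)); apply: (le_trans (lerD h1 h2)).
  have := ler_wpM2l L0 dq; lra.
have s : dx ^+ 2 + (dx - 2 * dx * n%:R) ^+ 2 <= 4 * dx ^+ 2 * n%:R ^+ 2.
  have := ler_wpM2l (sqr_ge0 dx) n1; have := sqr_ge0 dx; lra.
split.
  have -> : x + dx - 2 * dx * n%:R = x + (dx - 2 * dx * n%:R) by rewrite addrA.
  by apply: q; [lra|exact: s].
have -> : x - dx + 2 * dx * n%:R = x + - (dx - 2 * dx * n%:R) by lra.
by apply: q; [lra|rewrite addrC !sqrrN; exact: s].
Qed.

(** A slope error at one node persists, by one-sided Lipschitz continuity, on an
    interval of $n$ cells to one side, where it shows up in the values of $v$. *)
Lemma slope_error m n : even_node k m -> (0 < n)%N ->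
  `|slope N v k m - ubar (x_ m) (t_ k)| <= E / (n%:R * dx) + n%:R * ((J + L) * dx).
Proof.
move=> em n0; have x0 : 0 < dx by exact: (dx_gt0 NK).
have nR : 0 < n%:R :> R by rewrite ltr0n.
have nd : 0 < n%:R * dx by rewrite mulr_gt0.
have on1 : ~~ even_node k (m + 1) by rewrite even_nodeD1 em.
have on2 : ~~ even_node k (m - 1) by rewrite even_nodeB1 em.
have on3 : ~~ even_node k (m + 1 - 2 * n%:Z) by rewrite -mulrN even_nodeDn.
have on4 : ~~ even_node k (m - 1 + 2 * n%:Z) by rewrite even_nodeDn.
have xn : x_ (2 * n%:Z) = 2 * dx * n%:R by rewrite /xm intrM -pmulrn; lra.
have xnN : x_ (m + 1 - 2 * n%:Z) = x_ m + dx - 2 * dx * n%:R.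
  by rewrite -xn -xmD1 -[in RHS](subrK (2 * n%:Z) (m + 1)) [in RHS]xmD addrK.
have xnP : x_ (m - 1 + 2 * n%:Z) = x_ m - dx + 2 * dx * n%:R by rewrite xmD xmB1 xn.
suff : `|(slope N v k m - ubar (x_ m) (t_ k)) * (n%:R * dx)| <= E + n%:R * ((J + L) * dx) * (n%:R * dx).
  rewrite normrM (gtr0_norm nd) => hs; rewrite -(ler_pM2r nd) [leRHS]mulrDl divfK//.
  by rewrite gt_eqF.
have [b1 b2] := vbar_increment (x_ m) (t_ k) n0.
have i1 := increment_below n em; have i2 := increment_above n em.
have := errE on1; have := errE on2; have := errE on3; have := errE on4.
rewrite /grid_error xnN xnP xmD1 xmB1 !ler_norml.
move=> /andP[f1 f2] /andP[f3 f4] /andP[f5 f6] /andP[f7 f8].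
move: b1 b2; rewrite !ler_norml => /andP[b1 b1'] /andP[b2 b2'].
set w := slope N v k m in i1 i2 *; set ub := ubar _ _ in b1 b1' b2 b2' *.
by apply/andP; split; lra.
Qed.

End SlopeError.

Section Convergence.
Context {R : realType}.
Variables (H : R -> R -> R -> R) (hH : hamiltonian H) (c hbar U L : R) (ubar vbar : R -> R -> R).
Hypothesis reg : regular_solution H c hbar ubar vbar U L.
Variables (lambda0 B nu tau : R).
Hypotheses (B0 : 0 <= B) (l0 : 0 < lambda0).
Hypothesis driftB : forall x t, `|drift H c ubar x t| <= B.
Hypothesis kam : KAM_torus H c nu tau ubar.

(** The values are $\kappa$-close, $\kappa=\Delta x^{1/(2(1+\tau))}$, and slopes are read
    off over windows of length $\rho=\sqrt\kappa$, for which the two terms of the slope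
    error, $\kappa/\rho$ and $\rho$, agree. *)
Lemma grid_convergence : exists b7 b8 Us : R, [/\ 0 <= b7, 0 <= b8, 0 <= Us &
  forall N K h v, (0 < N <= K)%N -> lambda0 <= lam N K -> lam N K * B <= 1 ->
    grid_solution H c N K h v ->
    (forall k m, even_node k m -> `|Dp H (xm N m) (tk K k) (c + slope N v k m)| <= B) ->
    (forall m, ~~ even_node 0 m -> v (2 * K)%N m = v 0%N m) ->
  [/\ exists a : R, forall k m, ~~ even_node k m ->
        `|grid_error N K vbar v k m + a| <= b7 * dx N `^ (2 * (1 + tau))^-1,
      forall k m, even_node k m ->
        `|slope N v k m - ubar (xm N m) (tk K k)| <= b8 * dx N `^ (4 * (1 + tau))^-1 &
      forall k m, even_node k m -> `|slope N v k m| <= Us]].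
Proof.
have L0 := reg_L reg.
have tau0 : 0 < tau by case: kam => _ _ [F [w [_ _ [_ t0 _] _]]].
have [Ck Ck0 orbit] := kam_orbit_dense kam L0.
have [P P0 hP] := DpH_coercive hH B.
have Us0 : 0 <= P + `|c| by rewrite addr_ge0.
have [h hpos hconv] := H_uniformly_convex hH P.
have [C1 C10 hC1] := H_second_difference hH P.
have [C2 C20 hC2] := C1_3_strip_lipschitz (Dp_periodic (ham_periodic hH)) (DpH_C1 hH) P.
pose J := jump_const h C1 C2.
pose osc := error_oscillation hH reg B0 l0 driftB tau0 Us0 orbit.
pose b7 := `|osc_const U L lambda0 B (P + `|c|) Ck + 2 * total_consistency L lambda0 B|.
have J0 : 0 <= J.
  have Z0 : 0 <= 6 * C2 ^+ 2 / h + 4 * C1.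
    by apply: addr_ge0; [apply: divr_ge0; [apply: mulr_ge0 => //; exact: sqr_ge0|exact: ltW]|exact: mulr_ge0].
  apply: addr_ge0 => //; apply: addr_ge0 => //.
  by apply: divr_ge0; [exact: mulr_ge0|exact: ltW].
have b70 : 0 <= b7 by exact: normr_ge0.
exists b7, (b7 + 2 * (J + L)), (P + `|c|); split => //.
  by apply: addr_ge0 => //; apply: mulr_ge0 => //; exact: addr_ge0.
move=> N K hh v NK ll lamB gv bB vper.
have d0 : 0 < dx N :> R by exact: (dx_gt0 NK).
have d1 : dx N <= 1 :> R by have := dx_le NK (R := R); lra.
have [|/andP[k0 k1] rho0 rhoE [dk drho] _] := rate_facts tau0 (_ : 0 < dx N <= 1); first by rewrite d0.
have sU k m : even_node k m -> `|slope N v k m| <= P + `|c|.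
  move=> em; have := hP _ _ _ (bB k m em) => h1.
  rewrite -[X in `|X| <= _](addKr c) addrC.
  by apply: (le_trans (ler_normB _ _)); rewrite lerD2r.
have [a ha] : exists a : R, forall k m, ~~ even_node k m ->
        `|grid_error N K vbar v k m + a| <= b7 * dx N `^ (2 * (1 + tau))^-1.
  have [a ha] := osc N K hh v NK ll lamB gv bB sU vper.
  exists a => k m om; apply: (le_trans (ha k m om)); rewrite ler_wpM2r ?powR_ge0//.
  exact: ler_norm.
split => //; first by exists a.
move=> k m em.
have urec k' m' : even_node k' m' -> slope N v k'.+1 (m' + 1) = (slope N v k' m' + slope N v k' (m' + 2)) / 2
    - lam N K / 2 * (H (xm N (m' + 2)) (tk K k') (c + slope N v k' (m' + 2)) - H (xm N m') (tk K k') (c + slope N v k' m')).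
  move=> em'; have := slope_step NK gv em'.
  have dt0 : 0 < dt K :> R by exact: (dt_gt0 NK).
  set s1 := slope N v k'.+1 _; set s2 := slope N v k' m' + _; set D := H _ _ _ - _.
  have E : s1 = s2 / 2 + dt K * ((s1 - s2 / 2) / dt K) by field; rewrite gt_eqF.
  move=> h1; rewrite E.
  have -> : (s1 - s2 / 2) / dt K = - (D / (2 * dx N)) by move: h1; lra.
  by rewrite /lam; field; rewrite gt_eqF.
have uP k' m' : even_node k' m' -> `|c + slope N v k' m'| <= P by move=> em'; exact: hP (bB _ _ em').
have ub k' m' : even_node k' m' -> `|lam N K * Dp H (xm N m') (tk K k') (c + slope N v k' m')| <= 1.
  by move=> em'; apply: (lam_le1 NK lamB); exact: bB.
have hC2' x y t p : `|p| <= P -> `|Dp H x t p - Dp H y t p| <= C2 * `|x - y|.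
  by move=> pP; have := hC2 x t p y t p pP pP; rewrite !subrr normr0 !addr0.
have per_m k' m' : even_node k' m' -> slope N v k' (m' + (2 * N)%:Z) = slope N v k' m'.
  move=> em'; rewrite /slope addrAC (addrAC m' _ (- 1)) !(grid_periodic gv)//.
    by rewrite even_nodeB1 em'.
  by rewrite even_nodeD1 em'.
have per_k k' m' : even_node k' m' -> slope N v (k' + 2 * K) m' = slope N v k' m'.
  move=> em'; rewrite /slope !(grid_time_periodic hH NK gv vper)//.
    by rewrite even_nodeB1 em'.
  by rewrite even_nodeD1 em'.
have jb m' : even_node k m' -> slope N v k (m' + 2) - slope N v k m' <= J * dx N.
  by apply: (jump_bound hpos C10 C20 hconv hC1 hC2' NK urec uP ub per_m per_k).
set rho := dx N `^ (4 * (1 + tau))^-1 in rho0 rhoE drho *.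
pose n := (Num.truncn (rho / dx N)).+1.
have nlow : rho <= n%:R * dx N by rewrite -ler_pdivrMr// ltW// truncnS_gt.
have nup : n%:R * dx N <= 2 * rho.
  rewrite /n -natr1 mulrDl mul1r.
  have : (Num.truncn (rho / dx N))%:R <= rho / dx N by rewrite truncn_le divr_ge0// ltW.
  by rewrite ler_pdivlMr//; lra.
have n0 : (0 < n)%N by [].
have := slope_error reg NK J0 jb (ha k) em n0.
move=> h1; apply: (le_trans h1); rewrite -rhoE.
have p1 : 0 < n%:R * dx N :> R := lt_le_trans rho0 nlow.
have e1 : b7 * rho ^+ 2 / (n%:R * dx N) <= b7 * rho.
  by rewrite ler_pdivrMr// expr2 -!mulrA ler_wpM2l// ler_wpM2l// ltW.
have e2 : n%:R * ((J + L) * dx N) <= 2 * (J + L) * rho.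
  have := ler_wpM2l (addr_ge0 J0 L0) nup; lra.
lra.
Qed.

End Convergence.

(** * Correspondence of the two schemes *)

Lemma half_shift (m : int) (N : nat) :
  ((m + (2 * N)%:Z + 1) %/ 2)%Z = ((m + 1) %/ 2)%Z + N%:Z.
Proof.
have -> : m + (2 * N)%:Z + 1 = N%:Z * 2 + (m + 1) by rewrite PoszM mulrC addrAC addrC.
by rewrite divzMDl // addrC.
Qed.

Section SchemeSolutions.
Context {R : realType}.
Variables (H : R -> R -> R -> R) (hH : hamiltonian H) (c : R).
Let perH := ham_periodic hH.

Section Mesh.
Variables (N K : nat).
Hypothesis NK : (0 < N <= K)%N.
Local Notation dx := (dx N : R).
Local Notation dt := (dt K : R).
Local Notation x_ m := (xm N m : R).
Local Notation t_ k := (tk K k : R).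

(** The scheme for $v$ solved for the new level, at all integers $m$ instead of one parity
    class, so that periodicity is preserved without side conditions. *)
Fixpoint scheme_orbit (h : R) (w : int -> R) (k : nat) : int -> R :=
  if k is k'.+1 then fun m =>
    let v := scheme_orbit h w k' in
    (v (m - 1) + v (m + 1)) / 2
    - dt * (H (x_ m) (t_ k') (c + (v (m + 1) - v (m - 1)) / (2 * dx)) - h)
  else w.

Lemma scheme_orbit_solution h w : (forall m, w (m + (2 * N)%:Z) = w m) ->
  grid_solution H c N K h (scheme_orbit h w).
Proof.
move=> wper; have dt0 : 0 < dt by exact: (dt_gt0 NK).
have per k m : scheme_orbit h w k (m + (2 * N)%:Z) = scheme_orbit h w k m.
  elim: k m => [|k IH] m; first exact: wper.
  have xp : x_ (m + (2 * N)%:Z) = x_ m + 1 by have := xm_period NK m 1 (R := R); rewrite mulr1.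
  rewrite /= addrAC (addrAC m _ 1) !IH xp; congr (_ - dt * (_ - h)).
  by rewrite (perH _).1.
split=> k m em /=; last exact: per.
set v := scheme_orbit h w k; set X := H _ _ _.
by field; rewrite gt_eqF.
Qed.

Lemma slope_sum_zero (h : R) (v : nat -> int -> R) : grid_solution H c N K h v ->
  \sum_(i < N) slope N v 0 (2 * i%:Z) = 0.
Proof.
move=> gv; have x0 : 0 < dx by exact: (dx_gt0 NK).
have tele n : \sum_(i < n) slope N v 0 (2 * i%:Z) = (v 0%N (2 * n%:Z - 1) - v 0%N (- 1)) / (2 * dx).
  elim: n => [|n IH]; first by rewrite big_ord0 mulr0 sub0r subrr mul0r.
  rewrite big_ord_recr /= IH /slope -mulrDl; congr (_ / _).
  have -> : 2 * n.+1%:Z - 1 = 2 * n%:Z + 1 :> int by rewrite intS; lia.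
  lra.
have -> := tele N.
by rewrite -[2 * N%:Z]/((2 * N)%:Z) (addrC (2 * N)%:Z) (grid_periodic gv)// subrr mul0r.
Qed.

(** The discrete slopes of a solution for $v$ solve the scheme for $u$; the step
    function built on the initial slopes is admissible data with these very cell
    averages. *)
Lemma slope_u_scheme (h : R) (v : nat -> int -> R) (r : R) : grid_solution H c N K h v ->
    (forall m, even_node 0 m -> `|slope N v 0 m| <= r) ->
  exists u0, Linf_r0 r u0 /\ u_scheme H c N K u0 (slope N v).
Proof.
move=> gv sr; have x0 : 0 < dx by exact: (dx_gt0 NK).
have N0 : (0 < N)%N by case/andP: NK.
have ev (i : int) : even_node 0 (2 * i) by have := even_nodeDn 0 0 i; rewrite add0r.
have srB i : `|slope N v 0 (2 * i)| <= r by exact: sr (ev i).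
have per k m : even_node k m -> slope N v k (m + (2 * N)%:Z) = slope N v k m.
  move=> em; rewrite /slope addrAC (addrAC m _ (- 1)) !(grid_periodic gv)//.
    by rewrite even_nodeB1 em.
  by rewrite even_nodeD1 em.
exists (step_function N (slope N v 0)); split.
  by apply: step_function_Linf_r0 => //; [move=> i; exact: per|exact: slope_sum_zero gv].
split=> [k m em|k m em|m em].
- exact: (slope_step NK gv em).
- exact: per.
- have [i ->] : exists i, m = 2 * i.
    by exists (m %/ 2)%Z; move: em; rewrite /even_node; lia.
  rewrite (step_cell_integral N0 srB); field.
  by rewrite gt_eqF.
Qed.

Lemma int_primitive (g : int -> R) : exists f : int -> R, forall i, f (i + 1) - f i = g i.
Proof.
exists (fun i => match i with Posz n => \sum_(j < n) g j%:Z
                            | Negz n => - \sum_(j < n.+1) g (- j.+1%:Z) end).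
case=> [n|[|n]].
- have -> : n%:Z + 1 = n.+1%:Z by rewrite -addn1 PoszD.
  by rewrite big_ord_recr /= addrAC subrr add0r.
- have -> : Negz 0 + 1 = 0%:Z by [].
  by rewrite big_ord0 big_ord1 sub0r opprK.
- have -> : Negz n.+1 + 1 = Negz n by rewrite !NegzE; lia.
  by rewrite [X in _ - - X]big_ord_recr /= opprK addrA addNr add0r.
Qed.

(** Conversely a space-time periodic solution for $u$ of zero mean is the slope of a
    solution for $v$; subtracting its growth over one period, which is the same at all
    nodes, from the constant $h$ makes that solution periodic as well. *)
Lemma periodic_primitive (u : nat -> int -> R) :
    (forall k m, even_node k m ->
       (u k.+1 (m + 1) - (u k m + u k (m + 2)) / 2) / dt
       + (H (x_ (m + 2)) (t_ k) (c + u k (m + 2)) - H (x_ m) (t_ k) (c + u k m)) / (2 * dx) = 0) ->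
    (forall m, even_node 0 m -> u 0%N (m + (2 * N)%:Z) = u 0%N m) ->
    \sum_(i < N) u 0%N (2 * i%:Z) = 0 ->
    (forall m, even_node 0 m -> u (2 * K)%N m = u 0%N m) ->
  exists h v, [/\ grid_solution H c N K h v,
    forall k m, even_node k m -> slope N v k m = u k m &
    forall m, ~~ even_node 0 m -> v (2 * K)%N m = v 0%N m].
Proof.
move=> urec uper u0 utime.
have x0 : 0 < dx by exact: (dx_gt0 NK).
have dt0 : 0 < dt by exact: (dt_gt0 NK).
have ev (i : int) : even_node 0 (2 * i) by have := even_nodeDn 0 0 i; rewrite add0r.
have [P hP] := int_primitive (fun i => 2 * dx * u 0%N (2 * i)).
have PN i : P (i + N%:Z) = P i.
  have sumP n j : P (j + n%:Z) - P j = \sum_(a < n) (2 * dx * u 0%N (2 * (j + a%:Z))).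
    elim: n => [|n IH]; first by rewrite big_ord0 addr0 subrr.
    rewrite big_ord_recr /= -IH -hP; have -> : j + n.+1%:Z = j + n%:Z + 1 by rewrite -addn1 PoszD addrA.
    lra.
  have base : P N%:Z = P 0.
    have := sumP N 0; rewrite add0r.
    under eq_bigr do rewrite add0r.
    by rewrite -big_distrr /= u0 mulr0 => /eqP; rewrite subr_eq0 => /eqP.
  have shift j : P (j + 1 + N%:Z) - P (j + N%:Z) = P (j + 1) - P j.
    by rewrite addrAC !hP mulrDr -[2 * N%:Z]/((2 * N)%:Z) uper.
  have up n : P (n%:Z + N%:Z) = P n%:Z.
    elim: n => [|n IH]; first by rewrite add0r.
    have := shift n%:Z; have -> : n.+1%:Z = n%:Z + 1 by rewrite -addn1 PoszD.
    by rewrite IH; lra.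
  have down n : P (- n%:Z + N%:Z) = P (- n%:Z).
    elim: n => [|n IH]; first by rewrite oppr0 add0r.
    have := shift (- n.+1%:Z); have -> : - n.+1%:Z + 1 = - n%:Z by rewrite -addn1 PoszD opprD addrNK.
    by rewrite IH; lra.
  case: i => n; first exact: up.
  by rewrite NegzE; exact: down.
pose w m := P ((m + 1) %/ 2)%Z.
have wper m : w (m + (2 * N)%:Z) = w m.
  by rewrite /w half_shift PN.
pose V := scheme_orbit 0 w.
have gV := scheme_orbit_solution 0 wper.
have V0 m : even_node 0 m -> slope N V 0 m = u 0%N m.
  move=> em; have [i ->] : exists i, m = 2 * i.
    by exists (m %/ 2)%Z; move: em; rewrite /even_node; lia.
  rewrite /slope /V /= /w.
  have -> : ((2 * i + 1 + 1) %/ 2)%Z = i + 1 by lia.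
  have -> : ((2 * i - 1 + 1) %/ 2)%Z = i by lia.
  by rewrite hP; field; rewrite gt_eqF.
have sV k m : even_node k m -> slope N V k m = u k m.
  elim: k m => [|k IH] m; first exact: V0.
  rewrite even_nodeSl => om.
  have em : even_node k (m - 1) by rewrite even_nodeB1.
  have em2 : even_node k (m - 1 + 2) by rewrite even_nodeD2.
  have h1 := slope_step NK gV em; have h2 := urec _ _ em.
  rewrite !(IH _ em) !(IH _ em2) subrK in h1; rewrite subrK in h2.
  have := etrans h1 (esym h2) => /addIr.
  by move=> /(mulIf (invr_neq0 (lt0r_neq0 dt0))) /addIr.
pose kap := V (2 * K)%N 1 - V 0%N 1.
have on1 : ~~ even_node 0 1 by [].
have on n (i : int) : ~~ even_node (2 * n) (2 * i + 1) by rewrite /even_node; lia.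
have cst (i : int) : V (2 * K)%N (2 * i + 1) - V 0%N (2 * i + 1) = kap.
  have st j : V (2 * K)%N (2 * (j + 1) + 1) - V 0%N (2 * (j + 1) + 1) = V (2 * K)%N (2 * j + 1) - V 0%N (2 * j + 1).
    pose m := 2 * (j + 1); have em : even_node 0 m by exact: ev.
    have emK : even_node (2 * K) m by rewrite -[(2 * K)%N]add0n even_node_time.
    have s1 := sV _ _ emK; have s2 := sV _ _ em; rewrite (utime _ em) -s2 in s1.
    have -> : 2 * j + 1 = m - 1 by rewrite /m; lia.
    move: s1; rewrite /slope => /(mulIf (invr_neq0 (lt0r_neq0 (mulr_gt0 (ltr0n R 2 : 0 < 2) x0)))).
    by rewrite -/m; lra.
  have up n : V (2 * K)%N (2 * n%:Z + 1) - V 0%N (2 * n%:Z + 1) = kap.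
    elim: n => [|n IH]; first by rewrite mulr0 add0r.
    have -> : n.+1%:Z = n%:Z + 1 by rewrite -addn1 PoszD.
    by rewrite st IH.
  have down n : V (2 * K)%N (2 * (- n%:Z) + 1) - V 0%N (2 * (- n%:Z) + 1) = kap.
    elim: n => [|n IH]; first by rewrite oppr0 mulr0 add0r.
    have E : - n.+1%:Z + 1 = - n%:Z by rewrite -addn1 PoszD opprD addrNK.
    by rewrite -st E IH.
  by case: i => n; [exact: up|rewrite NegzE; exact: down].
pose v k m := V k m - kap * t_ k.
have vs k m : slope N v k m = slope N V k m.
  by rewrite /slope /v; congr (_ / _); lra.
exists (- kap), v; split.
- split=> k m em.
    rewrite -/(slope N v k m) vs; have [rec _] := gV; have := rec k m em.
    rewrite -/(slope N V k m) -/V /v tkS; set X := H _ _ _ => h1.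
    have -> : (V k.+1 m - kap * (t_ k + dt) - (V k (m - 1) - kap * t_ k + (V k (m + 1) - kap * t_ k)) / 2) / dt
      = (V k.+1 m - (V k (m - 1) + V k (m + 1)) / 2) / dt - kap by field; rewrite gt_eqF.
    by rewrite addrAC h1 sub0r.
  by have [_ per] := gV; rewrite /v /V per.
- by move=> k m em; rewrite vs sV.
- move=> m om; have [i ->] : exists i, m = 2 * i + 1.
    by exists ((m - 1) %/ 2)%Z; move: om; rewrite /even_node; lia.
  by rewrite /v (tk_one NK) /tk mul0r mulr0 subr0 mulr1 -(cst i); lra.
Qed.

End Mesh.
End SchemeSolutions.

(** * The speed of the exact characteristics *)

Section Windows.
Context {R : realType}.
Implicit Types (a x y z d e n : R).

Lemma window_close a x z d n : 0 <= d -> `|a - x| <= 2 * d -> a <= z -> z <= a + 2 * d * n ->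
  `|z - x| <= d * (2 * n + 4).
Proof. by move=> d0; rewrite !ler_norml => /andP[? ?] ? ?; apply/andP; split; lra. Qed.

Lemma cell_close x y d e n : 0 <= e -> 0 <= n -> x <= y -> y < x + d -> d <= e ->
  `|x - y| <= e * (2 * n + 4).
Proof.
by move=> e0 n0; have := mulr_ge0 e0 n0; rewrite ler_norml => ? ? ? ?; apply/andP; split; lra.
Qed.

End Windows.

Section SpeedBound.
Context {R : realType}.
Variables (H : R -> R -> R -> R) (hH : hamiltonian H) (c hbar U L : R) (ubar vbar : R -> R -> R).
Hypothesis reg : regular_solution H c hbar ubar vbar U L.
Variables (lambda0 B r delta : R) (N0 K0 : nat).
Hypotheses (B0 : 0 <= B) (delta0 : 0 < delta) (NK0 : (0 < N0 <= K0)%N).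
Hypothesis hl0 : 0 < lambda0 <= lam N0 K0.
Hypothesis lamB : lam N0 K0 * B < 1.
(** The meshes $(MN_0,MK_0)$ share one $\lambda$ and fall below $\delta$ for large $M$. *)
Hypothesis stable : forall M v, (0 < M)%N -> dx (M * N0) <= delta ->
  grid_solution H c (M * N0) (M * K0) hbar v ->
  (forall m, even_node 0 m -> `|slope (M * N0) v 0 m| <= r) ->
  forall k m, even_node k m ->
    `|Dp H (xm (M * N0) m) (tk (M * K0) k) (c + slope (M * N0) v k m)| <= B.
Hypothesis initial : forall x, `|ubar x 0| <= r.

Local Notation la := (lam N0 K0 : R).

Lemma dx_refine M : (0 < M)%N -> dx (M * N0) = dx N0 / M%:R :> R.
Proof.
move=> M0; have n0 : 0 < N0%:R :> R by exact: (N_gt0 NK0).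
have m0 : 0 < M%:R :> R by rewrite ltr0n.
by rewrite /dx natrM; field; rewrite !gt_eqF.
Qed.

Lemma lam_refine M : (0 < M)%N -> lam (M * N0) (M * K0) = la.
Proof.
move=> M0; have n0 : 0 < N0%:R :> R by exact: (N_gt0 NK0).
have k0 : 0 < K0%:R :> R by exact: (K_gt0 NK0).
have m0 : 0 < M%:R :> R by rewrite ltr0n.
by rewrite /lam /dx /dt !natrM; field; rewrite !gt_eqF.
Qed.

Lemma refine_mesh M : (0 < M)%N -> (0 < M * N0 <= M * K0)%N.
Proof. by case/andP: NK0 => n0 nk M0; rewrite muln_gt0 M0 n0 leq_mul2l nk orbT. Qed.

Lemma signed_increment (sg q : R) N K v k m n : (0 < N <= K)%N -> even_node k m ->
    (forall i, (i < n)%N -> sg * slope N v k (m + 2 * i%:Z) <= q) ->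
  sg * (v k (m - 1 + 2 * n%:Z) - v k (m - 1)) <= 2 * dx N * n%:R * q.
Proof.
move=> NK em; have x0 : 0 < dx N :> R by exact: (dx_gt0 NK).
elim: n => [|n IH] hq; first by rewrite !(mulr0, mul0r, addr0, subrr).
have h1 := slope_increment NK v k (m + 2 * n%:Z).
have E1 : m - 1 + 2 * n%:Z = m + 2 * n%:Z - 1 by rewrite addrAC.
have E2 : m - 1 + 2 * n.+1%:Z = m + 2 * n%:Z + 1 by rewrite odd_shiftS E1 subrK.
have {}IH := IH (fun i ii => hq i (ltnW ii)).
rewrite E1 in IH; rewrite E2.
have h2 := ler_wpM2l (mulr_ge0 (ler0n R 2) (ltW x0)) (hq n (leqnn _)).
rewrite -[n.+1%:R]natr1.
have -> : v k (m + 2 * n%:Z + 1) - v k (m - 1) = (v k (m + 2 * n%:Z + 1) - v k (m + 2 * n%:Z - 1)) + (v k (m + 2 * n%:Z - 1) - v k (m - 1)) by lra.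
rewrite h1; lra.
Qed.

Section Step.
Variables (t' : R).
Hypothesis t'0 : 0 <= t'.
Hypothesis before : forall s x, 0 <= s -> s < t' -> `|la * drift H c ubar x s| <= 1.

(** Up to time $t'$ the scheme is monotone along the exact solution, hence uniformly
    $O(\Delta x)$-close to it; averaged over a fixed large number of cells, its slopes
    must therefore come within $\rho$ of the exact slope at $(x_1,t')$, or go beyond it, from
    either side according to the sign. *)
Lemma slopes_reach (sg x1 rho : R) : `|sg| = 1 -> 0 < rho ->
  exists N K k m v, [/\ even_node k m, `|xm N m - x1| <= rho, `|tk K k - t'| <= rho,
    `|Dp H (xm N m) (tk K k) (c + slope N v k m)| <= B &
    sg * ubar x1 t' - rho <= sg * slope N v k m].
Proof.
move=> sg1 rho0; have L0 := reg_L reg.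
have la0 : 0 < lambda0 by case/andP: hl0.
pose Cc := total_consistency L lambda0 B.
have Cc0 : 0 <= Cc by apply: addr_ge0; apply: (consistency_ge0 reg hl0).
(* Over n cells a slope deficit rho / 2 amounts to n rho dx, which exceeds the error
   2 Cc t' dx of the values at the two ends. *)
have [n n0 hn] : exists2 n : nat, (0 < n)%N & 2 * Cc * t' < n%:R * rho.
  exists (Num.truncn (2 * Cc * t' / rho)).+1 => //.
  by rewrite -ltr_pdivrMr// truncnS_gt.
pose rho' := Num.min rho (rho / (4 * (L + 1))).
have L1 : 0 < L + 1 by rewrite ltr_wpDl.
have r'0 : 0 < rho' by rewrite lt_min rho0 divr_gt0// mulr_gt0.
have r'r : rho' <= rho by rewrite ge_min lexx.
have r'L : 4 * (L * rho') <= rho.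
  have : rho' <= rho / (4 * (L + 1)) by rewrite ge_min lexx orbT.
  rewrite ler_pdivlMr ?mulr_gt0//; have := ltW r'0; lra.
have dx00 : 0 < dx N0 :> R by exact: (dx_gt0 NK0).
(* Fine enough for stability, and for n cells to fit into a window of length rho'. *)
pose M := (Num.truncn (dx N0 / delta + dx N0 * (2 * n%:R + 4) / rho')).+1.
have M0 : (0 < M)%N by [].
have MR : 0 < M%:R :> R by rewrite ltr0n.
have Mb : dx N0 / delta + dx N0 * (2 * n%:R + 4) / rho' < M%:R by exact: truncnS_gt.
have q0 : 0 <= 2 * n%:R + 4 :> R by rewrite addr_ge0// mulr_ge0.
have p1 : 0 <= dx N0 / delta :> R by rewrite divr_ge0// ltW.
have p2 : 0 <= dx N0 * (2 * n%:R + 4) / rho' by apply: divr_ge0; [apply: mulr_ge0 => //|]; exact: ltW.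
pose N := (M * N0)%N; pose K := (M * K0)%N.
have NK : (0 < N <= K)%N by exact: refine_mesh.
have dxE : dx N = dx N0 / M%:R :> R by exact: dx_refine.
have dxd : dx N <= delta.
  rewrite dxE ler_pdivrMr// mulrC -ler_pdivrMr//; move: Mb p2; lra.
have dxr : dx N * (2 * n%:R + 4) <= rho'.
  rewrite dxE mulrAC ler_pdivrMr// -ler_pdivrMl// mulrC; move: Mb p1; lra.
have lamE' : lam N K = la by exact: lam_refine.
have hl : 0 < lambda0 <= lam N K by rewrite lamE'.
have lB : lam N K * B <= 1 by rewrite lamE' ltW.
have x0 : 0 < dx N :> R by exact: (dx_gt0 NK).
have dt0 : 0 < dt K :> R by exact: (dt_gt0 NK).
have dtx : dt K <= dx N :> R by exact: (dt_le_dx NK).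
pose w m : R := vbar (xm N m) 0.
have wper m : w (m + (2 * N)%:Z) = w m.
  have := xm_period NK m 1 (R := R); rewrite mulr1 /w => ->.
  by rewrite (reg_v_periodic reg).1.
pose v := scheme_orbit H c N K hbar w.
have gv : grid_solution H c N K hbar v by exact: scheme_orbit_solution.
have v0 m : even_node 0 m -> `|slope N v 0 m| <= r.
  move=> _; rewrite /slope /v /= /w normrM normfV (gtr0_norm (_ : 0 < 2 * dx N)) ?mulr_gt0//.
  rewrite ler_pdivrMr ?mulr_gt0//.
  have := @derivative_bound_lipschitz R (fun y => vbar y 0) (fun y => ubar y 0) r
    (xm N (m - 1)) (xm N (m + 1)) (xm N (m + 1)) (xm N (m - 1))
    (fun z _ => reg_v_derive reg z 0) (fun z _ => initial z).
  have le : xm N (m - 1) <= xm N (m + 1) :> R by rewrite xmB1 xmD1; lra.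
  rewrite !lexx le => /(_ isT isT).
  by rewrite xmB1 xmD1 (_ : xm N m + dx N - (xm N m - dx N) = 2 * dx N) ?(gtr0_norm (_ : 0 < 2 * dx N)) ?mulr_gt0//; lra.
have bB := stable M0 dxd gv v0.
pose k := Num.truncn (t' / dt K).
have tk0 : tk K k <= t' by rewrite /tk -ler_pdivlMr// truncn_le divr_ge0// ltW.
have tk1 : t' < tk K k + dt K.
  by rewrite -tkS /tk -ltr_pdivrMr// truncnS_gt.
pose e := grid_error N K vbar v.
have e0 m : ~~ even_node 0 m -> e 0%N m <= 0.
  by move=> _; rewrite /e /grid_error /v /= /w /tk mul0r subrr.
have e0' m : ~~ even_node 0 m -> - e 0%N m <= 0.
  by move=> _; rewrite /e /grid_error /v /= /w /tk mul0r subrr oppr0.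
pose kap := dt K * (hbar - hbar) + Cc * (dt K * dx N).
have stu j : (j < k)%N -> monotone_step N K e (fun k m => drift H c ubar (xm N m) (tk K k)) kap j.
  move=> jk; apply: (upper_monotone_step hH reg B0 NK hl gv) => x; rewrite lamE'.
  apply: before; first by rewrite /tk mulr_ge0// ltW.
  by apply: lt_le_trans tk0; rewrite /tk ltr_pM2r// ltr_nat.
have stl j : (j < k)%N -> monotone_step N K (fun k m => - e k m) (fun k m => Dp H (xm N m) (tk K k) (c + slope N v k m)) kap j.
  by move=> _; apply: (lower_monotone_step hH reg NK hl lB gv bB).
have eb m : ~~ even_node k m -> `|e k m| <= Cc * t' * dx N.
  move=> om.
  have a1 := maximum_principle stu e0 (leqnn _) om.
  have a2 := maximum_principle stl e0' (leqnn _) om.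
  have h3 : k%:R * kap <= Cc * t' * dx N.
    rewrite /kap subrr mulr0 add0r (_ : _ * _ = Cc * (k%:R * dt K) * dx N); last by lra.
    by rewrite ler_wpM2r ?(ltW x0)// ler_wpM2l.
  by move: a1 a2 h3; rewrite ler_norml => ? ? ?; apply/andP; split; lra.
have [ma oma hma] := odd_node_near NK x1 k.
pose m : int := ma + 1.
have em : even_node k m by rewrite even_nodeD1 oma.
have xm2 (i : nat) : xm N (m + 2 * i%:Z) = xm N ma + dx N + 2 * dx N * i%:R :> R.
  by rewrite xmD xmD1 /(xm N (2 * _)) intrM -pmulrn; lra.
suff : exists2 i, (i < n)%N & sg * ubar x1 t' - rho <= sg * slope N v k (m + 2 * i%:Z).
  move=> [i ii hi]; exists N, K, k, (m + 2 * i%:Z), v; split.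
  - by rewrite even_nodeDn.
  - apply: le_trans r'r; apply: le_trans dxr; rewrite xm2.
    have i1 : i%:R + 1 <= n%:R :> R by rewrite natr1 ler_nat.
    have di := mulr_ge0 (ltW x0) (ler0n R i); have dn := ler_wpM2l (ltW x0) i1.
    by apply: window_close (ltW x0) hma _ _; [move: di|move: dn]; lra.
  - by apply: le_trans r'r; apply: le_trans dxr; exact: cell_close (ltW x0) _ tk0 tk1 dtx.
  - by apply: bB; rewrite even_nodeDn.
  - exact: hi.
apply: contrapT => no.
have small i : (i < n)%N -> sg * slope N v k (m + 2 * i%:Z) <= sg * ubar x1 t' - rho.
  by move=> ii; rewrite leNgt; apply/negP => h; apply: no; exists i => //; exact: ltW.
have inc := signed_increment NK em small.
have xa : m - 1 = ma by rewrite /m addrK.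
rewrite xa in inc.
have omb : ~~ even_node k (ma + 2 * n%:Z) by rewrite even_nodeDn.
have xb : xm N (ma + 2 * n%:Z) = xm N ma + 2 * dx N * n%:R :> R.
  by rewrite xmD /(xm N (2 * _)) intrM -pmulrn; lra.
have ln : 0 <= 2 * dx N * n%:R :> R by apply: mulr_ge0 => //; apply: mulr_ge0 => //; exact: ltW.
have lab : xm N ma <= xm N (ma + 2 * n%:Z) :> R by rewrite xb lerDl.
have [|z /andP[za zb] zE] := mvt lab (f := fun y => vbar y (tk K k)) (df := fun y => ubar y (tk K k)).
  by move=> z _; exact: (reg_v_derive reg).
have zu : `|ubar z (tk K k) - ubar x1 t'| <= rho / 2.
  apply: (le_trans (reg_u_lipschitz reg _ _ _ _)).
  apply: (@le_trans _ _ (L * (rho' + rho'))); last by move: r'L; lra.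
  rewrite ler_wpM2l// lerD//; apply: le_trans dxr; last exact: cell_close (ltW x0) _ tk0 tk1 dtx.
  by apply: window_close (ltW x0) hma za _; rewrite -xb.
have zs : - (rho / 2) <= sg * (ubar z (tk K k) - ubar x1 t').
  by rewrite lerNl -mulrN; apply: (le_trans (ler_norm _)); rewrite normrM sg1 mul1r normrN.
have eb1 := eb _ oma; have eb2 := eb _ omb.
have es : - (2 * (Cc * t' * dx N)) <= sg * (e k (ma + 2 * n%:Z) - e k ma).
  rewrite lerNl -mulrN; apply: (le_trans (ler_norm _)); rewrite normrM sg1 mul1r normrN.
  by apply: (le_trans (ler_normB _ _)); move: eb1 eb2; lra.
rewrite /e /grid_error in es.
have nd : 2 * Cc * t' * dx N < n%:R * rho * dx N by rewrite ltr_pM2r.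
have zz := ler_wpM2l ln zs.
have {}zE : vbar (xm N (ma + 2 * n%:Z)) (tk K k) = vbar (xm N ma) (tk K k) + ubar z (tk K k) * (2 * dx N * n%:R).
  by rewrite -[LHS](subrK (vbar (xm N ma) (tk K k))) zE addrC xb (addrC (xm N ma)) addrK.
rewrite zE in es.
move: es inc zz nd; lra.
Qed.

(** At the nodes found by the previous lemma $H_p$ is bounded by $B$; as $H_p$ increases
    with $p$, slopes from above and from below give the two bounds on the drift. *)
Lemma speed_bound_step x : `|drift H c ubar x t'| <= B.
Proof.
have P0 : 0 <= U := le_trans (normr_ge0 _) (reg_U reg x t').
have [C C0 hC] := C1_3_strip_lipschitz (Dp_periodic (ham_periodic hH)) (DpH_C1 hH) (`|c| + U + 1).
have inP : `|c + ubar x t'| <= `|c| + U + 1.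
  by rewrite (le_trans (ler_normD _ _))// -addrA lerD2l (le_trans (reg_U reg _ _))// lerDl.
have inP' d : `|d| <= 1 -> `|c + ubar x t' + d| <= `|c| + U + 1.
  move=> d1; apply: (le_trans (ler_normD _ _)); apply: lerD => //.
  by rewrite (le_trans (ler_normD _ _))// lerD2l (reg_U reg).
have close (rho : R) y s d : 0 < rho <= 1 -> `|y - x| <= rho -> `|s - t'| <= rho -> `|d| <= rho ->
    `|Dp H y s (c + ubar x t' + d) - drift H c ubar x t'| <= C * (3 * rho).
  move=> /andP[r0 r1] hy hs hd.
  apply: (le_trans (hC _ _ _ _ _ _ (inP' _ (le_trans hd r1)) inP)).
  rewrite ler_wpM2l// (_ : c + ubar x t' + d - (c + ubar x t') = d); move: hy hs hd; lra.
have eps (a b : R) : (forall rho, 0 < rho <= 1 -> a <= b + C * (3 * rho)) -> a <= b.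
  move=> h; rewrite leNgt; apply/negP => ba.
  pose rho := Num.min 1 ((a - b) / (6 * (C + 1))).
  have C1 : 0 < 6 * (C + 1) by rewrite mulr_gt0// ltr_wpDl.
  have ab : 0 < a - b by rewrite subr_gt0.
  have r0 : 0 < rho by rewrite lt_min ltr01 divr_gt0.
  have r1 : rho <= 1 by rewrite ge_min lexx.
  have : rho <= (a - b) / (6 * (C + 1)) by rewrite ge_min lexx orbT.
  rewrite ler_pdivlMr//; have := h rho; rewrite r0 r1 => /(_ isT).
  nra.
rewrite ler_norml; apply/andP; split.
- rewrite lerNl; apply: eps => rho /[dup] r01 /andP[r0 r1].
  have [|N [K [k [m [v [em hx ht hb hs]]]]]] := @slopes_reach (- 1) x rho _ r0; first by rewrite normrN normr1.
  have hm : slope N v k m <= ubar x t' + rho by lra.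
  have rr : `|rho| <= rho by rewrite gtr0_norm.
  have := close rho _ _ rho r01 hx ht rr; rewrite ler_norml => /andP[_ h1].
  have h2 : Dp H (xm N m) (tk K k) (c + slope N v k m) <= Dp H (xm N m) (tk K k) (c + ubar x t' + rho).
    by apply: (DpH_monotone hH); lra.
  by move: hb; rewrite ler_norml => /andP[h3 _]; lra.
- apply: eps => rho /[dup] r01 /andP[r0 r1].
  have [|N [K [k [m [v [em hx ht hb hs]]]]]] := @slopes_reach 1 x rho _ r0; first by rewrite normr1.
  have hm : ubar x t' - rho <= slope N v k m by lra.
  have rr : `|- rho| <= rho by rewrite normrN gtr0_norm.
  have := close rho _ _ (- rho) r01 hx ht rr; rewrite ler_norml => /andP[h1 _].
  have h2 : Dp H (xm N m) (tk K k) (c + ubar x t' - rho) <= Dp H (xm N m) (tk K k) (c + slope N v k m).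
    by apply: (DpH_monotone hH); lra.
  by move: hb; rewrite ler_norml => /andP[_ h3]; lra.
Qed.

End Step.

(** The gap between $B$ and $\lambda^{-1}$ buys a time step of fixed length, over which
    the Lipschitz drift stays below $\lambda^{-1}$ and the previous lemma restores the
    bound $B$. *)
Lemma speed_bound x t : `|drift H c ubar x t| <= B.
Proof.
have L0 := reg_L reg.
have la0 : 0 < la by apply: lt_le_trans (proj2 (andP hl0)); case/andP: hl0.
pose gap := la^-1 - B.
have gap0 : 0 < gap by rewrite subr_gt0 -[_^-1]mul1r ltr_pdivlMr// mulrC.
pose eta := gap / (L + 1).
have L1 : 0 < L + 1 by rewrite ltr_wpDl.
have eta0 : 0 < eta by rewrite divr_gt0.
have etaL : L * eta <= gap.
  have : eta * (L + 1) = gap by rewrite /eta mulfVK// gt_eqF.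
  by have := ltW eta0; lra.
have claim n : forall s y, 0 <= s -> s <= n%:R * eta -> `|drift H c ubar y s| <= B.
  elim: n => [|n IH] s y s0 sn.
    apply: speed_bound_step => // z y' z0 zs; exfalso.
    by move: (le_lt_trans z0 zs); rewrite ltNge -[X in _ <= X](mul0r eta) sn.
  apply: speed_bound_step => // z y' z0 zs.
  rewrite normrM (gtr0_norm la0) mulrC -ler_pdivlMr// mul1r.
  have [zn|nz] := leP z (n%:R * eta).
    by apply: (le_trans (IH _ _ z0 zn)); rewrite -subr_ge0 ltW.
  have n0 : 0 <= n%:R * eta by rewrite mulr_ge0// ltW.
  have h1 := IH (n%:R * eta) y' n0 (lexx _).
  have h2 := reg_drift_lipschitz reg y' z y' (n%:R * eta).
  rewrite subrr normr0 add0r (gtr0_norm (_ : 0 < z - n%:R * eta)) ?subr_gt0// in h2.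
  have h3 : L * (z - n%:R * eta) <= L * eta.
    rewrite ler_wpM2l//; move: sn; rewrite -[n.+1%:R]natr1; lra.
  rewrite -[drift H c ubar y' z](subrK (drift H c ubar y' (n%:R * eta))).
  apply: (le_trans (ler_normD _ _)); move: etaL; rewrite /gap; lra.
have per z y : drift H c ubar y (z + 1) = drift H c ubar y z.
  by rewrite /drift (reg_u_periodic reg).2 (Dp_periodic (ham_periodic hH) _).2.
have [s s01 ->] := periodic_frac (fun z => per z x) t.
case/andP: s01 => s0 _.
apply: (claim (Num.truncn (s / eta)).+1) => //.
by rewrite -ler_pdivrMr// ltW// truncnS_gt.
Qed.

End SpeedBound.

(** * From the grid to the periodic difference solutions *)

Section InitialSlice.
Context {R : realType}.
Variables (H : R -> R -> R -> R) (c0 c1 beta1 c hbar U L : R) (ubar vbar : R -> R -> R).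
Hypotheses (hbound : beta1_bound H c0 c1 beta1) (hc : c0 <= c <= c1).
Hypothesis reg : regular_solution H c hbar ubar vbar U L.
Hypothesis ent : entropy_solution H c (fun x => ubar x 0) ubar.

Let ubar_continuous t : continuous (fun x => ubar x t).
Proof.
have L0 := reg_L reg; have L1 : 0 < L + 1 by rewrite ltr_wpDl.
move=> x; apply/cvgrPdist_le => e e0.
near=> y.
have h := reg_u_lipschitz reg x t y t.
rewrite subrr normr0 addr0 in h; apply: (le_trans h).
have : `|x - y| <= e / (L + 1).
  by near: y; apply/nbhs_ballP; exists (e / (L + 1)) => [|z /ltW//]; exact: divr_gt0.
rewrite ler_pdivlMr// => h2; have := normr_ge0 (x - y); lra.
Unshelve. all: by end_near.
Qed.

(** A time-periodic solution is its own image after time one, so the universal bound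
    on that image holds at time zero; the mean vanishes because $\bar u=\bar v_x$. *)
Lemma periodic_slice_bound x : `|ubar x 0| <= beta1.
Proof.
have [px pt] := reg_u_periodic reg.
have -> : ubar x 0 = ubar x 1 by rewrite -[1]add0r pt.
suff L0 : Linf0 (fun x => ubar x 0).
  by apply: (@continuous_Linf_bound R (fun x => ubar x 1)); [exact: ubar_continuous|exact: hbound hc L0 ent].
split.
- by apply: continuous_measurable_fun; exact: (@ubar_continuous 0).
- exact: px.
- apply: (@le_lt_trans _ _ U%:E); last exact: ltry.
  by apply/Linf_normP; apply: aeW => y; exact: (reg_U reg).
- have dv z : derivable (fun y => vbar y 0) z 1 by have [] := reg_v_derive reg z 0.
  rewrite /Rintegral (@continuous_FTC2 R _ (fun y => vbar y 0)) //.
  + have [vx _] := reg_v_periodic reg.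
    by rewrite -EFinB /= -[X in vbar X 0 - _]add0r vx subrr.
  + by apply: continuous_subspaceT; exact: ubar_continuous.
  + split => [z _||]; first exact: dv.
      by apply: cvg_at_right_filter; apply: differentiable_continuous; exact/derivable1_diffP.
    by apply: cvg_at_left_filter; apply: differentiable_continuous; exact/derivable1_diffP.
  + by move=> z _; rewrite derive1E; have h := reg_v_derive reg z 0; rewrite derive_val.
Qed.

End InitialSlice.

Section Cells.
Context {R : realType}.
Variables (N K : nat).
Hypothesis NK : (0 < N <= K)%N.

Lemma space_cell (x : R) k :
  exists2 m, even_node k m & xm N (m - 1) <= x < xm N (m + 1).
Proof.
have x0 : 0 < dx N :> R by exact: (dx_gt0 NK).
have /andP[fl fu] := floor_itv (x / dx N).
set m := Num.floor (x / dx N) in fl fu.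
have h1 : xm N m <= x by rewrite /xm -ler_pdivlMr.
have h2 : x < xm N m + dx N by rewrite -xmD1 /xm -ltr_pdivrMr.
have [e|o] := boolP (even_node k m).
  by exists m => //; rewrite xmB1 xmD1; apply/andP; split; lra.
exists (m + 1); first by rewrite even_nodeD1.
by rewrite xmB1 !xmD1; apply/andP; split; lra.
Qed.

Lemma time_cell (t : R) : 0 <= t -> exists k, tk K k <= t < tk K k.+1.
Proof.
move=> t0; have dt0 : 0 < dt K :> R by exact: (dt_gt0 NK).
exists (Num.truncn (t / dt K)); rewrite /tk -ler_pdivlMr// -ltr_pdivrMr// truncnS_gt andbT.
by rewrite truncn_le// divr_ge0// ltW.
Qed.

End Cells.

Section Reconstruction.
Context {R : realType}.
Variables (H : R -> R -> R -> R) (c hbar U L : R) (ubar vbar : R -> R -> R).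
Hypothesis reg : regular_solution H c hbar ubar vbar U L.
Variables (N K : nat).
Hypothesis NK : (0 < N <= K)%N.

(** The last term collects the variation over one cell of the interpolant, of $\bar v$ in
    $x$ and of $\bar v$ in $t$. *)
Lemma interpolation_error v V (a E Us : R) : v_interp N K v V ->
    (forall k m, ~~ even_node k m -> `|grid_error N K vbar v k m + a| <= E) ->
    (forall k m, even_node k m -> `|slope N v k m| <= Us) ->
  forall x t, 0 <= t -> `|V x t + a - vbar x t| <= E + (2 * Us + 2 * U + L) * dx N.
Proof.
move=> vV hE hs x t t0.
have x0 : 0 < dx N :> R by exact: (dx_gt0 NK).
have dtx : dt K <= dx N :> R by exact: (dt_le_dx NK).
have dx2 : dx N <= 2^-1 :> R by exact: (dx_le NK).
have [k kt] := time_cell NK t0; have [m em mx] := space_cell NK x k.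
rewrite (vV k m x t em mx kt) -/(slope N v k m).
have om : ~~ even_node k (m - 1) by rewrite even_nodeB1 em.
have h1 := hE _ _ om; have h2 := hs _ _ em.
case/andP: kt; rewrite tkS => kt1 kt2.
case/andP: mx; rewrite xmB1 xmD1 => mx1 mx2.
have d0 : 0 <= x - (xm N m - dx N) by lra.
have d1 : x - (xm N m - dx N) <= 2 * dx N by lra.
have h3 : `|slope N v k m * (x - (xm N m - dx N))| <= Us * (2 * dx N).
  by rewrite normrM (ger0_norm d0) ler_pM.
have h4 := regular_v_lipschitz reg (xm N m - dx N) x (tk K k).
rewrite [X in _ <= _ * X]distrC (ger0_norm d0) in h4.
have U0 : 0 <= U := le_trans (normr_ge0 _) (reg_U reg x t).
have h4' := ler_wpM2l U0 d1.
have s0 : 0 <= t - tk K k <= 1 by apply/andP; split; lra.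
have h5 := reg_v_time reg x (tk K k) s0.
rewrite (addrC (tk K k)) subrK in h5.
have h5' : L * (t - tk K k) <= L * dx N by rewrite ler_wpM2l ?(reg_L reg)//; lra.
rewrite /grid_error xmB1 in h1.
set X := v k (m - 1) in h1 *; set S := slope N v k m * _ in h3 *.
move: h1 h3 h4 h4' h5 h5'; rewrite !ler_norml.
set V1 := vbar _ _; set V2 := vbar _ _; set V3 := vbar _ _.
by move=> /andP[? ?] /andP[? ?] /andP[? ?] ? /andP[? ?] ?; apply/andP; split; lra.
Qed.

Lemma step_error u V (E : R) : u_step N K u V ->
    (forall k m, even_node k m -> `|u k m - ubar (xm N m) (tk K k)| <= E) ->
  forall x t, 0 <= t -> `|V x t - ubar x t| <= E + 2 * L * dx N.
Proof.
move=> uV hE x t t0.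
have x0 : 0 < dx N :> R by exact: (dx_gt0 NK).
have dtx : dt K <= dx N :> R by exact: (dt_le_dx NK).
have [k kt] := time_cell NK t0; have [m em mx] := space_cell NK x k.
rewrite (uV k m x t em mx kt).
case/andP: kt; rewrite tkS => kt1 kt2.
case/andP: mx; rewrite xmB1 xmD1 => mx1 mx2.
rewrite -(subrKA (ubar (xm N m) (tk K k))); apply: (le_trans (ler_normD _ _)).
apply: lerD; first exact: hE.
apply: (le_trans (reg_u_lipschitz reg _ _ _ _)).
rewrite (mulrC 2) -mulrA ler_wpM2l ?(reg_L reg)// mulrDl mul1r.
by apply: lerD; rewrite ler_norml; apply/andP; split; lra.
Qed.

End Reconstruction.

Section PeriodicSchemes.
Context {R : realType}.
Variables (H : R -> R -> R -> R) (c r : R) (N K : nat).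
Hypothesis NK : (0 < N <= K)%N.
Local Notation mu := (@lebesgue_measure R).

(** The time level $t=1$ is the level $2K$, and the interpolation reproduces the grid
    values at the nodes; so a fixed point returns to its initial grid values. *)
Lemma periodic_v_grid h V : periodic_v_Delta H c r h N K V ->
  exists v, [/\ grid_solution H c N K h v, v_interp N K v V,
    forall m, even_node 0 m -> `|slope N v 0 m| <= r &
    forall m, ~~ even_node 0 m -> v (2 * K)%N m = v 0%N m].
Proof.
move=> [v0 [[_ lip] [v [[vrec vper vinit] vV]] V1]].
have x0 : 0 < dx N :> R by exact: (dx_gt0 NK).
have v0E m : ~~ even_node 0 m -> v 0%N m = v0 (xm N m).
  by move=> om; have := vinit (m - 1); rewrite even_nodeB1 subrK; apply.
exists v; split => //.
- move=> m em; rewrite /slope !v0E ?even_nodeD1 ?even_nodeB1 ?em//.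
  rewrite normrM normfV (gtr0_norm (_ : 0 < 2 * dx N)) ?mulr_gt0//.
  rewrite ler_pdivrMr ?mulr_gt0//.
  have /= := lip (xm N (m + 1), xm N (m - 1)) (conj I I).
  rewrite xmB1 xmD1 (_ : xm N m + dx N - (xm N m - dx N) = 2 * dx N); last by lra.
  by rewrite (gtr0_norm (_ : 0 < 2 * dx N)) ?mulr_gt0.
- move=> m om; rewrite v0E// -V1.
  have em : even_node (2 * K) (m + 1) by rewrite -[(2 * K)%N]add0n even_node_time even_nodeD1.
  have dt0 : 0 < dt K :> R by exact: (dt_gt0 NK).
  rewrite (vV (2 * K)%N (m + 1) (xm N m) 1 em).
  + by rewrite addrK subrr mulr0 addr0.
  + by rewrite addrK lexx xmD1 xmD1; lra.
  + by rewrite tkS (tk_one NK) lexx ltrDl.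
Qed.

(** The scheme samples its data by cell averages, and the solution at time one is a
    step function on the very same cells; so a fixed point returns to its initial grid
    values, and inherits the zero mean. *)
Lemma periodic_u_grid M V : (forall u0, Linf_r0 r u0 -> forall u, u_scheme H c N K u0 u ->
      forall k m, even_node k m -> `|u k m| <= M) ->
    periodic_u_Delta H c r N K V ->
  exists u0 u, [/\ Linf_r0 r u0, u_scheme H c N K u0 u, u_step N K u V,
    \sum_(i < N) u 0%N (2 * i%:Z) = 0 &
    forall m, even_node 0 m -> u (2 * K)%N m = u 0%N m].
Proof.
move=> bM [u0 [hu0 [u [us uV]] V1]].
have {}bM := bM _ hu0 _ us.
have N0 : (0 < N)%N by case/andP: NK.
have x0 : 0 < dx N :> R by exact: (dx_gt0 NK).
have dt0 : 0 < dt K :> R by exact: (dt_gt0 NK).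
have ev (i : int) : even_node 0 (2 * i) by have := even_nodeDn 0 0 i; rewrite add0r.
have evK (m : int) : even_node (2 * K) m = even_node 0 m.
  by rewrite -[(2 * K)%N]add0n even_node_time.
have [urec uper uinit] := us.
pose s := u (2 * K)%N.
have sM i : `|s (2 * i)| <= M by apply: bM; rewrite evK ev.
have sper i : s (2 * i + (2 * N)%:Z) = s (2 * i) by apply: uper; rewrite evK ev.
have [[mu0 pu0 _ iu0] _] := hu0.
have ms := measurable_step_function N0 s.
have VE x : V x 1 = step_function N s x.
  have [i ci] := step_function_cell N0 x; rewrite (step_functionE N0 s ci).
  apply: uV; first by rewrite evK ev.
  - by rewrite xmB1 xmD1.
  - by rewrite tkS (tk_one NK) lexx ltrDl.
have ae : {ae mu, forall x, step_function N s x = u0 x}.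
  by apply: (@filterS _ _ (ae_filter_ringOfSetsType mu) _ _ _ V1) => x /= <-; rewrite VE.
have time m : even_node 0 m -> u (2 * K)%N m = u 0%N m.
  move=> em; rewrite (uinit _ em) -(ae_eq_Rintegral _ _ ms mu0 ae).
  have [i ->] : exists i, m = 2 * i.
    by exists (m %/ 2)%Z; move: em; rewrite /even_node; lia.
  by rewrite (step_cell_integral N0 sM) mulrCA mulVf ?mulr1// gt_eqF// mulr_gt0.
exists u0, u; split => //.
have := step_period_integral N0 sM sper.
rewrite (ae_eq_Rintegral _ _ ms mu0 ae) iu0 => /esym/eqP; rewrite mulf_eq0 gt_eqF ?mulr_gt0// orFb => /eqP s0; rewrite -[RHS]s0.
by apply: eq_bigr => i _; rewrite /s time.
Qed.

End PeriodicSchemes.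

Theorem theorem4p2 (R : realType) (H : R -> R -> R -> R)
    (r c0 c1 beta1 lambda0 lambda1 delta : R)
    (hH : hamiltonian H) (hr : 0 < r) (hc01 : c0 <= c1)
    (hbeta1 : 0 < beta1) (hbound : beta1_bound H c0 c1 beta1)
    (hlambda : 0 < lambda0 < lambda1) (hdelta : 0 < delta)
    (hstab : stability_bounds H r c0 c1 beta1 lambda0 lambda1 delta)
    (hrbeta : beta1 + 1 <= r)
    (c nu tau : R) (hc : c0 <= c <= c1)
    (ubar : R -> R -> R) (hubar : KAM_torus H c nu tau ubar)
    (hbar : R) (vbar : R -> R -> R)
    (hvbar : periodic_viscosity_solution H c hbar vbar)
    (huv : forall x t : R, is_derive x 1 (fun y => vbar y t) (ubar x t)) :
  exists beta7 beta8 : R,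
    forall N K : nat,
      mesh_conditions H r c0 c1 lambda0 lambda1 delta N K ->
    forall (uD : R -> R -> R) (hbarD : R) (vD : R -> R -> R),
      periodic_u_Delta H c r N K uD ->
      periodic_v_Delta H c r hbarD N K vD ->
      (exists a : R, forall x t : R, 0 <= t ->
         `|(vD x t + a) - vbar x t| <= beta7 * dx N `^ (2 * (1 + tau))^-1) /\
      (forall x t : R, 0 <= t ->
         `|uD x t - ubar x t| <= beta8 * dx N `^ (4 * (1 + tau))^-1).
Proof.
have [[up ent] uC [F [omega [_ _ [_ tau0 _] _]]]] := hubar.
have [U [L reg]] := regular_solution_exists hH up uC hvbar huv.
have [l0 l01] := andP hlambda; have l1 : 0 < lambda1 by exact: lt_trans l01.
pose B := lambda1^-1; have B0 : 0 <= B by rewrite invr_ge0 ltW.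
have lamB N K : lam N K < lambda1 -> lam N K * B < 1 by move=> h; rewrite [_ * B]mulrC ltr_pdivrMl// mulr1.
(* If no mesh meets the conditions on lambda, there is nothing to prove; otherwise the
   refinements of one such mesh bound the drift. *)
have [[N0 [K0 [NK0 lam0]]]|none] := pselect (exists N0 K0,
    (0 < N0 <= K0)%N /\ lambda0 <= lam N0 K0 < lambda1); last first.
  exists 0, 0 => N K mesh; exfalso; apply: none; exists N, K.
  by split; [exact: (mesh_nat mesh)|exact: (mesh_lambda mesh)].
have stab N K u0 u : (0 < N <= K)%N -> lambda0 <= lam N K < lambda1 -> dx N <= delta ->
    Linf_r0 r u0 -> u_scheme H c N K u0 u ->
    forall k m, even_node k m -> `|Dp H (xm N m) (tk K k) (c + u k m)| <= B.
  move=> NK lamNK dxd hu0 hu k m em.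
  by have [/(_ u hu k m em)/andP[] ] := hstab N K NK lamNK dxd c u0 hc hu0.
have stabv N K h v : (0 < N <= K)%N -> lambda0 <= lam N K < lambda1 -> dx N <= delta ->
    grid_solution H c N K h v -> (forall m, even_node 0 m -> `|slope N v 0 m| <= r) ->
    forall k m, even_node k m -> `|Dp H (xm N m) (tk K k) (c + slope N v k m)| <= B.
  move=> NK lamNK dxd gv sr; have [u0 [hu0 hu]] := slope_u_scheme NK gv sr.
  exact: stab NK lamNK dxd hu0 hu.
have driftB x t : `|drift H c ubar x t| <= B.
  have [lam00 lam01] := andP lam0.
  apply: (speed_bound hH reg B0 hdelta NK0 (lambda0 := lambda0) (r := r)).
  - by rewrite l0.
  - exact: lamB.
  - move=> M v M0; apply: stabv; first exact: refine_mesh.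
    by rewrite (lam_refine NK0).
  - move=> y; apply: le_trans (periodic_slice_bound hbound hc reg ent y) _.
    by apply: le_trans hrbeta; rewrite lerDl.
have [b7 [b8 [Us [b70 b80 Us0 conv]]]] := grid_convergence hH reg B0 l0 driftB hubar.
have [Um Um0 coer] := DpH_coercive hH B.
exists (b7 + (2 * Us + 2 * U + L)), (b8 + 2 * L) => N K mesh uD hbarD vD hu hv.
have NK := mesh_nat mesh; have lamNK := mesh_lambda mesh; have dxd := mesh_dx mesh.
have [lamNK0 lamNK1] := andP lamNK.
have lB : lam N K * B <= 1 by apply/ltW/lamB.
have L0 := reg_L reg; have U0 : 0 <= U := le_trans (normr_ge0 _) (reg_U reg 0 0).
have d0 : 0 < dx N :> R by exact: (dx_gt0 NK).
have [|_ _ _ [dk dr] _] := rate_facts tau0 (_ : 0 < dx N <= 1).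
  by rewrite d0 (le_trans (dx_le NK))// invf_le1// ler1n.
split.
- have [v [gv vV sr vper]] := periodic_v_grid NK hv.
  have bB := stabv N K hbarD v NK lamNK dxd gv sr.
  have [[a ha] _ hs] := conv N K hbarD v NK lamNK0 lB gv bB vper.
  exists a => x t t0; apply: (le_trans (interpolation_error reg NK vV ha hs x t0)).
  rewrite [leRHS]mulrDl lerD2l ler_wpM2l//.
  by apply: addr_ge0 => //; apply: addr_ge0; apply: mulr_ge0.
- have bM u0 : Linf_r0 r u0 -> forall u, u_scheme H c N K u0 u ->
      forall k m, even_node k m -> `|u k m| <= Um + `|c|.
    move=> hu0 u us k m em; have := coer _ _ _ (stab _ _ _ _ NK lamNK dxd hu0 us k m em).
    rewrite -[X in _ -> `|X| <= _](addKr c) => h; apply: (le_trans (ler_normD _ _)).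
    by rewrite normrN addrC lerD2r.
  have [u0 [u [hu0 us uV usum utime]]] := periodic_u_grid NK bM hu.
  have [urec uper _] := us.
  have [h [v [gv vu vper]]] := periodic_primitive hH NK urec (uper 0%N) usum utime.
  have bB k m : even_node k m -> `|Dp H (xm N m) (tk K k) (c + slope N v k m)| <= B.
    by move=> em; rewrite vu//; exact: stab NK lamNK dxd hu0 us _ _ em.
  have [_ hs _] := conv N K h v NK lamNK0 lB gv bB vper.
  have hE k m : even_node k m -> `|u k m - ubar (xm N m) (tk K k)| <= b8 * dx N `^ (4 * (1 + tau))^-1.
    by move=> em; rewrite -vu//; exact: hs.
  move=> x t t0; apply: (le_trans (step_error reg NK uV hE x t0)).
  by rewrite [leRHS]mulrDl lerD2l ler_wpM2l// mulr_ge0.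
Qed.
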